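(* Let $\pi=(p_1,\dots,p_n)$ be positive integers with $p_1\leqslant\dots\leqslant p_n$, and let $\lambda(u)=(\lambda_1(u),\dots,\lambda_n(u))$ be an $n$-tuple of monic polynomials with complex coefficients, $\lambda_i(u)=(u+\lambda_i^{(1)})\cdots(u+\lambda_i^{(p_i)})$, such that $\lambda_i^{(k)}-\lambda_{i+1}^{(k)}\in\mathbb{Z}_+$ for all $i=1,\dots,n-1$ and $k=1,\dots,p_i$, and $\lambda_i^{(k)}-\lambda_j^{(m)}\notin\mathbb{Z}$ for all $i,j$ and all $k\ne m$ (with $1\leqslant k\leqslant p_i$, $1\leqslant m\leqslant p_j$). Then the vectors $\zeta_{\Lambda}$, parameterized by all Gelfand--Tsetlin patterns $\Lambda(u)$ associated with the highest weight $\lambda(u)$, form a basis of the irreducible highest weight representation $L(\lambda(u))$ of the finite $W$-algebra $W(\pi)$.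
   Context: All algebras are associative unital algebras over $\mathbb{C}$; $\mathbb{Z}_+$ is the set of nonnegative integers. **Shifted Yangian.** For $\pi=(p_1,\dots,p_n)$ with $p_1\leqslant\dots\leqslant p_n$, $\mathrm{Y}_\pi(\mathfrak{gl}_n)$ is generated by $d_i^{(r)}$ ($1\leqslant i\leqslant n$, $r\geqslant1$), $f_i^{(r)}$ ($1\leqslant i\leqslant n-1$, $r\geqslant 1$), $e_i^{(r)}$ ($1\leqslant i\leqslant n-1$, $r\geqslant p_{i+1}-p_i+1$), subject to the following relations for all admissible indices, where $d_i^{(0)}=1$ and $d_i^{\prime(r)}$ are determined by $\sum_{t=0}^r d_i^{(t)}d_i^{\prime(r-t)}=\delta_{r0}$ for $r\geqslant0$: $[d_i^{(r)},d_j^{(s)}]=0$; $[e_i^{(r)},f_j^{(s)}]=-\delta_{ij}\sum_{t=0}^{r+s-1}d_i^{\prime(t)}d_{i+1}^{(r+s-t-1)}$; $[d_i^{(r)},e_j^{(s)}]=(\delta_{ij}-\delta_{i,j+1})\sum_{t=0}^{r-1}d_i^{(t)}e_j^{(r+s-t-1)}$; $[d_i^{(r)},f_j^{(s)}]=(\delta_{i,j+1}-\delta_{ij})\sum_{t=0}^{r-1}f_j^{(r+s-t-1)}d_i^{(t)}$; $[e_i^{(r)},e_i^{(s+1)}]-[e_i^{(r+1)},e_i^{(s)}]=e_i^{(r)}e_i^{(s)}+e_i^{(s)}e_i^{(r)}$; $[f_i^{(r+1)},f_i^{(s)}]-[f_i^{(r)},f_i^{(s+1)}]=f_i^{(r)}f_i^{(s)}+f_i^{(s)}f_i^{(r)}$;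 $[e_i^{(r)},e_{i+1}^{(s+1)}]-[e_i^{(r+1)},e_{i+1}^{(s)}]=-e_i^{(r)}e_{i+1}^{(s)}$; $[f_i^{(r+1)},f_{i+1}^{(s)}]-[f_i^{(r)},f_{i+1}^{(s+1)}]=-f_{i+1}^{(s)}f_i^{(r)}$; $[e_i^{(r)},e_j^{(s)}]=0=[f_i^{(r)},f_j^{(s)}]$ if $|i-j|>1$; $[e_i^{(r)},[e_i^{(s)},e_j^{(t)}]]+[e_i^{(s)},[e_i^{(r)},e_j^{(t)}]]=0$ and $[f_i^{(r)},[f_i^{(s)},f_j^{(t)}]]+[f_i^{(s)},[f_i^{(r)},f_j^{(t)}]]=0$ if $|i-j|=1$. **Finite $W$-algebra.** $W(\pi)$ is the quotient of $\mathrm{Y}_\pi(\mathfrak{gl}_n)$ by the two-sided ideal generated by all $d_1^{(r)}$ with $r\geqslant p_1+1$; images of elements are denoted by the same symbols. **Series.** $d_i(u)=1+\sum_{r\geqslant1}d_i^{(r)}u^{-r}$, $f_i(u)=\sum_{r\geqslant1}f_i^{(r)}u^{-r}$, $e_i(u)=\sum_{r\geqslant p_{i+1}-p_i+1}e_i^{(r)}u^{-r}$; $a_i(u)=d_1(u)d_2(u-1)\cdots d_i(u-i+1)$, $b_i(u)=a_i(u)e_i(u-i+1)$, $c_i(u)=f_i(u-i+1)a_i(u)$. In $W(\pi)$ set $B_i(u)=u^{p_1}(u-1)^{p_2}\cdots(u-i+2)^{p_{i-1}}(u-i+1)^{p_{i+1}}\,b_i(u)$ and $C_i(u)=u^{p_1}(u-1)^{p_2}\cdots(u-i+1)^{p_i}\,c_i(u)$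 for $1\leqslant i\leqslant n-1$. These are polynomials in $u$ with coefficients in $W(\pi)$, so they can be evaluated at complex numbers. One has $[C_i(u),C_i(v)]=0$. **Highest weight representation.** $L(\lambda(u))$ is the irreducible representation of $W(\pi)$ generated by a nonzero vector $\zeta$ (the highest vector) with $B_i(u)\zeta=0$ for $1\leqslant i\leqslant n-1$ and $u^{p_i}d_i(u)\zeta=\lambda_i(u)\zeta$ for $1\leqslant i\leqslant n$. **Patterns.** A Gelfand--Tsetlin pattern $\Lambda(u)$ associated with $\lambda(u)$ is an array of monic polynomials $\lambda_{ri}(u)=(u+\lambda_{ri}^{(1)})\cdots(u+\lambda_{ri}^{(p_i)})$, $1\leqslant i\leqslant r\leqslant n$, with $\lambda_{ni}^{(k)}=\lambda_i^{(k)}$ and $\lambda_{r+1,i}^{(k)}-\lambda_{ri}^{(k)}\in\mathbb{Z}_+$, $\lambda_{ri}^{(k)}-\lambda_{r+1,i+1}^{(k)}\in\mathbb{Z}_+$ for $k=1,\dots,p_i$ and $1\leqslant i\leqslant r\leqslant n-1$. Put $l_i^{(k)}=\lambda_i^{(k)}-i+1$ and $l_{ri}^{(k)}=\lambda_{ri}^{(k)}-i+1$. **Vectors $\zeta_\Lambda$.** For a pattern $\Lambda(u)$, $$\zeta_\Lambda=\prod_{i=1,\dots,n-1}^{\longrightarrow}\Big\{P_{n-1,i}\,P_{n-2,i}\cdots P_{i,i}\Big\}\,\zeta,\qquad P_{r,i}=\prod_{k=1}^{p_i}\Big(C_r(-l_{ri}^{(k)}-1)\cdots C_r(-l_i^{(k)}+1)\,C_r(-l_i^{(k)})\Big),$$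 where the arrow means that the factor with $i=1$ is leftmost and $i=n-1$ rightmost, and the inner product has $l_i^{(k)}-l_{ri}^{(k)}$ factors (empty product equal to $1$ if $l_i^{(k)}=l_{ri}^{(k)}$). *)

(* Defs.v *)
From HB Require Import structures.
From mathcomp Require Import all_boot all_order all_algebra.
From mathcomp Require Import generic_quotient ring_quotient.
From mathcomp Require Import finmap monalg.
From mathcomp Require Import boolp classical_sets reals complex.

Set Implicit Arguments.
Unset Strict Implicit.
Unset Printing Implicit Defensive.

Import Order.TTheory GRing.Theory.
Local Open Scope ring_scope.
Local Open Scope quotient_scope.

Definition free_algebra (K : comNzRingType) (X : choiceType) :=
  {malg K[{fmonom X}]}.

Section FreeAlgebra.
Variables (K : comNzRingType) (X : choiceType).

HB.instance Definition _ := GRing.Lalgebra.on (free_algebra K X).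

Let free_scalerAr (c : K) (x y : free_algebra K X) :
  c *: (x * y) = x * (c *: y).
Proof.
apply/malgP=> k; rewrite mcoeffZ mcoeffMl.
rewrite (mcoeffMlw _ (fsubset_refl (msupp x)) (msuppZ_le c y)) mulr_sumr.
apply: eq_bigr => k1 _; rewrite mulr_sumr; apply: eq_bigr => k2 _.
by rewrite mcoeffZ mulrCA mulrnAr.
Qed.

HB.instance Definition _ :=
  GRing.LSemiAlgebra_isSemiAlgebra.Build K (free_algebra K X) free_scalerAr.

Definition free_gen (x : X) : free_algebra K X := << fmu x >>.

Definition free_counit : free_algebra K X -> K := mcoeff (mone : {fmonom X}).

HB.instance Definition _ := GRing.RMorphism.on free_counit.

Lemma free_counit_gen x : free_counit (free_gen x) = 0.
Proof.
rewrite /free_counit /free_gen mcoeffU; case: eqP => //.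
move=> /(congr1 (@fmonom_val X)).
by rewrite fmU fm1.
Qed.

End FreeAlgebra.

Section QuotientAlgebra.
Variables (K : comNzRingType) (A : algType K) (S : set A).

Inductive ideal_gen : A -> Prop :=
| ideal_gen_sub x of S x : ideal_gen x
| ideal_gen0 : ideal_gen 0
| ideal_genB x y of ideal_gen x & ideal_gen y : ideal_gen (x - y)
| ideal_genM a x b of ideal_gen x : ideal_gen (a * x * b).

Definition ideal_pred : {pred A} := fun x => `[< ideal_gen x >].

Let ideal_predB : zmod_closed ideal_pred.
Proof.
split=> [|x y /asboolP Ix /asboolP Iy]; apply/asboolP; first exact: ideal_gen0.
exact: ideal_genB.
Qed.

HB.instance Definition _ := GRing.isZmodClosed.Build A ideal_pred ideal_predB.

Definition quot_alg := Quotient.quot ideal_pred.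

HB.instance Definition _ := GRing.Zmodule.on quot_alg.
HB.instance Definition _ := EqQuotient.on quot_alg.

Definition quot_pi (x : A) : quot_alg := \pi_(quot_alg) x.

Lemma quot_piP x y : quot_pi x = quot_pi y <-> ideal_gen (x - y).
Proof.
have -> : (quot_pi x = quot_pi y) <-> (x == y %[mod quot_alg]).
  by split=> [/eqP|/eqP].
by rewrite -Quotient.idealrBE; split=> /asboolP.
Qed.

Lemma quot_pi_surj (x : quot_alg) : quot_pi (repr x) = x.
Proof. exact: reprK. Qed.

Lemma ideal_gen_repr x : ideal_gen (repr (quot_pi x) - x).
Proof. by apply/quot_piP; rewrite quot_pi_surj. Qed.

Lemma quot_pi_is_zmod_morphism : zmod_morphism quot_pi.
Proof. exact: raddfB. Qed.
HB.instance Definition _ :=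
  GRing.isZmodMorphism.Build A quot_alg quot_pi quot_pi_is_zmod_morphism.

Definition quot_one := quot_pi 1.
Definition quot_mul (x y : quot_alg) := quot_pi (repr x * repr y).
Definition quot_scale (c : K) (x : quot_alg) := quot_pi (c *: repr x).

Let ideal_genMl a x : ideal_gen x -> ideal_gen (a * x).
Proof. by move=> Ix; rewrite -[_ * _]mulr1; apply: ideal_genM. Qed.

Let ideal_genMr x b : ideal_gen x -> ideal_gen (x * b).
Proof. by move=> Ix; rewrite -[x]mul1r; apply: ideal_genM. Qed.

Let ideal_genD x y : ideal_gen x -> ideal_gen y -> ideal_gen (x + y).
Proof.
move=> Ix Iy; rewrite -[y]opprK -[- y]sub0r.
by apply: ideal_genB => //; apply: ideal_genB => //; apply: ideal_gen0.
Qed.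

Let quot_piM x y : quot_pi (x * y) = quot_mul (quot_pi x) (quot_pi y).
Proof.
apply/esym/quot_piP; set x' := repr _; set y' := repr _.
have -> : x' * y' - x * y = (x' - x) * y' + x * (y' - y).
  by rewrite mulrBl mulrBr addrA subrK.
by apply: ideal_genD; [apply: ideal_genMr | apply: ideal_genMl];
  apply: ideal_gen_repr.
Qed.

Let quot_piZ c x : quot_pi (c *: x) = quot_scale c (quot_pi x).
Proof.
apply/esym/quot_piP; rewrite -scalerBr -[_ - _]mul1r scalerAl.
by apply: ideal_genMl; apply: ideal_gen_repr.
Qed.

Let quotW (P : quot_alg -> Prop) : (forall x, P (quot_pi x)) -> forall x, P x.
Proof. by move=> h x; rewrite -[x]quot_pi_surj. Qed.

Let quot_mulA : associative quot_mul.
Proof. by do 3!elim/quotW=> ?; rewrite -!quot_piM mulrA. Qed.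
Let quot_mul1 : left_id quot_one quot_mul.
Proof. by elim/quotW=> ?; rewrite -!quot_piM mul1r. Qed.
Let quot_1mul : right_id quot_one quot_mul.
Proof. by elim/quotW=> ?; rewrite -!quot_piM mulr1. Qed.
Let quot_mulDl : left_distributive quot_mul +%R.
Proof. by do 3!elim/quotW=> ?; rewrite -!(quot_piM, raddfD) mulrDl. Qed.
Let quot_mulDr : right_distributive quot_mul +%R.
Proof. by do 3!elim/quotW=> ?; rewrite -!(quot_piM, raddfD) mulrDr. Qed.

HB.instance Definition _ := GRing.Zmodule_isPzRing.Build quot_alg
  quot_mulA quot_mul1 quot_1mul quot_mulDl quot_mulDr.

Let quot_scaleA a b x :
  quot_scale a (quot_scale b x) = quot_scale (a * b) x.
Proof. by elim/quotW: x => x; rewrite -!quot_piZ scalerA. Qed.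
Let quot_scale1 : left_id 1 quot_scale.
Proof. by elim/quotW=> ?; rewrite -!quot_piZ scale1r. Qed.
Let quot_scaleDr : right_distributive quot_scale +%R.
Proof.
move=> c; elim/quotW=> x; elim/quotW=> y.
by rewrite -raddfD -!quot_piZ -raddfD scalerDr.
Qed.
Let quot_scaleDl x : {morph quot_scale^~ x : a b / a + b}.
Proof.
by move=> a b; elim/quotW: x => x; rewrite -!quot_piZ -raddfD scalerDl.
Qed.

HB.instance Definition _ := GRing.Zmodule_isLmodule.Build K quot_alg
  quot_scaleA quot_scale1 quot_scaleDr quot_scaleDl.

Lemma quot_pi_is_monoid_morphism : monoid_morphism quot_pi.
Proof. by split=> // x y; rewrite quot_piM. Qed.
HB.instance Definition _ :=
  GRing.isMonoidMorphism.Build A quot_alg quot_pi quot_pi_is_monoid_morphism.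
Lemma quot_pi_is_scalable : scalable quot_pi.
Proof. by move=> c x; rewrite quot_piZ. Qed.
HB.instance Definition _ :=
  GRing.isScalable.Build K A quot_alg *:%R quot_pi quot_pi_is_scalable.

Lemma quot_scaleAl c (x y : quot_alg) : c *: (x * y) = (c *: x) * y.
Proof.
rewrite -[x]quot_pi_surj -[y]quot_pi_surj.
by rewrite -rmorphM -!linearZ -rmorphM /= scalerAl.
Qed.

Lemma quot_scaleAr c (x y : quot_alg) : c *: (x * y) = x * (c *: y).
Proof.
rewrite -[x]quot_pi_surj -[y]quot_pi_surj.
by rewrite -rmorphM -!linearZ -rmorphM /= scalerAr.
Qed.

Section Lift.
Variables (B : pzRingType) (f : {rmorphism A -> B}).
Hypothesis fS : forall x, S x -> f x = 0.

Definition quot_lift (x : quot_alg) : B := f (repr x).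

Lemma quot_lift_pi x : quot_lift (quot_pi x) = f x.
Proof.
have f0 y : ideal_gen y -> f y = 0.
  elim=> {y} [y /fS//||y z _ y0 _ z0|a y b _ y0]; first exact: rmorph0.
    by rewrite rmorphB y0 z0 subrr.
  by rewrite !rmorphM y0 mulr0 mul0r.
by apply/eqP; rewrite -subr_eq0 -rmorphB f0 //; apply: ideal_gen_repr.
Qed.

Lemma quot_lift_is_zmod_morphism : zmod_morphism quot_lift.
Proof.
by elim/quotW=> x; elim/quotW=> y; rewrite -rmorphB !quot_lift_pi rmorphB.
Qed.
Lemma quot_lift_is_monoid_morphism : monoid_morphism quot_lift.
Proof.
split=> [|]; first by rewrite -[1]/(quot_pi 1) quot_lift_pi rmorph1.
by elim/quotW=> x; elim/quotW=> y; rewrite -rmorphM !quot_lift_pi rmorphM.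
Qed.
End Lift.

End QuotientAlgebra.

Definition lie (A : pzRingType) (x y : A) : A := x * y - y * x.

(* A series s : nat -> A stands for s(u) = \sum_(r >= 0) s r u^(-r). *)

Section Series.
Variables (K : comNzRingType) (A : algType K).
Implicit Types (s t : nat -> A) (Q : {poly K}).

Definition ser1 : nat -> A := fun r => (r == 0)%:R.

Definition ser_mul s t : nat -> A :=
  fun r => \sum_(k < r.+1) s k * t (r - k)%N.

(* s(u - c), re-expanded in u^-1 by means of
   (u - c)^(-r) = \sum_(m >= r) 'C(m - 1, m - r) c^(m - r) u^(-m) *)
Definition ser_shift (c : K) s : nat -> A :=
  fun m => \sum_(r < m.+1) ('C(m.-1, m - r)%:R * c ^+ (m - r)) *: s r.

(* The coefficients d'(0), ..., d'(m) of the right inverse of a series d with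
   d 0 = 1, computed by d'(m) = - \sum_(1 <= t <= m) d(t) d'(m - t) *)
Fixpoint ser_inv_coefs s (m : nat) : seq A :=
  if m is m'.+1 then
    let c := ser_inv_coefs s m' in
    rcons c (- \sum_(t < m'.+1) s t.+1 * c`_(m' - t))
  else [:: 1].

Definition ser_inv s : nat -> A := fun m => (ser_inv_coefs s m)`_m.

(* Coefficient of u^m, for any integer m, in the product Q(u) s(u) *)
Definition laurent_coef Q s (m : int) : A :=
  \sum_(j < size Q | (m <= j%:Z)%R) Q`_j *: s (absz (j%:Z - m)).

(* The polynomial part of Q(u) s(u). It is equal to Q(u) s(u) as soon as the
   latter has no terms in negative powers of u. *)
Definition laurent_poly Q s : {poly A} :=
  \poly_(m < size Q) laurent_coef Q s m%:Z.

Lemma size_ser_inv_coefs s m : size (ser_inv_coefs s m) = m.+1.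
Proof. by elim: m => //= m IHm; rewrite size_rcons IHm. Qed.

Lemma ser_inv_coefs_nth s m k :
  (k <= m)%N -> (ser_inv_coefs s m)`_k = ser_inv s k.
Proof.
elim: m => [|m IHm]; first by case: k.
rewrite leq_eqVlt => /predU1P[-> //|]; rewrite ltnS => le_km /=.
by rewrite nth_rcons size_ser_inv_coefs ltnS le_km IHm.
Qed.

Lemma ser_invP s : s 0%N = 1 ->
  forall r, \sum_(t < r.+1) s t * ser_inv s (r - t)%N = (r == 0%N)%:R.
Proof.
move=> s0 [|m]; first by rewrite big_ord1 s0 mul1r.
rewrite big_ord_recl s0 mul1r subn0 {1}/ser_inv /= nth_rcons size_ser_inv_coefs.
rewrite ltnn eqxx; apply/eqP; rewrite addrC subr_eq0; apply/eqP.
by apply: eq_bigr => t _; rewrite subSS ser_inv_coefs_nth // leq_subr.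
Qed.

End Series.

(* Sd i r, Sf i r, Se i r stand for d_i^(r), f_i^(r), e_i^(r). Indices are
   1-based, and pi = (p 1, ..., p n): no other value of p is used. *)
Inductive symbol := Sd (i r : nat) | Sf (i r : nat) | Se (i r : nat).

Definition symbol_code (x : symbol) : nat * (nat * nat) :=
  match x with
  | Sd i r => (0, (i, r)) | Sf i r => (1, (i, r)) | Se i r => (2, (i, r))
  end%N.
Definition symbol_decode (c : nat * (nat * nat)) : symbol :=
  match c with
  | (0, (i, r)) => Sd i r | (1, (i, r)) => Sf i r | (_, (i, r)) => Se i r
  end%N.
Lemma symbol_codeK : cancel symbol_code symbol_decode.
Proof. by case. Qed.

HB.instance Definition _ := Choice.copy symbol (can_type symbol_codeK).

Section Yangian.
Variables (K : comNzRingType) (n : nat) (p : nat -> nat).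

Definition admissible (x : symbol) : bool :=
  match x with
  | Sd i r => (1 <= i <= n) && (1 <= r)
  | Sf i r => (1 <= i < n) && (1 <= r)
  | Se i r => (1 <= i < n) && (p i.+1 - p i + 1 <= r)
  end%N.

Definition generator := {x : symbol | admissible x}.

Notation FA := (free_algebra K generator).

(* A symbol as an element of the free algebra; 0 if it is not admissible. *)
Definition sym (x : symbol) : FA :=
  if insub x is Some g then free_gen K (g : generator) else 0.

Definition fd (i r : nat) : FA := if r == 0%N then 1 else sym (Sd i r).
Definition ff (i r : nat) : FA := sym (Sf i r).
Definition fe (i r : nat) : FA := sym (Se i r).
Definition fd' (i : nat) : nat -> FA := ser_inv (fd i).

(* yangian_rel x y stands for the relation x = y. *)
Inductive yangian_rel : FA -> FA -> Prop :=
| rel_dd i j r s of admissible (Sd i r) & admissible (Sd j s) :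
    yangian_rel (lie (fd i r) (fd j s)) 0
| rel_ef i j r s of admissible (Se i r) & admissible (Sf j s) :
    yangian_rel (lie (fe i r) (ff j s))
      (- (i == j)%:R * \sum_(0 <= t < r + s) fd' i t * fd i.+1 (r + s - t - 1))
| rel_de i j r s of admissible (Sd i r) & admissible (Se j s) :
    yangian_rel (lie (fd i r) (fe j s))
      (((i == j)%:R - (i == j.+1)%:R) *
        \sum_(0 <= t < r) fd i t * fe j (r + s - t - 1))
| rel_df i j r s of admissible (Sd i r) & admissible (Sf j s) :
    yangian_rel (lie (fd i r) (ff j s))
      (((i == j.+1)%:R - (i == j)%:R) *
        \sum_(0 <= t < r) ff j (r + s - t - 1) * fd i t)
| rel_ee i r s of admissible (Se i r) & admissible (Se i s) :
    yangian_rel (lie (fe i r) (fe i s.+1) - lie (fe i r.+1) (fe i s))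
      (fe i r * fe i s + fe i s * fe i r)
| rel_ff i r s of admissible (Sf i r) & admissible (Sf i s) :
    yangian_rel (lie (ff i r.+1) (ff i s) - lie (ff i r) (ff i s.+1))
      (ff i r * ff i s + ff i s * ff i r)
| rel_ee1 i r s of admissible (Se i r) & admissible (Se i.+1 s) :
    yangian_rel (lie (fe i r) (fe i.+1 s.+1) - lie (fe i r.+1) (fe i.+1 s))
      (- (fe i r * fe i.+1 s))
| rel_ff1 i r s of admissible (Sf i r) & admissible (Sf i.+1 s) :
    yangian_rel (lie (ff i r.+1) (ff i.+1 s) - lie (ff i r) (ff i.+1 s.+1))
      (- (ff i.+1 s * ff i r))
| rel_ee0 i j r s of admissible (Se i r) & admissible (Se j s)
    & (i.+1 < j)%N || (j.+1 < i)%N :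
    yangian_rel (lie (fe i r) (fe j s)) 0
| rel_ff0 i j r s of admissible (Sf i r) & admissible (Sf j s)
    & (i.+1 < j)%N || (j.+1 < i)%N :
    yangian_rel (lie (ff i r) (ff j s)) 0
| rel_eee i j r s t of admissible (Se i r) & admissible (Se i s)
    & admissible (Se j t) & (j == i.+1) || (i == j.+1) :
    yangian_rel (lie (fe i r) (lie (fe i s) (fe j t))
                 + lie (fe i s) (lie (fe i r) (fe j t))) 0
| rel_fff i j r s t of admissible (Sf i r) & admissible (Sf i s)
    & admissible (Sf j t) & (j == i.+1) || (i == j.+1) :
    yangian_rel (lie (ff i r) (lie (ff i s) (ff j t))
                 + lie (ff i s) (lie (ff i r) (ff j t))) 0.

Definition yangian_relators : set FA :=
  [set z | exists x y, yangian_rel x y /\ z = x - y].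

Definition yangian := quot_alg yangian_relators.

HB.instance Definition _ := GRing.PzRing.on yangian.
HB.instance Definition _ := GRing.Lmodule.on yangian.

(* All the relators have zero augmentation, hence 1 <> 0 in the quotient. *)
Local Notation eps := (@free_counit K generator).

Let epsM x y : eps (x * y) = eps x * eps y. Proof. exact: rmorphM. Qed.
Let epsB x y : eps (x - y) = eps x - eps y. Proof. exact: rmorphB. Qed.
Let epsD x y : eps (x + y) = eps x + eps y. Proof. exact: rmorphD. Qed.
Let epsN x : eps (- x) = - eps x. Proof. exact: rmorphN. Qed.
Let eps0 : eps 0 = 0. Proof. exact: rmorph0. Qed.
Let eps_nat m : eps m%:R = m%:R. Proof. exact: rmorph_nat. Qed.
Let eps_sum m (F : nat -> FA) :
  eps (\sum_(0 <= t < m) F t) = \sum_(0 <= t < m) eps (F t).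
Proof. exact: rmorph_sum. Qed.

Let eps_sym x : eps (sym x) = 0.
Proof. by rewrite /sym; case: insub => [g|]; rewrite ?free_counit_gen. Qed.

Let eps_d i r : eps (fd i r) = (r == 0%N)%:R.
Proof. by rewrite /fd; case: r => [|r]; rewrite ?(eps_nat 1) ?eps_sym. Qed.

Let eps_d' i m : eps (fd' i m) = (m == 0%N)%:R.
Proof.
have := congr1 eps (ser_invP (erefl : fd i 0%N = 1) m).
rewrite eps_nat => <-.
rewrite -(big_mkord xpredT (fun t => fd i t * fd' i (m - t)%N)) eps_sum.
rewrite big_nat_recl // big1 => [|t _]; rewrite epsM eps_d ?mul0r //.
by rewrite mul1r subn0 addr0.
Qed.

Let eps_lie x y : eps (lie x y) = 0.
Proof. by rewrite /lie epsB !epsM mulrC subrr. Qed.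

Let epsM0 x y : eps y = 0 -> eps (x * y) = 0.
Proof. by move=> y0; rewrite epsM y0 mulr0. Qed.
Let epsD0 x y : eps x = 0 -> eps y = 0 -> eps (x + y) = 0.
Proof. by move=> x0 y0; rewrite epsD x0 y0 addr0. Qed.
Let epsN0 x : eps x = 0 -> eps (- x) = 0.
Proof. by move=> x0; rewrite epsN x0 oppr0. Qed.
Let eps_sum0 m (F : nat -> FA) : (forall t, (t < m)%N -> eps (F t) = 0) ->
  eps (\sum_(0 <= t < m) F t) = 0.
Proof.
move=> F0; rewrite eps_sum big1_seq // => t /=.
by rewrite mem_index_iota => /andP[_]; apply: F0.
Qed.

Let eps_relators x : yangian_relators x -> eps x = 0.
Proof.
case=> a [b [ab ->]]; suff: eps a = 0 /\ eps b = 0.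
  by case=> a0 b0; rewrite epsB a0 b0 subrr.
case: ab => [i j r s _ _|i j r s /andP[_ r_gt0] /andP[_ s_gt0]|i j r s _ _
  |i j r s _ _|i r s _ _|i r s _ _|i r s _ _|i r s _ _|i j r s _ _ _
  |i j r s _ _ _|i j r s t _ _ _ _|i j r s t _ _ _ _]; split.
- exact: eps_lie.
- exact: eps0.
- exact: eps_lie.
- apply: epsM0; apply: eps_sum0 => t t_lt.
  rewrite epsM eps_d' eps_d; case: t t_lt => [|t] _; rewrite ?mul0r //.
  have: (1 < r + s)%N.
    by rewrite (leq_trans _ (leq_add r_gt0 s_gt0)) // addn1 addnS.
  by case: (r + s)%N => [|[|m]] //= _; rewrite mulr0.
- exact: eps_lie.
- by apply: epsM0; apply: eps_sum0 => t _; apply: epsM0; apply: eps_sym.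
- exact: eps_lie.
- by apply: epsM0; apply: eps_sum0 => t _; rewrite epsM eps_sym mul0r.
- by apply: epsD0; [|apply: epsN0]; apply: eps_lie.
- by apply: epsD0; apply: epsM0; apply: eps_sym.
- by apply: epsD0; [|apply: epsN0]; apply: eps_lie.
- by apply: epsD0; apply: epsM0; apply: eps_sym.
- by apply: epsD0; [|apply: epsN0]; apply: eps_lie.
- by apply: epsN0; apply: epsM0; apply: eps_sym.
- by apply: epsD0; [|apply: epsN0]; apply: eps_lie.
- by apply: epsN0; apply: epsM0; apply: eps_sym.
- exact: eps_lie.
- exact: eps0.
- exact: eps_lie.
- exact: eps0.
- by apply: epsD0; apply: eps_lie.
- exact: eps0.
- by apply: epsD0; apply: eps_lie.
- exact: eps0.
Qed.

Definition yangian_counit : yangian -> K :=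
  quot_lift (S := yangian_relators) eps.

HB.instance Definition _ := GRing.isZmodMorphism.Build yangian K yangian_counit
  (quot_lift_is_zmod_morphism eps_relators).
HB.instance Definition _ :=
  GRing.isMonoidMorphism.Build yangian K yangian_counit
  (quot_lift_is_monoid_morphism eps_relators).

Let yangian_nz : (1 : yangian) != 0.
Proof.
apply/eqP => /(congr1 yangian_counit); rewrite rmorph1 rmorph0.
exact/eqP/oner_neq0.
Qed.

HB.instance Definition _ := GRing.PzSemiRing_isNonZero.Build yangian yangian_nz.
HB.instance Definition _ := GRing.LSemiModule_isLSemiAlgebra.Build K yangian
  (@quot_scaleAl K FA yangian_relators).
HB.instance Definition _ := GRing.LSemiAlgebra_isSemiAlgebra.Build K yangian
  (@quot_scaleAr K FA yangian_relators).

Definition yd (i r : nat) : yangian := quot_pi yangian_relators (fd i r).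
Definition yf (i r : nat) : yangian := quot_pi yangian_relators (ff i r).
Definition ye (i r : nat) : yangian := quot_pi yangian_relators (fe i r).

Definition W_relators : set yangian :=
  [set yd 1 r | r in [set r | (p 1 + 1 <= r)%N]].

Definition W_algebra := quot_alg W_relators.

HB.instance Definition _ := GRing.PzRing.on W_algebra.
HB.instance Definition _ := GRing.Lmodule.on W_algebra.

Let W_counit_relators x : W_relators x -> yangian_counit x = 0.
Proof.
case=> r /=; rewrite addn1 => r_gt <-; rewrite /yangian_counit quot_lift_pi //.
apply: etrans (eps_d _ _) _.
by rewrite gtn_eqF // (leq_ltn_trans _ r_gt).
Qed.

Let W_nz : (1 : W_algebra) != 0.
Proof.
have [l1 _] := quot_lift_is_monoid_morphism W_counit_relators.
have := quot_lift_is_zmod_morphism W_counit_relators 0 0; rewrite !subrr => l0.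
by apply/eqP => w10; have := oner_neq0 K; rewrite -l1 w10 l0 eqxx.
Qed.

HB.instance Definition _ := GRing.PzSemiRing_isNonZero.Build W_algebra W_nz.
HB.instance Definition _ := GRing.LSemiModule_isLSemiAlgebra.Build K W_algebra
  (@quot_scaleAl K yangian W_relators).
HB.instance Definition _ := GRing.LSemiAlgebra_isSemiAlgebra.Build K W_algebra
  (@quot_scaleAr K yangian W_relators).

Definition wd (i r : nat) : W_algebra := quot_pi W_relators (yd i r).
Definition wf (i r : nat) : W_algebra := quot_pi W_relators (yf i r).
Definition we (i r : nat) : W_algebra := quot_pi W_relators (ye i r).

(* As series, wf i has no constant term and we i starts at
   r = p (i + 1) - p i + 1, since inadmissible symbols are sent to 0. *)
Fixpoint a_ser (i : nat) : nat -> W_algebra :=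
  if i is i'.+1 then ser_mul (a_ser i') (ser_shift i'%:R (wd i)) else ser1 _.

Definition b_ser (i : nat) : nat -> W_algebra :=
  ser_mul (a_ser i) (ser_shift (i.-1)%:R (we i)).

Definition c_ser (i : nat) : nat -> W_algebra :=
  ser_mul (ser_shift (i.-1)%:R (wf i)) (a_ser i).

(* u^(p 1) (u - 1)^(p 2) ... (u - i + 2)^(p (i - 1)) (u - i + 1)^(p (i + 1)) *)
Definition B_factor (i : nat) : {poly K} :=
  (\prod_(1 <= k < i) ('X - (k.-1)%:R%:P) ^+ p k)
    * ('X - (i.-1)%:R%:P) ^+ p i.+1.

(* u^(p 1) (u - 1)^(p 2) ... (u - i + 1)^(p i) *)
Definition C_factor (i : nat) : {poly K} :=
  \prod_(1 <= k < i.+1) ('X - (k.-1)%:R%:P) ^+ p k.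

(* Coefficient of u^m in B_i(u) = B_factor i * b_i(u) *)
Definition B_coef (i : nat) (m : int) : W_algebra :=
  laurent_coef (B_factor i) (b_ser i) m.

(* C_i(u) = C_factor i * c_i(u), which is known to be a polynomial in W(pi) *)
Definition C_poly (i : nat) : {poly W_algebra} :=
  laurent_poly (C_factor i) (c_ser i).

Definition C_at (i : nat) (z : K) : W_algebra := (C_poly i).[z%:A].

End Yangian.

Record representation (K : comNzRingType) (A : algType K) (V : lmodType K) := {
  rep_act :> A -> V -> V;
  rep_linearr : forall a, linear (rep_act a);
  rep_linearl : forall v, linear (rep_act^~ v);
  rep1 : forall v, rep_act 1 v = v;
  repM : forall a b v, rep_act (a * b) v = rep_act a (rep_act b v)
}.

Section Representations.
Variables (K : comNzRingType) (A : algType K) (V : lmodType K).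
Variable rho : representation A V.

Definition subrepresentation (U : set V) : Prop :=
  [/\ U 0, forall c x y, U x -> U y -> U (c *: x + y)
     & forall a x, U x -> U (rho a x)].

Definition irreducible : Prop :=
  (exists v : V, v != 0) /\
  forall U, subrepresentation U -> U = [set 0]%classic \/ U = setT.

Definition generates (v : V) : Prop := forall x, exists a, x = rho a v.

End Representations.

Section Basis.
Variables (K : comNzRingType) (V : lmodType K) (I : Type) (v : I -> V).

Definition linearly_independent : Prop :=
  forall (m : nat) (s : 'I_m -> I) (c : 'I_m -> K),
    injective s -> \sum_j c j *: v (s j) = 0 -> forall j, c j = 0.

Definition spanning : Prop :=
  forall x, exists (m : nat) (s : 'I_m -> I) (c : 'I_m -> K),
    x = \sum_j c j *: v (s j).

Definition is_basis : Prop := linearly_independent /\ spanning.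

End Basis.

Section HighestWeight.
Variables (K : comNzRingType) (n : nat) (p : nat -> nat).

(* lam i k stands for lambda_i^(k), 1 <= i <= n, 1 <= k <= p i. *)
Variable lam : nat -> nat -> K.

Definition is_nat (x : K) : Prop := exists m : nat, x = m%:R.
Definition is_int (x : K) : Prop := exists m : int, x = m%:~R.

Definition weight_poly (i : nat) : {poly K} :=
  \prod_(1 <= k < (p i).+1) ('X + (lam i k)%:P).

Definition poly_coef (Q : {poly K}) (m : int) : K :=
  if m is Posz k then Q`_k else 0.

(* The representation rho on V, with highest vector z, is L(lambda(u)). *)
Record is_highest_weight_rep (V : lmodType K)
    (rho : representation (W_algebra K n p) V) (z : V) : Prop := {
  hw_irreducible : irreducible rho;
  hw_generates : generates rho z;
  hw_neq0 : z != 0;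
  hw_B : forall i m, (1 <= i < n)%N -> rho (B_coef K n p i m) z = 0;
  hw_d : forall i m, (1 <= i <= n)%N ->
    rho (laurent_coef 'X^(p i) (wd K n p i) m) z
      = poly_coef (weight_poly i) m *: z
}.

(* L r i k stands for lambda_(r i)^(k). The last field normalizes the entries
   outside of the pattern, so that patterns are equal when their entries are.
   A pattern is encoded by the labelled roots of its polynomials. When
   the numbers lambda_i^(k) - lambda_i^(m), k != m, are not integers, the
   labelling is determined by the polynomials, since
   lambda_(r i)^(k) - lambda_i^(k) is an integer. *)
Record is_pattern (L : nat -> nat -> nat -> K) : Prop := {
  pattern_top : forall i k, (1 <= i <= n)%N -> (1 <= k <= p i)%N ->
    L n i k = lam i k;
  pattern_up : forall r i k, (1 <= i <= r)%N -> (r <= n - 1)%N ->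
    (1 <= k <= p i)%N -> is_nat (L r.+1 i k - L r i k);
  pattern_down : forall r i k, (1 <= i <= r)%N -> (r <= n - 1)%N ->
    (1 <= k <= p i)%N -> is_nat (L r i k - L r.+1 i.+1 k);
  pattern_out : forall r i k,
    ~~ [&& (1 <= i <= r)%N, (r <= n)%N & (1 <= k <= p i)%N] -> L r i k = 0
}.

Definition pattern := {L : nat -> nat -> nat -> K | is_pattern L}.

Definition to_nat (x : K) : nat := xget 0%N [set m : nat | x = m%:R].

Section Vectors.
Variable L : nat -> nat -> nat -> K.

Definition l_top (i k : nat) : K := lam i k - i%:R + 1.
Definition l_row (r i k : nat) : K := L r i k - i%:R + 1.

(* C_r(- l_(r i)^(k) - 1) ... C_r(- l_i^(k) + 1) C_r(- l_i^(k)) *)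
Definition lower_string (r i k : nat) : W_algebra K n p :=
  \prod_(j <- rev (iota 0 (to_nat (l_top i k - l_row r i k))))
    C_at n p r (- l_top i k + j%:R).

Definition P_elt (r i : nat) : W_algebra K n p :=
  \prod_(1 <= k < (p i).+1) lower_string r i k.

(* The factors P_(n-1, i), ..., P_(i, i) occur in decreasing order of r. *)
Definition zeta_elt : W_algebra K n p :=
  \prod_(1 <= i < n) \prod_(r <- rev (index_iota i n)) P_elt r i.

End Vectors.

Definition zeta_vec (V : lmodType K)
    (rho : representation (W_algebra K n p) V) (z : V) (L : pattern) : V :=
  rho (zeta_elt (sval L)) z.

End HighestWeight.

(* Main.v *)
From HB Require Import structures.
Require Import Defs.
From mathcomp Require Import all_boot all_order all_algebra.
From mathcomp Require Import finmap monalg.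
From mathcomp Require Import boolp classical_sets reals complex.
From mathcomp Require Import ring zify.

Set Implicit Arguments.
Unset Strict Implicit.
Unset Printing Implicit Defensive.

Import Order.TTheory GRing.Theory Num.Theory.
Local Open Scope ring_scope.

(* For a pattern put m = lambda_i^(k) - lambda_(ri)^(k). On a vector of weight
   Lambda, d_r(u) acts by a ratio of products of linear factors whose roots x_b
   are indexed by the boxes b = (r, i, k), and lowering the pattern at b raises
   x_b by 1. We construct vectors v_Lambda by induction on the sum of the m,
   with
     f_r(u) v_Lambda = sum_b F_b (u - x_b)^(-1) v_(Lambda - b),
     e_r(u) v_Lambda = sum_b E_b (u - x_b + 1)^(-1) v_(Lambda + b)
   (for the indices at which e_r is defined), with explicit coefficients E_b,
   F_b: a new vector is a Lagrange combination of the f_r^(s) v_Lambda. The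
   action of the e_r on the f_r^(s) v_Lambda is computed from [e, f] and from
   the partial fractions of d_r(u)^(-1) d_(r+1)(u), in which the poles outside
   of the set of patterns cancel. The difference of the two sides of the first
   formula is then killed by all the e_r; as it has a lower weight than the
   highest vector, it generates a proper submodule and must be zero. The span
   of the v_Lambda is thus a submodule, hence everything, and the e_r separate
   the v_Lambda. Finally C_r(-l_(ri)^(k)) maps v_Lambda to a nonzero multiple
   of v_(Lambda - b), and all the intermediate arrays in the definition of
   zeta_Lambda are patterns. *)


(** * Formal power series *)

(** The vector of a pattern is defined through one arbitrarily chosen box, so the formula for [f_r]
    at the other boxes says that all lowering paths lead to the same line with compatible scalars.
    This is obtained from irreducibility rather than by computation, and it dictates an interleaved
    induction: the [e]-formula at depth N+1 needs the [f]-formula below depth N, the [f]-formula at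
    depth N needs the [e]-formula at depths N and N+1, and the [d]-formula at depth N+1 needs the
    [f]-formula at depth N. The coefficients come from splitting residues: the zeros of
    [d_r(u)^-1 d_(r+1)(u)] coming from row r-1 go to F, those from row r+1 to E. With this choice
    the terms of [e f] and [f e] at distinct boxes cancel in pairs, also at the boundary, because
    patterns are closed under entrywise minimum and maximum. Genericity confines every coincidence
    of roots to one layer k, where the betweenness conditions decide it. In particular the roots in
    a row of a pattern are distinct, which is what Lagrange interpolation needs. *)

Record pseries (K : Type) := PSeries { pcoef :> nat -> K }.

Section PowerSeries.
Variable K : fieldType.
Notation ps := (pseries K).
Implicit Types (f g h : ps) (s : seq K).

Lemma psP f g : (forall t, f t = g t) <-> f = g.
Proof.
split=> [|-> //]; case: f g => [f] [g] /= fg; congr PSeries.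
exact: boolp.funext.
Qed.

HB.instance Definition _ := gen_eqMixin ps.
HB.instance Definition _ := gen_choiceMixin ps.

Definition ps_zero : ps := PSeries (fun=> 0).
Definition ps_one : ps := PSeries (fun t => (t == 0)%:R).
Definition ps_add f g : ps := PSeries (fun t => f t + g t).
Definition ps_opp f : ps := PSeries (fun t => - f t).
Definition ps_mul f g : ps := PSeries (fun t => \sum_(k < t.+1) f k * g (t - k)%N).

Let ps_addA : associative ps_add.
Proof. by move=> f g h; apply/psP => t /=; rewrite addrA. Qed.
Let ps_addC : commutative ps_add.
Proof. by move=> f g; apply/psP => t /=; rewrite addrC. Qed.
Let ps_add0 : left_id ps_zero ps_add.
Proof. by move=> f; apply/psP => t /=; rewrite add0r. Qed.
Let ps_addN : left_inverse ps_zero ps_opp ps_add.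
Proof. by move=> f; apply/psP => t /=; rewrite addNr. Qed.

HB.instance Definition _ :=
  GRing.isZmodule.Build ps ps_addA ps_addC ps_add0 ps_addN.

Let trunc m f : {poly K} := \poly_(i < m) f i.

Let truncE m f t : (t < m)%N -> (trunc m f)`_t = f t.
Proof. by move=> tm; rewrite (coef_poly m f) tm. Qed.

(** A coefficient of a product sees only truncations of the factors, so that associativity and
    commutativity are inherited from polynomials. *)
Let trunc_mul m f g t : (t < m)%N -> ps_mul f g t = (trunc m f * trunc m g)`_t.
Proof.
move=> t_lt; rewrite coefM; apply: eq_bigr => k _.
rewrite !truncE ?(leq_ltn_trans _ t_lt) ?leq_subr //.
by rewrite -ltnS.
Qed.

Let ps_mulC : commutative ps_mul.
Proof.
by move=> f g; apply/psP => t; rewrite !(@trunc_mul t.+1) // mulrC.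
Qed.

Let ps_mulA : associative ps_mul.
Proof.
move=> f g h; apply/psP => t /=.
transitivity ((trunc t.+1 f * (trunc t.+1 g * trunc t.+1 h))`_t).
  rewrite coefM; apply: eq_bigr => k _; rewrite [in RHS]truncE //.
  by rewrite -trunc_mul // ltnS leq_subr.
rewrite mulrA coefM; apply: eq_bigr => k _.
by rewrite -trunc_mul // truncE // ltnS leq_subr.
Qed.

Let ps_mul1 : left_id ps_one ps_mul.
Proof.
move=> f; apply/psP => t /=; rewrite big_ord_recl /= mul1r subn0.
by rewrite big1 ?addr0 // => i _; rewrite mul0r.
Qed.

Let ps_mulDl : left_distributive ps_mul ps_add.
Proof.
move=> f g h; apply/psP => t /=; rewrite -big_split /=.
by apply: eq_bigr => k _; rewrite mulrDl.
Qed.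

Let ps_one_neq0 : ps_one != ps_zero.
Proof. by apply/eqP => /psP/(_ 0%N)/eqP /=; rewrite oner_eq0. Qed.

HB.instance Definition _ := GRing.Zmodule_isComNzRing.Build ps
  ps_mulA ps_mulC ps_mul1 ps_mulDl ps_one_neq0.

Lemma psM f g t : (f * g) t = \sum_(k < t.+1) f k * g (t - k)%N.
Proof. by []. Qed.

Lemma psB f g t : (f - g) t = f t - g t. Proof. by []. Qed.

Lemma ps1 t : (1 : ps) t = (t == 0)%:R. Proof. by []. Qed.

Definition psX : ps := PSeries (fun t => (t == 1)%:R).

Lemma psXM f t : (psX * f) t = if t is t'.+1 then f t' else 0.
Proof.
case: t => [|t]; first by rewrite psM big_ord1 mul0r.
rewrite psM big_ord_recl mul0r add0r big_ord_recl mul1r /=.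
by rewrite big1 ?addr0 ?subSS ?subn0 // => i _; rewrite mul0r.
Qed.

(* With [w = u^-1], [linps x] is [1 - x w] and [geops x] is its inverse. *)
Definition linps (x : K) : ps :=
  PSeries (fun t => if t is t'.+1 then - x *+ (t' == 0) else 1).
Definition geops (x : K) : ps := PSeries (fun t => x ^+ t).

Lemma geopsE x t : geops x t = x ^+ t. Proof. by []. Qed.

Lemma linpsM x f t :
  (linps x * f) t = f t - x * (if t is t'.+1 then f t' else 0).
Proof.
case: t => [|t]; first by rewrite psM big_ord1 mul1r mulr0 subr0.
rewrite psM big_ord_recl mul1r subn0 big_ord_recl big1 => [|i _] /=.
  by rewrite addr0 subSS subn0 mulNr.
by rewrite mul0r.
Qed.

#[global] Arguments pcoef : simpl never.

Lemma linpsK x : linps x * geops x = 1.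
Proof.
apply/psP => -[|t]; rewrite linpsM !geopsE ?mulr0 ?subr0 ?expr0 //.
by rewrite exprS subrr.
Qed.

Lemma linps_geo x f : linps x * (geops x * f) = f.
Proof. by rewrite mulrA linpsK mul1r. Qed.

Lemma geo_linps x f : geops x * (linps x * f) = f.
Proof. by rewrite mulrCA linps_geo. Qed.

Lemma linps_inj x f g : linps x * f = linps x * g -> f = g.
Proof. by move=> /(congr1 ( *%R (geops x))); rewrite !geo_linps. Qed.

(** In terms of [u = w^-1] this is [u^(size ys - size zs) \prod (u - z) / \prod (u - y)]. *)
Definition ps_ratio (zs ys : seq K) : ps :=
  (\prod_(z <- zs) linps z) * \prod_(y <- ys) geops y.

Lemma ps_ratio_nil : ps_ratio [::] [::] = 1.
Proof. by rewrite /ps_ratio !big_nil mulr1. Qed.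

Lemma ps_ratioM zs1 ys1 zs2 ys2 :
  ps_ratio (zs1 ++ zs2) (ys1 ++ ys2) = ps_ratio zs1 ys1 * ps_ratio zs2 ys2.
Proof. by rewrite /ps_ratio !big_cat /= mulrACA. Qed.

Lemma ps_ratio_cons z zs ys : ps_ratio (z :: zs) ys = linps z * ps_ratio zs ys.
Proof. by rewrite /ps_ratio big_cons mulrA. Qed.

Lemma ps_ratio_consr zs y ys : ps_ratio zs (y :: ys) = geops y * ps_ratio zs ys.
Proof. by rewrite /ps_ratio big_cons mulrCA. Qed.

Lemma ps_ratio_perm zs ys zs' ys' :
  perm_eq zs zs' -> perm_eq ys ys' -> ps_ratio zs ys = ps_ratio zs' ys'.
Proof. by move=> hz hy; rewrite /ps_ratio (perm_big _ hz) (perm_big _ hy). Qed.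

Lemma ps_ratio_id s : ps_ratio s s = 1.
Proof.
elim: s => [|x s IHs]; first exact: ps_ratio_nil.
by rewrite ps_ratio_cons ps_ratio_consr linps_geo.
Qed.

Lemma ps_ratio_inv s1 s2 : ps_ratio s1 s2 * ps_ratio s2 s1 = 1.
Proof.
rewrite -ps_ratioM -(ps_ratio_id (s1 ++ s2)).
by apply: ps_ratio_perm; rewrite ?perm_refl // perm_catC.
Qed.

Lemma ps_ratio0 zs ys : ps_ratio zs ys 0%N = 1.
Proof.
elim: zs => [|z zs IHz]; last by rewrite ps_ratio_cons linpsM mulr0 subr0.
elim: ys => [|y ys IHy]; first by rewrite ps_ratio_nil.
by rewrite ps_ratio_consr psM big_ord1 geopsE expr0 mul1r.
Qed.

(** * Partial fractions *)

Section LagrangeSum.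

Let lag s y := (\prod_(y' <- s | y' != y) (y - y'))^-1.

Let lag_cons s x y : y \in s -> x \notin s -> uniq s ->
  lag (x :: s) y = lag s y / (y - x).
Proof.
move=> ys xs us; rewrite /lag big_cons.
have -> : x != y by apply: contraNneq xs => ->.
by rewrite invfM mulrC.
Qed.

Let prod_neq0 s y : \prod_(y' <- s | y' != y) (y - y') != 0.
Proof.
by rewrite prodf_seq_neq0; apply/allP => z _; apply/implyP;
  rewrite subr_eq0 eq_sym.
Qed.

Let lag_poly s y : {poly K} := \prod_(y' <- s | y' != y) ('X - y'%:P).

Let size_lag_poly s y : uniq s -> y \in s -> size (lag_poly s y) = size s.
Proof.
move=> us ys; rewrite /lag_poly -big_filter size_prod_XsubC.
rewrite size_filter -(count_predC (pred1 y) s) count_uniq_mem // ys add1n.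
by congr _.+1; apply: eq_count.
Qed.

(** Lagrange interpolation of the constant 1 at the points of [s]: the sum is the coefficient of
    degree [(size s).-1 > 0] of the interpolating polynomial, hence 0. *)
Lemma sum_lagrange0 s : uniq s -> (1 < size s)%N -> \sum_(y <- s) lag s y = 0.
Proof.
move=> us s_gt1.
have E : \sum_(y <- s) lag s y *: lag_poly s y = 1.
  apply/eqP; rewrite -subr_eq0; apply/eqP.
  apply: (@roots_geq_poly_eq0 _ _ s) => //; last first.
    rewrite (leq_trans (size_polyD _ _)) // size_polyN size_poly1 geq_max.
    rewrite (ltnW s_gt1) andbT.
    apply: (leq_trans (size_sum _ _ _)); apply/bigmax_leqP_seq => y ys _.
    by rewrite (leq_trans (size_scale_leq _ _)) // size_lag_poly.
  apply/allP => x xs; rewrite rootE !hornerE horner_sum.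
  rewrite (big_rem x) //= !hornerE /lag_poly horner_prod.
  have -> : \prod_(i <- s | i != x) ('X - i%:P).[x]
            = \prod_(i <- s | i != x) (x - i).
    by apply: eq_bigr => i _; rewrite !hornerE.
  rewrite mulVf ?prod_neq0 // big_seq big1 ?addr0 ?subrr // => y.
  rewrite mem_rem_uniq // inE => /andP[yx ys].
  rewrite hornerZ (big_rem x) //= eq_sym yx.
  by rewrite hornerM hornerXsubC subrr mul0r mulr0.
have /(congr1 (coefp (size s).-1)) := E; rewrite /= coef_sum coef1.
have -> : ((size s).-1 == 0)%N = false by case: (size s) s_gt1 => [|[]].
rewrite big_seq => S0; rewrite big_seq -[RHS]S0; apply: eq_bigr => y ys.
rewrite coefZ -(size_lag_poly us ys).
suff /monicP : lag_poly s y \is monic by rewrite /lead_coef => ->; rewrite mulr1.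
by apply: monic_prod => i _; apply: monicXsubC.
Qed.

(** The classical expression of complete homogeneous symmetric polynomials. The power of [psX]
    includes the vanishing power sums of low degree, where the induction starts through
    [sum_lagrange0]. *)
Let ps_power_sum s t : uniq s -> (0 < size s)%N ->
  (psX ^+ (size s).-1 * ps_ratio [::] s) t = \sum_(y <- s) lag s y * y ^+ t.
Proof.
case: s => // x s /= + _; elim: s x t => [|x s IHs] x0 t.
  rewrite ps_ratio_consr ps_ratio_nil /= mul1r mulr1 big_seq1 /lag geopsE.
  by rewrite big_cons eqxx big_nil invr1 mul1r.
move=> us; have /= /andP[x0s uxs] := us.
set G : ps := PSeries (fun t => \sum_(y <- x0 :: x :: s)
  lag (x0 :: x :: s) y * y ^+ t).
have GE t' : G t' = \sum_(y <- x0 :: x :: s) lag (x0 :: x :: s) y * y ^+ t'.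
  by [].
suff -> : psX ^+ size (x :: s) * ps_ratio [::] (x0 :: x :: s) = G by [].
rewrite ps_ratio_consr mulrCA; apply: (@linps_inj x0); rewrite linps_geo /=.
rewrite exprS -mulrA; apply/psP => -[|t']; rewrite psXM linpsM /= GE.
  rewrite mulr0 subr0; under eq_bigr => i _ do rewrite expr0 mulr1.
  by rewrite sum_lagrange0.
rewrite GE IHs //= [in RHS]big_cons [X in _ - _ * X]big_cons.
rewrite mulrDr [_ * (_ * x0 ^+ t')]mulrCA -exprS opprD addrACA subrr add0r.
rewrite mulr_sumr -sumrB big_seq [RHS]big_seq; apply: eq_bigr => y ys.
rewrite (lag_cons ys x0s uxs) exprS; set l := lag _ y; set d := (y - x0)^-1.
rewrite [RHS](_ : _ = l * y ^+ t' * ((y - x0) * d)); last by ring.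
by rewrite divff ?mulr1 // subr_eq0; apply: contraNneq x0s => <-.
Qed.

(** A factor [1 - z w] replaces [y^t] by [y^t - z y^(t-1) = (y - z) y^(t-1)]; the bound on [t] keeps
    the exponents nonnegative. *)
Let ps_ratio_coef zs s t : uniq s -> (0 < size s)%N -> (size zs <= t)%N ->
  (psX ^+ (size s).-1 * ps_ratio zs s) t =
  \sum_(y <- s) lag s y * (\prod_(z <- zs) (y - z)) * y ^+ (t - size zs).
Proof.
move=> us s_gt0; elim: zs t => [|z zs IHz] t; last case: t => //= t.
  move=> _; rewrite ps_power_sum // subn0; apply: eq_bigr => y _.
  by rewrite big_nil mulr1.
rewrite ltnS => zt; rewrite ps_ratio_cons mulrCA linpsM !IHz ?(leqW zt) //.
rewrite mulr_sumr -sumrB; apply: eq_bigr => y _.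
by rewrite subSS subSn // big_cons exprS; ring.
Qed.

(** Multiplied by [u^q], the ratio is a polynomial of degree [q] in [u] plus simple fractions
    [R_y / (u - y)]. The negative powers of [u] see only the fractions, through
    [1 / (u - y) = \sum_j y^j u^(-j-1)]. *)
Lemma ps_ratio_partial_fractions zs s q j : uniq s ->
  size zs = (size s + q)%N ->
  ps_ratio zs s (q + 1 + j)%N =
  \sum_(y <- s) (\prod_(z <- zs) (y - z)) * lag s y * y ^+ j.
Proof.
case: s => [|y0 s] us szs.
  (* Without poles the series is a polynomial of degree at most [q] in [w]. *)
  rewrite big_nil; have : (size zs <= q)%N by rewrite szs.
  elim: zs {szs} q j => [|z zs IHz] q j.
    by move=> _; rewrite ps_ratio_nil ps1 addn1.
  case: q => //= q zq; rewrite ps_ratio_cons linpsM (IHz _ _ (leqW zq)).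
  by rewrite !addSn IHz // mulr0 subr0.
have := @ps_ratio_coef zs (y0 :: s) (size zs + j) us isT (leq_addr _ _).
have -> : (size zs + j = (size (y0 :: s)).-1 + (q + 1 + j))%N.
  by rewrite szs /=; lia.
set k := (size _).-1; have shiftE f t : (psX ^+ k * f) (k + t)%N = f t.
  by elim: k => [|k IHk]; rewrite ?mul1r // exprS -mulrA addSn psXM.
rewrite shiftE => ->; apply: eq_bigr => y _; congr (_ * _ ^+ _).
  by rewrite mulrC.
by rewrite szs /k /=; lia.
Qed.

(* The poles in [bad] are cancelled by zeros. *)
Lemma ps_ratio_partial_fractions_cancel zs ys s bad q j :
  perm_eq ys (s ++ bad) ->
  (forall x, (count_mem x bad <= count_mem x zs)%N) ->
  uniq s -> {in s, forall y, y \notin bad} ->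
  size zs = (size ys + q)%N ->
  ps_ratio zs ys (q + 1 + j)%N =
  \sum_(y <- s) (\prod_(z <- zs) (y - z)) * lag ys y * y ^+ j.
Proof.
move=> ysE badz us sbad szs.
have [bad' + ebad] : exists2 b, subseq b zs & perm_eq bad b.
  by apply/count_subseqP.
move=> /perm_to_subseq[zs' zsE].
have {}zsE : perm_eq zs (zs' ++ bad).
  by rewrite (perm_trans zsE) // perm_sym perm_catC perm_cat2r.
have -> : ps_ratio zs ys = ps_ratio zs' s.
  by rewrite (ps_ratio_perm zsE ysE) ps_ratioM ps_ratio_id mulr1.
rewrite ps_ratio_partial_fractions //; last first.
  apply/eqP; rewrite -(eqn_add2r (size bad)).
  have := perm_size zsE; rewrite size_cat szs (perm_size ysE) size_cat => <-.
  by rewrite addnAC.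
rewrite big_seq [RHS]big_seq; apply: eq_bigr => y ys0; congr (_ * _).
rewrite /lag (perm_big _ zsE) (perm_big _ ysE) !big_cat /= invfM.
have -> : \prod_(i <- bad | i != y) (y - i) = \prod_(i <- bad) (y - i).
  rewrite big_seq_cond [RHS]big_seq; apply: eq_bigl => i.
  by case ib: (i \in bad) => //=; apply: contraTneq ib => ->; apply: sbad.
rewrite -[LHS]mulr1 mulrACA; set d := \prod_(i <- bad) _.
rewrite -(mulfV (_ : d != 0)); first by ring.
rewrite prodf_seq_neq0; apply/allP => i ib /=; rewrite subr_eq0.
by apply: contraTneq ib => <-; apply: sbad.
Qed.

End LagrangeSum.

End PowerSeries.

(** * Translation and reversal of series *)

Section Shift.
Variable K : fieldType.
Notation ps := (pseries K).
Implicit Types (f g : ps) (c x : K).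

(* [f(u - c)], where [f] is a series in [w = u^-1]: this substitutes
   [w / (1 - c w)] for [w]. *)
Definition ps_shift c f : ps := PSeries (fun m =>
  \sum_(r < m.+1) ('C(m.-1, m - r)%:R * c ^+ (m - r)) * f r).

Lemma ps_shiftE c f m : ps_shift c f m =
  \sum_(r < m.+1) ('C(m.-1, m - r)%:R * c ^+ (m - r)) * f r.
Proof. by []. Qed.

Lemma ps_shift1 c : ps_shift c 1 = 1.
Proof.
apply/psP => m; rewrite ps_shiftE big_ord_recl big1 => [|i _].
  rewrite addr0 !ps1 mulr1 subn0; case: m => [|m]; first by rewrite expr0 mulr1.
  by rewrite bin_small ?mul0r.
by rewrite ps1 mulr0.
Qed.

Lemma ps_shiftB c f g : ps_shift c (f - g) = ps_shift c f - ps_shift c g.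
Proof.
apply/psP => m; rewrite psB !ps_shiftE -sumrB; apply: eq_bigr => r _.
by rewrite psB mulrBr.
Qed.

Definition ps_const c : ps := PSeries (fun t => if t is t'.+1 then 0 else c).

Lemma ps_constM c f t : (ps_const c * f) t = c * f t.
Proof.
by rewrite psM big_ord_recl big1 ?addr0 ?subn0 // => i _; rewrite mul0r.
Qed.

Lemma linpsE x : linps x = 1 - ps_const x * psX K.
Proof.
apply/psP => t; rewrite psB ps_constM -[linps x]mulr1 linpsM ps1.
by case: t => [|t] //; rewrite !sub0r /pcoef /= eqSS.
Qed.

Lemma ps_shift_const c x f : ps_shift c (ps_const x * f) = ps_const x * ps_shift c f.
Proof.
apply/psP => m; rewrite ps_constM !ps_shiftE mulr_sumr.
by apply: eq_bigr => r _; rewrite ps_constM mulrCA.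
Qed.

(** The substitution sends [w] to [w / (1 - c w)]; on coefficients this is Pascal's rule. *)
Lemma ps_shiftX c f : linps c * ps_shift c (psX K * f) = psX K * ps_shift c f.
Proof.
apply/psP => -[|m]; rewrite linpsM psXM.
  by rewrite ps_shiftE big_ord1 psXM !mulr0 subr0.
rewrite !ps_shiftE big_ord_recl psXM mulr0 add0r.
under eq_bigr => i _ do rewrite psXM /= ?add1n subSS.
case: m => [|m].
  by rewrite !big_ord1 psXM !mulr0 subr0.
rewrite [X in c * X]big_ord_recl psXM mulr0 add0r mulr_sumr.
under [X in _ - X]eq_bigr => i _ do rewrite psXM /= ?add1n subSS.
rewrite big_ord_recr /= subnn expr0 bin0 mul1r.
rewrite [in RHS]big_ord_recr /= subnn expr0 bin0 mul1r addrAC; congr (_ + _).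
  rewrite -sumrB; apply: eq_bigr => i _; rewrite subSn; last by rewrite -ltnS.
  by rewrite binS natrD exprS; ring.
by rewrite !mul1r.
Qed.

Lemma ps_shift_linps c x f :
  ps_shift c (linps x * f) = linps (x + c) * geops c * ps_shift c f.
Proof.
apply: (@linps_inj _ c); rewrite -!mulrA [RHS]mulrCA linps_geo.
rewrite (linpsE x) mulrBl mul1r -mulrA ps_shiftB ps_shift_const.
rewrite mulrBr mulrCA ps_shiftX !linpsE.
have -> : ps_const (x + c) = ps_const x + ps_const c.
  by apply/psP => -[|t] //; rewrite /pcoef /= addr0.
by ring.
Qed.

Lemma ps_shift_geops c y f :
  ps_shift c (geops y * f) = geops (y + c) * linps c * ps_shift c f.
Proof.
apply: (@linps_inj _ (y + c)); rewrite -!mulrA linps_geo.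
rewrite -[in RHS](linps_geo y f) ps_shift_linps -!mulrA.
by rewrite mulrCA linps_geo.
Qed.

(** Since [1 - z w] becomes [(1 - (z + c) w) / (1 - c w)], every zero leaves a pole at [c] and every
    pole a zero at [c]. *)
Lemma ps_shift_ratio c zs ys : ps_shift c (ps_ratio zs ys) =
  ps_ratio [seq z + c | z <- zs] [seq y + c | y <- ys] *
  ps_ratio (nseq (size ys) c) (nseq (size zs) c).
Proof.
elim: zs => [|z zs IHz]; last first.
  by rewrite ps_ratio_cons ps_shift_linps IHz /= ps_ratio_cons ps_ratio_consr;
    ring.
elim: ys => [|y ys IHy]; first by rewrite /= !ps_ratio_nil ps_shift1 mulr1.
by rewrite ps_ratio_consr ps_shift_geops IHy /= ps_ratio_cons ps_ratio_consr;
  ring.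
Qed.

Lemma coef_prod_linps_gt (s : seq K) t : (size s < t)%N ->
  (\prod_(x <- s) linps x) t = 0.
Proof.
elim: s t => [|x s IHs] [|t] //= st; first by rewrite big_nil ps1.
by rewrite big_cons linpsM !IHs // ?(ltnW st) // mulr0 subr0.
Qed.

Lemma coef_prod_linps (s : seq K) t : (t <= size s)%N ->
  (\prod_(x <- s) linps x) t = (\prod_(x <- s) ('X - x%:P))`_(size s - t).
Proof.
elim: s t => [|x s IHs] t /=.
  by rewrite leqn0 => /eqP ->; rewrite !big_nil coef1 ps1.
rewrite !big_cons linpsM mulrBl coefB coefXM mul_polyC coefZ.
case: t => [|t] ts.
  rewrite IHs // subn0 mulr0 [X in _ = _ - _ * X]nth_default ?mulr0 ?subn0 //.
  by rewrite size_prod_XsubC.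
rewrite subSS; rewrite ltnS in ts; rewrite (IHs t) //; congr (_ - _).
rewrite subn_eq0; case: ltngtP ts => // [ts _|-> _].
  by rewrite IHs // subnS.
by rewrite coef_prod_linps_gt.
Qed.

(* The polynomial part of [Q(u) g(u)] when [g = w A(w) / Q(w)]. *)
Lemma polynomial_part_ratio (qs s : seq K) (x : K) (Q := \prod_(q <- qs) ('X - q%:P))
    (g := psX K * ps_ratio s qs) :
  size qs = (size s).+1 ->
  \sum_(m < size Q) (\sum_(j < size Q | (m <= j)%N) Q`_j * g (j - m)%N) * x ^+ m
  = \prod_(a <- s) (x - a).
Proof.
move=> sqs; have sQ : size Q = (size qs).+1 by rewrite size_prod_XsubC.
have gE : (\prod_(q <- qs) linps q) * g = psX K * \prod_(a <- s) linps a.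
  by have := ps_ratio_id qs; rewrite /g /ps_ratio => E; rewrite mulrCA [X in _ * X]mulrCA E mulr1.
transitivity (\prod_(a <- s) ('X - a%:P)).[x]; last first.
  by rewrite horner_prod; apply: eq_bigr => a _; rewrite hornerXsubC.
rewrite (@horner_coef_wide _ (size Q)); last first.
  by rewrite size_prod_XsubC sQ sqs.
apply: eq_bigr => -[m /=]; rewrite sQ ltnS => mQ _; congr (_ * _).
(* Reversal of [Q]: the coefficient of [u^m] in [Q(u) g(u)] is the one of degree [size qs - m] in a
   Cauchy product of series in [w]. *)
transitivity (((\prod_(q <- qs) linps q) * g) (size qs - m)%N).
  rewrite psM -(@big_geq_mkord _ _ _ _ _ xpredT (fun j => Q`_j * g (j - m)%N)).
  rewrite -{1}[m]add0n big_addn big_mkord subSn // (reindex_inj rev_ord_inj) /=.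
  apply: eq_bigr => -[k /=]; rewrite ltnS => km _.
  rewrite subSS addnK coef_prod_linps ?(leq_trans km) ?leq_subr //.
  by congr (Q`_ _ * g _); lia.
rewrite gE psXM; case D: (size qs - m)%N => [|t].
  rewrite nth_default //.
  by rewrite size_prod_XsubC -sqs; lia.
rewrite coef_prod_linps; last by lia.
by congr (_`_ _); lia.
Qed.

End Shift.

(** * Patterns as integer arrays *)

(** Non-integrality is recorded in row [n] alone: by dominance each [lam i k] differs from [lam n k]
    by an integer, and all layers occur in that row. *)
Record generic_dominant (K : numFieldType) (n : nat) (p : nat -> nat)
    (lam : nat -> nat -> K) : Prop := GenericDominant {
  gd_n_gt0 : (0 < n)%N;
  gd_p_mono : forall i, (1 <= i < n)%N -> (p i <= p i.+1)%N;
  gd_dominant : forall i k, (1 <= i < n)%N -> (1 <= k <= p i)%N ->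
    is_nat (lam i k - lam i.+1 k);
  gd_generic : forall k m, (1 <= k <= p n)%N -> (1 <= m <= p n)%N ->
    k != m -> ~ is_int (lam n k - lam n m)
}.

Section States.
Variables (K : numFieldType) (n : nat) (p : nat -> nat) (lam : nat -> nat -> K).
Hypothesis W : generic_dominant n p lam.

Let n_gt0 : (0 < n)%N. Proof. by case: W. Qed.
Let p_mono i : (1 <= i < n)%N -> (p i <= p i.+1)%N. Proof. by case: W i. Qed.
Let lam_dominant i k : (1 <= i < n)%N -> (1 <= k <= p i)%N ->
  is_nat (lam i k - lam i.+1 k).
Proof. by case: W i k. Qed.
Let lam_generic k m : (1 <= k <= p n)%N -> (1 <= m <= p n)%N ->
  k != m -> ~ is_int (lam n k - lam n m).
Proof. by case: W k m. Qed.

(** Indices are 1-based and columns have different heights, so the product type contains spurious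
    triples, which [valid] discards. The boxes of row [n] are valid but not [active]: the weight
    prescribes their entries. *)
Definition box : finType := ('I_n.+1 * 'I_n.+1 * 'I_(p n).+1)%type.
Implicit Types b c d : box.

Definition row b : nat := b.1.1.
Definition col b : nat := b.1.2.
Definition lay b : nat := b.2.
Definition valid b := (0 < col b <= row b)%N && (0 < lay b <= p (col b))%N.
Definition inrow r b := (row b == r) && valid b.
Definition active b := (row b < n)%N && valid b.

Lemma box_eq b c : row b = row c -> col b = col c -> lay b = lay c -> b = c.
Proof.
case: b c => [[b1 b2] b3] [[c1 c2] c3]; rewrite /row /col /lay /=.
by move=> /ord_inj -> /ord_inj -> /ord_inj ->.
Qed.

Lemma row_le b : (row b <= n)%N. Proof. exact: leq_ord. Qed.

Lemma p_le i j : (0 < i)%N -> (i <= j)%N -> (j <= n)%N -> (p i <= p j)%N.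
Proof.
move=> i_gt0; elim: j => [|j IHj]; first by case: i i_gt0.
rewrite leq_eqVlt => /predU1P[-> //|]; rewrite ltnS => ij jn.
by apply: leq_trans (IHj ij (ltnW jn)) (p_mono _); lia.
Qed.

Lemma ex_box r i k : (0 < i <= r)%N -> (r <= n)%N -> (0 < k <= p i)%N ->
  exists2 b, inrow r b & col b = i /\ lay b = k.
Proof.
move=> ir rn ki; have kn : (k <= p n)%N.
  by have := @p_le i n; lia.
exists (inord r, inord i, inord k).
  by rewrite /inrow /valid /row /col /lay /= !inordK; lia.
by rewrite /col /lay /= !inordK; lia.
Qed.

Lemma big_row (T : Type) (idx : T) (op : Monoid.com_law idx) r
    (F : nat -> nat -> T) : (r <= n)%N ->
  \big[op/idx]_(b | inrow r b) F (col b) (lay b) =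
  \big[op/idx]_(1 <= i < r.+1) \big[op/idx]_(1 <= k < (p i).+1) F i k.
Proof.
move=> rn.
have rowsE : \big[op/idx]_(1 <= i < r.+1) \big[op/idx]_(1 <= k < (p i).+1) F i k
    = \big[op/idx]_(i < n.+1 | (0 < i <= r)%N)
        \big[op/idx]_(k < (p n).+1 | (0 < k <= p i)%N) F i k.
  rewrite (@big_nat_widen _ _ _ _ _ n.+1) ?ltnS // big_geq_mkord.
  apply: eq_big => [i|i /andP[ir i_gt0]]; first by rewrite ltnS andbC.
  rewrite (@big_nat_widen _ _ _ _ _ (p n).+1) ?big_geq_mkord.
    by apply: eq_bigl => k; rewrite ltnS andbC.
  by rewrite ltnS p_le //; have := ltn_ord i; lia.
rewrite rowsE pair_big_dep /=.
rewrite (reindex_onto (fun q : 'I_n.+1 * 'I_(p n).+1 => (inord r, q.1, q.2) : box)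
   (fun b => (b.1.2, b.2))) /=; last first.
  move=> [[r' i] k] /andP[/eqP /= r'E _]; congr (_, _, _).
  by rewrite -r'E /row inord_val.
apply: eq_big => [[i k]|//]; rewrite /inrow /valid /row /col /lay /=.
by rewrite inordK ?ltnS // !eqxx andbT.
Qed.

Lemma card_row r : (r <= n)%N -> #|inrow r| = (\sum_(1 <= i < r.+1) p i)%N.
Proof.
move=> rn; rewrite -sum1_card (big_row _ (fun _ _ => 1%N)) //.
by apply: eq_bigr => i _; rewrite sum_nat_const_nat muln1 subn1.
Qed.

Lemma card_rowS r : (r < n)%N -> #|inrow r.+1| = (#|inrow r| + p r.+1)%N.
Proof. by move=> rn; rewrite !card_row ?(ltnW rn) // big_nat_recr. Qed.

Definition gaps i k : nat := \sum_(i <= j < n) to_nat (lam j k - lam j.+1 k).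

Lemma to_natK (x : K) : is_nat x -> x = (to_nat x)%:R.
Proof. by move=> x_nat; apply: (@classical_sets.xgetPex _ 0%N _ x_nat). Qed.

Lemma lam_gaps i k : (0 < i <= n)%N -> (0 < k <= p i)%N ->
  lam i k = lam n k + (gaps i k)%:R.
Proof.
move=> /andP[i_gt0 i_n] /andP[k_gt0 kp].
have -> : (gaps i k)%:R = \sum_(i <= j < n) (lam j k - lam j.+1 k) :> K.
  rewrite natr_sum; apply: eq_big_nat => j /andP[ij jn].
  rewrite -to_natK //; apply: lam_dominant; first by lia.
  by have := @p_le i j; lia.
under eq_bigr => j _ do rewrite -opprB.
by rewrite sumrN telescope_sumr // addrC opprB subrK.
Qed.

Lemma gaps_le i k : (gaps i.+1 k <= gaps i k)%N.
Proof.
rewrite /gaps; case: (ltnP i n) => i_n; first by rewrite [leqRHS]big_ltn // leq_addl.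
by rewrite big_geq // ltnW.
Qed.

(* The state of a pattern has the entry lambda_n^(k) - lambda_(ri)^(k) + i - r at
   the box (r, i, k). This is an integer, and the betweenness conditions become
   z_(r+1,i) < z_(r,i) <= z_(r+1,i+1). *)
Definition state := {ffun box -> int}.
Implicit Types z : state.

Definition top : state :=
  [ffun b => (col b)%:Z - (row b)%:Z - (gaps (col b) (lay b))%:Z].
Definition unit_at b : state := [ffun c => (c == b)%:R].

Lemma incE z b c : (z + unit_at b) c = z c + (c == b)%:R.
Proof. by rewrite !ffunE. Qed.

Lemma decE z b c : (z - unit_at b) c = z c - (c == b)%:R.
Proof. by rewrite !ffunE. Qed.

(** At the box (r, i, k) of a pattern this is [- lambda_(ri)^(k) + i - r], that is,
    [- l_(ri)^(k) - (r - 1)]. *)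
Definition root_at z b : K := (z b)%:~R - lam n (lay b).

Lemma root_at_inc z b c : root_at (z + unit_at b) c = root_at z c + (c == b)%:R.
Proof.
by rewrite /root_at incE intrD; case: (c == b); rewrite /= ?addr0 // addrAC.
Qed.

Lemma root_at_dec z b c : root_at (z - unit_at b) c = root_at z c - (c == b)%:R.
Proof.
by rewrite /root_at decE intrB; case: (c == b); rewrite /= ?subr0 // addrAC.
Qed.

Lemma root_at_top b : valid b ->
  root_at top b = - lam (col b) (lay b) + (col b)%:R - (row b)%:R.
Proof.
move=> /andP[cb lb]; rewrite /root_at ffunE (@lam_gaps (col b)) //; last first.
  by have := row_le b; lia.
by rewrite !intrB !pmulrn; ring.
Qed.

(** Genericity enters here: an integer difference between roots of layers k and m would give one
    between [lambda_n^(k)] and [lambda_n^(m)]. Coincidences of roots thus become equations between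
    integers in a single layer. *)
Lemma root_at_eq z z' b c (s t : int) : valid b -> valid c ->
  root_at z b + s%:~R = root_at z' c + t%:~R -> lay b = lay c /\ z b + s = z' c + t.
Proof.
move=> /andP[cb lb] /andP[cc lc] E.
have lay_p d : (0 < col d <= row d)%N -> (0 < lay d <= p (col d))%N -> (0 < lay d <= p n)%N.
  by move=> h h'; have := @p_le (col d) n; have := row_le d; lia.
have [bc|bc] := eqVneq (lay b) (lay c).
  split=> //; apply: (@intr_inj K); rewrite !intrD; move: E; rewrite /root_at bc.
  by rewrite addrAC [RHS]addrAC => /addIr.
case: (lam_generic (lay_p _ cb lb) (lay_p _ cc lc) bc).
exists (z b + s - (z' c + t)); rewrite intrB !intrD.
have -> : (z b)%:~R = root_at z b + lam n (lay b) by rewrite /root_at subrK.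
have -> : (z' c)%:~R = root_at z' c + lam n (lay c) by rewrite /root_at subrK.
have -> : root_at z b = root_at z' c + t%:~R - s%:~R by rewrite -E addrK.
by ring.
Qed.

Record pattern_spec z : Prop := PatternSpec {
  pat_fixed : forall b, ~~ active b -> z b = top b;
  pat_lt : forall b c, valid b -> valid c -> lay b = lay c ->
    row c = (row b).+1 -> col c = col b -> z c < z b;
  pat_le : forall b c, valid b -> valid c -> lay b = lay c ->
    row c = (row b).+1 -> col c = (col b).+1 -> z b <= z c
}.

Definition pat z : bool := `[< pattern_spec z >].

Lemma patP z : reflect (pattern_spec z) (pat z).
Proof. exact: asboolP. Qed.

Lemma pat_top : pat top.
Proof.
apply/patP; split=> // b c bv cv bc rc cc; rewrite !ffunE rc cc bc.
  by lia.
by have := gaps_le (col b) (lay c); lia.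
Qed.

(** From row r to row r+1 in a fixed column and layer, [top] drops by exactly 1 and a pattern by at
    least 1; they agree in row [n]. *)
Lemma pat_ge_top z b : pat z -> top b <= z b.
Proof.
move=> /patP zp.
have [k] := ubnP (n - row b)%N; elim: k b => // k IHk b bk.
have [|ab] := boolP (active b); last by rewrite pat_fixed.
move=> /andP[bn bv]; have /andP[cb lb] := bv.
have [c /andP[/eqP rc cv] [cc lc]] := @ex_box (row b).+1 (col b) (lay b) ltac:(lia) bn lb.
have := pat_lt zp bv cv (esym lc) rc cc.
have : (n - row c < k)%N by lia.
move=> /IHk; rewrite !ffunE rc cc lc; lia.
Qed.

(** Neighbouring columns are separated through row r+1: [z_(r,i) <= z_(r+1,i+1) < z_(r,i+1)]. In row
    [n] dominance takes over. *)
Lemma pat_row_lt z b c : pat z -> valid b -> valid c -> row b = row c ->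
  lay b = lay c -> (col b <= col c)%N -> z b + (col c)%:Z - (col b)%:Z <= z c.
Proof.
move=> zp; have [k] := ubnP (col c - col b)%N; elim: k b => // k IHk b.
move=> bk bv cv rbc lbc.
rewrite leq_eqVlt => /predU1P[E|bc].
  by rewrite (box_eq rbc E lbc); lia.
have /andP[cb lb] := bv; have /andP[cc lc] := cv.
have pb : (p (col b) <= p (col b).+1)%N.
  by apply: p_le => //; have := row_le b; lia.
have [d /andP[/eqP rd dv] [cd ld]] :=
  @ex_box (row b) (col b).+1 (lay b) ltac:(lia) (row_le b) ltac:(lia).
suff zbd : z b < z d.
  have := IHk d ltac:(lia) dv cv ltac:(lia) ltac:(lia) ltac:(lia).
  by rewrite cd; lia.
have /patP zpp := zp.
have [bn|nb] := ltnP (row b) n.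
  have [d' /andP[/eqP rd' dv'] [cd' ld']] :=
    @ex_box (row b).+1 (col b).+1 (lay b) ltac:(lia) bn ltac:(lia).
  have h1 := pat_le zpp bv dv' (esym ld') rd' cd'.
  have h2 := pat_lt zpp dv dv' ltac:(lia) ltac:(lia) ltac:(lia).
  exact: le_lt_trans h1 h2.
rewrite !(pat_fixed zpp) /active ?rd -?leqNgt ?ltnNge ?nb //= !ffunE cd ld rd.
by have := gaps_le (col b) (lay b); lia.
Qed.

(** The conditions compare entries in pairs, so patterns are closed under entrywise minimum and
    maximum; [z - unit_at c] and [z + unit_at b] are the minimum and the maximum of the two given
    patterns. *)
Lemma pat_exchange z b c : b != c -> pat z -> pat (z - unit_at c + unit_at b) ->
  pat (z + unit_at b) /\ pat (z - unit_at c).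
Proof.
move=> bc /patP z1 /patP z2.
have E d : (z - unit_at c + unit_at b) d = z d - (d == c)%:R + (d == b)%:R.
  by rewrite incE decE.
have bcE d : ~~ ((d == b) && (d == c)).
  by apply: contra bc => /andP[/eqP <-].
split; apply/patP; split.
- move=> d ad; rewrite incE; have := pat_fixed z1 ad; have := pat_fixed z2 ad.
  by rewrite E; move: (bcE d); case: (d == b); case: (d == c) => //= _; lia.
- move=> d e dv ev l r k; rewrite !incE.
  have := pat_lt z1 dv ev l r k; have := pat_lt z2 dv ev l r k; rewrite !E.
  move: (bcE d) (bcE e).
  by case: (d == b); case: (d == c); case: (e == b); case: (e == c) => //= _ _; lia.
- move=> d e dv ev l r k; rewrite !incE.
  have := pat_le z1 dv ev l r k; have := pat_le z2 dv ev l r k; rewrite !E.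
  move: (bcE d) (bcE e).
  by case: (d == b); case: (d == c); case: (e == b); case: (e == c) => //= _ _; lia.
- move=> d ad; rewrite decE; have := pat_fixed z1 ad; have := pat_fixed z2 ad.
  by rewrite E; move: (bcE d); case: (d == b); case: (d == c) => //= _; lia.
- move=> d e dv ev l r k; rewrite !decE.
  have := pat_lt z1 dv ev l r k; have := pat_lt z2 dv ev l r k; rewrite !E.
  move: (bcE d) (bcE e).
  by case: (d == b); case: (d == c); case: (e == b); case: (e == c) => //= _ _; lia.
- move=> d e dv ev l r k; rewrite !decE.
  have := pat_le z1 dv ev l r k; have := pat_le z2 dv ev l r k; rewrite !E.
  move: (bcE d) (bcE e).
  by case: (d == b); case: (d == c); case: (e == b); case: (e == c) => //= _ _; lia.
Qed.

(** The blocking neighbour lies in an adjacent row, and its root, diminished by 1 if it is in row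
    r-1, equals [x_b]. This is the zero that will cancel the pole at [x_b]. *)
Lemma not_pat_inc z b : pat z -> active b -> ~~ pat (z + unit_at b) ->
  (exists c, [/\ inrow (row b).+1 c, lay c = lay b, col c = (col b).+1 & z c = z b]) \/
  (exists c, [/\ inrow (row b).-1 c, lay c = lay b, col c = col b & z c = z b + 1]).
Proof.
move=> /patP zp ab /negP; apply: contra_notP => /not_orP[/forallNP h1 /forallNP h2].
have /andP[bn bv] := ab.
apply/patP; split=> [d ad|d c dv cv l r k|d c dv cv l r k]; rewrite !incE.
- have -> : (d == b) = false by apply: contraNF ad => /eqP ->.
  by rewrite addr0 pat_fixed.
- have := pat_lt zp dv cv l r k; have [cb|cb] := eqVneq c b; last first.
    by case: (d == b) => /=; lia.
  have -> : (d == b) = false by apply/eqP => db; move: r; rewrite db cb; lia.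
  have := h2 d; rewrite /inrow -cb r dv eqxx -k -l => h zcd.
  suff: z d <> z c + 1 by lia.
  by move=> E; apply: h.
- have := pat_le zp dv cv l r k; have [db|db] := eqVneq d b; last first.
    by case: (c == b) => /=; lia.
  have -> : (c == b) = false by apply/eqP => cb; move: r; rewrite db cb; lia.
  have := h1 c; rewrite /inrow -db r cv eqxx k -l => h zcd.
  suff: z c <> z d by lia.
  by move=> E; apply: h.
Qed.

Lemma not_pat_dec z b : pat z -> active b -> ~~ pat (z - unit_at b) ->
  (exists c, [/\ inrow (row b).+1 c, lay c = lay b, col c = col b & z c = z b - 1]) \/
  (exists c, [/\ inrow (row b).-1 c, lay c = lay b, col b = (col c).+1 & z c = z b]).
Proof.
move=> /patP zp ab /negP; apply: contra_notP => /not_orP[/forallNP h1 /forallNP h2].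
have /andP[bn bv] := ab.
apply/patP; split=> [d ad|d c dv cv l r k|d c dv cv l r k]; rewrite !decE.
- have -> : (d == b) = false by apply: contraNF ad => /eqP ->.
  by rewrite subr0 pat_fixed.
- have := pat_lt zp dv cv l r k; have [db|db] := eqVneq d b; last first.
    by case: (c == b) => /=; lia.
  have -> : (c == b) = false by apply/eqP => cb; move: r; rewrite db cb; lia.
  have := h1 c; rewrite /inrow -db r cv eqxx k -l => h zcd.
  suff: z c <> z d - 1 by lia.
  by move=> E; apply: h.
- have := pat_le zp dv cv l r k; have [cb|cb] := eqVneq c b; last first.
    by case: (d == b) => /=; lia.
  have -> : (d == b) = false by apply/eqP => db; move: r; rewrite db cb; lia.
  have := h2 d; rewrite /inrow -cb r dv eqxx k -l => h zcd.
  suff: z d <> z c by lia.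
  by move=> E; apply: h.
Qed.

Lemma pat_inc_active z b : pat z -> pat (z + unit_at b) -> active b.
Proof.
move=> /patP z1 /patP z2; apply: contraT => ab.
by have := pat_fixed z2 ab; rewrite incE eqxx (pat_fixed z1 ab) /=; lia.
Qed.

Lemma pat_dec_active z b : pat z -> pat (z - unit_at b) -> active b.
Proof.
move=> /patP z1 /patP z2; apply: contraT => ab.
by have := pat_fixed z2 ab; rewrite decE eqxx (pat_fixed z1 ab) /=; lia.
Qed.

Lemma ex_pat_dec z : pat z -> z != top -> exists2 b, active b & pat (z - unit_at b).
Proof.
move=> zp ztop; have zge b : top b <= z b := pat_ge_top b zp.
have [b0 b0P] : exists b, top b < z b.
  apply/existsP; apply: contraNT ztop; rewrite negb_exists => /forallP h.
  by apply/eqP/ffunP => b; apply: le_anti; rewrite zge andbT leNgt.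
(* Lexicographic choice: smallest column, then largest row. A neighbour that blocks the move would
   also exceed [top], and it comes earlier in this order. *)
pose m b := (col b * n.+1 + (n - row b))%N.
case: (@arg_minnP _ b0 (fun b => top b < z b) m b0P) => b bP bmin.
have ab : active b.
  apply: contraTT bP => ab; rewrite -leNgt; have /patP zpp := zp.
  by rewrite (pat_fixed zpp).
exists b => //; apply: contraT => /(not_pat_dec zp ab).
have /andP[bn /andP[cb lb]] := ab.
case=> [[c [/andP[/eqP rc cv] lc cc zc]]|[c [/andP[/eqP rc cv] lc cc zc]]].
  have : top c < z c.
    by rewrite zc; move: bP; rewrite !ffunE lc cc rc; lia.
  by move=> /bmin; rewrite /m rc cc; lia.
have : top c < z c.
  rewrite zc; move: bP; rewrite !ffunE lc cc rc.
  by have := gaps_le (col c) (lay b); lia.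
by move=> /bmin; rewrite /m cc; have := row_le c; nia.
Qed.

(** The sum is nonnegative on patterns, so [absz] is a mere conversion there. *)
Definition depth z : nat := absz (\sum_b (z b - top b)).

Lemma depth_top : depth top = 0%N.
Proof. by rewrite /depth big1 // => b _; rewrite subrr. Qed.

Lemma depth_inc z b : pat z -> depth (z + unit_at b) = (depth z).+1.
Proof.
move=> zp; rewrite /depth.
have -> : \sum_c ((z + unit_at b) c - top c) = \sum_c (z c - top c) + 1.
  under eq_bigr => c _ do rewrite incE addrAC.
  rewrite big_split /=; congr (_ + _).
  by rewrite (bigD1 b) //= eqxx big1 ?addr0 // => c /negPf ->.
have : 0 <= \sum_c (z c - top c).
  by apply: sumr_ge0 => c _; rewrite subr_ge0 pat_ge_top.
by lia.
Qed.

Lemma depth0 z : pat z -> depth z = 0%N -> z = top.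
Proof.
move=> zp z0; apply/eqP; apply: contraT => /(ex_pat_dec zp)[b _ bp].
by move: z0; rewrite -[z](subrK (unit_at b)) depth_inc.
Qed.

End States.

(** * Matrix coefficients *)

Section Coefficients.
Variables (K : numFieldType) (n : nat) (p : nat -> nat) (lam : nat -> nat -> K).
Hypothesis W : generic_dominant n p lam.
Notation box := (box n p).
Notation state := (state n p).
Notation x := (root_at lam).
Notation pat := (pat lam).
Implicit Types (b c d : box) (z : state).

(** The residue at [x_b] of [d_r(u)^-1 d_(r+1)(u)] must be [- F_b E_b], with [E_b] taken at
    [z + unit_at b]; [f_factor] takes its zeros from row r-1 and [e_factor] those from row r+1. The
    default factor 1 allows products over all other boxes, in which each entry affects a single
    factor. *)
Definition f_factor b c (s t : K) : K :=
  if inrow (row b).-1 c then s + 1 - t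
  else if inrow (row b) c then (s - t)^-1 else 1.

Definition e_factor b c (s t : K) : K :=
  if inrow (row b).+1 c then s - 1 - t
  else if inrow (row b) c then (s - t)^-1 else 1.

Definition f_coef z b : K := \prod_(c | c != b) f_factor b c (x z b) (x z c).
Definition e_coef z b : K := - \prod_(c | c != b) e_factor b c (x z b) (x z c).

Lemma valid_row b : valid b -> (0 < row b)%N.
Proof. by move=> /andP[]; lia. Qed.

(** Moving one of the two boxes changes, in the coefficient of the other, only the factor of the
    pair. It remains to compare these factors ([E]) according to the difference of the rows. *)
Lemma ef_coef_comm z b c : b != c -> valid b -> valid c ->
  e_coef z c * f_coef (z - unit_at c) b = f_coef z b * e_coef (z + unit_at b) c.
Proof.
move=> bc bv cv; have cb : c != b by rewrite eq_sym.
rewrite /e_coef /f_coef (bigD1 b) //= [X in _ * X = _](bigD1 c) //=.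
rewrite [X in _ = X * _](bigD1 c) //= [X in _ = _ * - X](bigD1 b) //=.
rewrite !root_at_inc !root_at_dec !eqxx (negPf bc) (negPf cb) /= addr0 subr0.
set e1 := e_factor _ _ _ (x z b); set f1 := f_factor _ _ _ (_ - _).
set f2 := f_factor _ _ _ (x z c); set e2 := e_factor _ _ _ (_ + _).
have E : e1 * f1 = f2 * e2.
  rewrite /e1 /e2 /f1 /f2 /e_factor /f_factor /inrow bv cv !andbT.
  have := valid_row bv; rewrite !(eq_sym (row b)).
  case: (row b) => // r _; rewrite eqSS succnK.
  have [_|_] := eqVneq (row c) r; first by ring.
  have [_|_] := eqVneq (row c) r.+1; last by rewrite mulr1.
  have -> : x z c - (x z b + 1) = - (x z b - (x z c - 1)) by ring.
  by rewrite -[x z c - x z b]opprB !invrN mulrN mulNr mulrC.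
set P1 := (X in - (e1 * X)); set P2 := (X in f1 * X).
set P3 := (X in f2 * X); set P4 := (X in e2 * X).
have -> : P4 = P1.
  apply: eq_bigr => d /andP[dc db]; rewrite !root_at_inc (negPf db).
  by rewrite addr0.
have -> : P2 = P3.
  apply: eq_bigr => d /andP[db dc]; rewrite !root_at_dec (negPf dc).
  by rewrite subr0.
have -> : - (e1 * P1) * (f1 * P3) = - (P1 * P3) * (e1 * f1) by ring.
by rewrite E; ring.
Qed.

Lemma root_at_neq z b c (t : int) : valid b -> valid c ->
  (lay b = lay c -> z b + t != z c) -> x z b + t%:~R != x z c.
Proof.
move=> bv cv h; apply/eqP => E.
have : x z b + t%:~R = x z c + 0%:~R by rewrite addr0.
by move/(root_at_eq W bv cv) => [/h/eqP ne]; rewrite addr0.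
Qed.

Lemma root_at_inj z b c : pat z -> inrow (row b) c -> valid b -> c != b ->
  x z b != x z c.
Proof.
move=> zp /andP[/eqP rc cv] bv cb; rewrite -[x z b]addr0.
apply: (@root_at_neq _ _ _ 0) => // l; rewrite addr0; apply/eqP => E.
have [cc|cc] := leqP (col b) (col c).
  have := pat_row_lt W zp bv cv (esym rc) l cc; rewrite E => h.
  by case/eqP: cb; apply: box_eq => //; lia.
have := pat_row_lt W zp cv bv rc (esym l) (ltnW cc); rewrite E; lia.
Qed.

(** A numerator vanishes only if [x_c = x_b + 1] for some [c] in row r-1. From the column of [b] on,
    [z c > z b + 1] because [z + unit_at b] is a pattern; in earlier columns [z c <= z b]. *)
Lemma f_coef_neq0 z b : pat z -> pat (z + unit_at b) -> f_coef z b != 0.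
Proof.
move=> zp zbp; have /andP[bn bv] := pat_inc_active W zp zbp.
apply/prodf_neq0 => c cb; rewrite /f_factor.
case: ifP => [/andP[/eqP rc cv]|_]; last first.
  case: ifP => [rc|_]; last exact: oner_neq0.
  by rewrite invr_eq0 subr_eq0 root_at_inj.
rewrite subr_eq0; apply: (@root_at_neq _ _ _ 1) => // l.
have /patP zpp := zp; have /patP zbpp := zbp.
have /andP[cb1 lb] := bv; have /andP[cc lc] := cv.
have r0 := valid_row bv.
have [cc1|cc1] := leqP (col b) (col c).
  have [d /andP[/eqP rd dv] [cd ld]] :=
    @ex_box _ _ _ _ W (row b).-1 (col b) (lay b) ltac:(lia) ltac:(lia) lb.
  have := pat_lt zbpp dv bv ld ltac:(lia) ltac:(lia).
  rewrite !incE eqxx.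
  have -> : (d == b) = false by apply/eqP => db; move: rd; rewrite db; lia.
  have := pat_row_lt W zp dv cv ltac:(lia) ltac:(lia) ltac:(lia).
  by rewrite /= cd; lia.
have pc : (p (col c) <= p (col c).+1)%N.
  by apply: gd_p_mono W _ _; lia.
have [d /andP[/eqP rd dv] [cd ld]] :=
  @ex_box _ _ _ _ W (row b) (col c).+1 (lay b) ltac:(lia) ltac:(lia) ltac:(lia).
have := pat_le zpp cv dv ltac:(lia) ltac:(lia) ltac:(lia).
have := pat_row_lt W zp dv bv ltac:(lia) ltac:(lia) ltac:(lia).
by rewrite cd; lia.
Qed.

Lemma e_coef_neq0 z b : pat z -> pat (z - unit_at b) -> e_coef z b != 0.
Proof.
move=> zp zbp; have /andP[bn bv] := pat_dec_active W zp zbp.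
rewrite oppr_eq0; apply/prodf_neq0 => c cb; rewrite /e_factor.
case: ifP => [/andP[/eqP rc cv]|_]; last first.
  case: ifP => [rc|_]; last exact: oner_neq0.
  by rewrite invr_eq0 subr_eq0 root_at_inj.
rewrite subr_eq0; apply: (@root_at_neq _ _ _ (-1)) => // l.
have /patP zpp := zp; have /patP zbpp := zbp.
have /andP[cb1 lb] := bv; have /andP[cc lc] := cv.
have [cc1|cc1] := leqP (col c) (col b).
  have [d /andP[/eqP rd dv] [cd ld]] :=
    @ex_box _ _ _ _ W (row b).+1 (col b) (lay b) ltac:(lia) ltac:(lia) lb.
  have := pat_lt zbpp bv dv (esym ld) ltac:(lia) ltac:(lia).
  rewrite !decE eqxx.
  have -> : (d == b) = false by apply/eqP => db; move: rd; rewrite db; lia.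
  have := pat_row_lt W zp cv dv ltac:(lia) ltac:(lia) ltac:(lia).
  by rewrite /= cd; lia.
have pb : (p (col b) <= p (col b).+1)%N.
  by apply: gd_p_mono W _ _; lia.
have [d /andP[/eqP rd dv] [cd ld]] :=
  @ex_box _ _ _ _ W (row b).+1 (col b).+1 (lay b) ltac:(lia) ltac:(lia) ltac:(lia).
have := pat_le zpp bv dv ltac:(lia) ltac:(lia) ltac:(lia).
have := pat_row_lt W zp dv cv ltac:(lia) ltac:(lia) ltac:(lia).
by rewrite cd; lia.
Qed.

(** * Poles and residues of [d_r(u)^-1 d_(r+1)(u)] *)

Definition row_enum r : seq box := enum (inrow r).
Definition roots r z : seq K := [seq x z c | c <- row_enum r].
Definition roots1 r z : seq K := [seq x z c - 1 | c <- row_enum r].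

Lemma mem_row_enum r c : (c \in row_enum r) = inrow r c.
Proof. by rewrite mem_enum. Qed.

Definition d_series r z := ps_ratio (roots r z) (roots1 r.-1 z).
Definition h_series r z :=
  ps_ratio (roots r.+1 z ++ roots1 r.-1 z) (roots1 r z ++ roots r z).

Lemma h_seriesE r z : (0 < r)%N ->
  h_series r z = ps_ratio (roots1 r.-1 z) (roots r z) * d_series r.+1 z.
Proof.
case: r => // r _; rewrite /h_series /d_series -ps_ratioM.
by apply: ps_ratio_perm; rewrite perm_catC.
Qed.

Lemma d_series0 r z : d_series r z 0%N = 1.
Proof. exact: ps_ratio0. Qed.

(** A pole [x_b] stands for raising the entry at [b], a pole [x_b - 1] for lowering it; it is good
    if the move leads to a pattern. *)
Let good r z : seq K := [seq x z b | b <- row_enum r & pat (z + unit_at b)] ++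
  [seq x z b - 1 | b <- row_enum r & pat (z - unit_at b)].
Let bad r z : seq K := [seq x z b | b <- row_enum r & ~~ pat (z + unit_at b)] ++
  [seq x z b - 1 | b <- row_enum r & ~~ pat (z - unit_at b)].

Lemma root_at_lay z b c (t : int) : lay c = lay b -> z c = z b + t ->
  x z c = x z b + t%:~R.
Proof. by move=> l zc; rewrite /root_at l zc intrD addrAC. Qed.

(** Each forbidden move has a wall, which supplies a zero at the pole. A value occurs at most twice
    among the bad poles, as [x_b] and as [x_c - 1]; then [c] is the right neighbour of [b], and
    betweenness squeezes the two boxes adjacent to both, in rows r+1 and r-1, so that each gives a
    zero at this value. *)
Let bad_zeros r z (v : K) : pat z -> (r < n)%N ->
  (count_mem v (bad r z) <= count_mem v (roots r.+1 z ++ roots1 r.-1 z))%N.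
Proof.
move=> zp rn; rewrite /bad /roots /roots1 !count_cat -!sum1_count !big_map 2!big_filter_cond.
rewrite /row_enum !big_enum_cond /= !sum1_card.
set D := #|_|; set E := #|_|; set Z1 := #|_|; set Z2 := #|_|.
have active_row b : inrow r b -> active b.
  by move=> /andP[/eqP rb bv]; rewrite /active rb rn.
have DP b : b \in [pred i | inrow r i & (~~ pat (z + unit_at i) && (x z i == v))] ->
    [/\ inrow r b, ~~ pat (z + unit_at b) & x z b = v].
  by move=> /andP[? /andP[? /eqP ?]].
have EP b : b \in [pred i | inrow r i & (~~ pat (z - unit_at i) && (x z i - 1 == v))] ->
    [/\ inrow r b, ~~ pat (z - unit_at b) & x z b - 1 = v].
  by move=> /andP[? /andP[? /eqP ?]].
have inj b c : inrow r b -> inrow r c -> x z b = x z c -> b = c.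
  move=> /andP[/eqP rb bv] rc E'; apply/esym/eqP; apply: contraT => cb.
  by have := root_at_inj zp _ bv cb; rewrite rb rc E' eqxx => /(_ isT).
have D1 : (D <= 1)%N.
  apply/card_le1_eqP => b c /DP[rb _ bv] /DP[rc _ cv].
  by apply: inj => //; rewrite bv cv.
have E1 : (E <= 1)%N.
  apply/card_le1_eqP => b c /EP[rb _ bv] /EP[rc _ cv].
  by apply: inj => //; apply: (@addIr _ (-1)); rewrite bv cv.
have Z1_gt0 c : inrow r.+1 c -> x z c = v -> (0 < Z1)%N.
  by move=> rc cv; apply/card_gt0P; exists c; apply/andP; split=> //=; rewrite cv eqxx.
have Z2_gt0 c : inrow r.-1 c -> x z c - 1 = v -> (0 < Z2)%N.
  by move=> rc cv; apply/card_gt0P; exists c; apply/andP; split=> //=; rewrite cv eqxx.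
have [D0|D_gt0] := posnP D; have [E0|E_gt0] := posnP E; first by rewrite D0 E0.
- have /card_gt0P[b /EP[rb bp bv]] := E_gt0.
  suff : (0 < Z1)%N || (0 < Z2)%N by lia.
  have := not_pat_dec W zp (active_row b rb) bp; have /andP[/eqP -> _] := rb.
  case=> [[c [rc lc cc zc]]|[c [rc lc cc zc]]]; apply/orP.
    by left; apply: Z1_gt0 rc _; rewrite -bv (root_at_lay lc zc).
  by right; apply: Z2_gt0 rc _; rewrite -bv (@root_at_lay z b c 0) ?addr0.
- have /card_gt0P[b /DP[rb bp bv]] := D_gt0.
  suff : (0 < Z1)%N || (0 < Z2)%N by lia.
  have := not_pat_inc W zp (active_row b rb) bp; have /andP[/eqP -> _] := rb.
  case=> [[c [rc lc cc zc]]|[c [rc lc cc zc]]]; apply/orP.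
    by left; apply: Z1_gt0 rc _; rewrite -bv (@root_at_lay z b c 0) ?addr0.
  by right; apply: Z2_gt0 rc _; rewrite -bv (root_at_lay lc zc) addrK.
have /card_gt0P[b /DP[/andP[/eqP rb bv] _ bE]] := D_gt0.
have /card_gt0P[c /EP[/andP[/eqP rc cv] _ cE]] := E_gt0.
have [lbc zbc] : lay b = lay c /\ z b + 0 = z c + (-1).
  by apply: (root_at_eq W) => //; rewrite addr0 bE cE.
have /andP[cb lb] := bv; have /andP[cc lc] := cv.
have cbc : col c = (col b).+1.
  have [cbc|cbc] := leqP (col c) (col b).
    by have := pat_row_lt W zp cv bv ltac:(lia) (esym lbc) cbc; lia.
  by have := pat_row_lt W zp bv cv ltac:(lia) lbc (ltnW cbc); lia.
have /patP zpp := zp.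
have pb : (p (col b) <= p (col b).+1)%N by apply: gd_p_mono W _ _; lia.
have [d1 rd1 [cd1 ld1]] :=
  @ex_box _ _ _ _ W r.+1 (col b).+1 (lay b) ltac:(lia) ltac:(lia) ltac:(lia).
have [d2 rd2 [cd2 ld2]] :=
  @ex_box _ _ _ _ W r.-1 (col b) (lay b) ltac:(lia) ltac:(lia) ltac:(lia).
have /andP[/eqP rd1' dv1] := rd1; have /andP[/eqP rd2' dv2] := rd2.
have zd1 : z d1 = z b + 0.
  have := pat_le zpp bv dv1 (esym ld1) ltac:(lia) cd1.
  by have := pat_lt zpp cv dv1 ltac:(lia) ltac:(lia) ltac:(lia); lia.
have zd2 : z d2 = z b + 1.
  have := pat_lt zpp dv2 bv ltac:(lia) ltac:(lia) ltac:(lia).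
  by have := pat_le zpp dv2 cv ltac:(lia) ltac:(lia) ltac:(lia); lia.
have := Z1_gt0 d1 rd1; rewrite (root_at_lay ld1 zd1) addr0 bE => /(_ erefl).
have := Z2_gt0 d2 rd2; rewrite (root_at_lay ld2 zd2) addrK bE => /(_ erefl).
by lia.
Qed.

Let perm_good_bad r z : perm_eq (roots r z ++ roots1 r z) (good r z ++ bad r z).
Proof.
rewrite perm_sym /good /bad perm_catACA; apply: perm_cat; rewrite -map_cat;
  by apply: perm_map; apply/permPl/perm_filterC.
Qed.

Let mem_sel (a : pred box) r c :
  (c \in [seq b <- row_enum r | a b]) = a c && inrow r c.
Proof. by rewrite mem_filter mem_row_enum. Qed.

Let prod_split (b : box) (A B : pred box) (F G : box -> K) :
  ~~ A b -> (forall c, A c -> ~~ B c) ->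
  \prod_(c | c != b) (if A c then F c else if B c then (G c)^-1 else 1) =
  (\prod_(c | A c) F c) * (\prod_(c | B c && (c != b)) G c)^-1.
Proof.
move=> Ab AB; rewrite -prodfV big_mkcond [X in _ = X * _]big_mkcond.
rewrite [X in _ = _ * X]big_mkcond -big_split; apply: eq_bigr => c _ /=.
have [->|cb] := eqVneq c b; first by rewrite (negPf Ab) andbF mulr1.
case: ifP => [/AB /negPf -> | _]; first by rewrite mulr1.
by rewrite andbT mul1r.
Qed.

Lemma f_coefE z b : valid b -> f_coef z b =
  (\prod_(c | inrow (row b).-1 c) (x z b + 1 - x z c)) *
  (\prod_(c | inrow (row b) c && (c != b)) (x z b - x z c))^-1.
Proof.
move=> bv; apply: prod_split => [|c /andP[/eqP rc _]].
  by rewrite /inrow; have := valid_row bv; case: eqP => //; lia.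
by rewrite /inrow rc; have := valid_row bv; case: eqP => //; lia.
Qed.

Lemma e_coefE z b : valid b -> e_coef z b =
  - ((\prod_(c | inrow (row b).+1 c) (x z b - 1 - x z c)) *
  (\prod_(c | inrow (row b) c && (c != b)) (x z b - x z c))^-1).
Proof.
move=> bv; congr (- _); apply: prod_split => [|c /andP[/eqP rc _]].
  by rewrite /inrow; case: eqP => //; lia.
by rewrite /inrow rc; case: eqP => //; lia.
Qed.

Let roots_inj r z b c : pat z -> inrow r b -> inrow r c ->
  (x z c == x z b) = (c == b).
Proof.
move=> zp rb rc; have [->|cb] := eqVneq c b; first by rewrite eqxx.
have /andP[/eqP rbr bv] := rb.
by apply/eqP => E; have := root_at_inj zp _ bv cb; rewrite rbr rc E eqxx => /(_ isT).
Qed.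

(* A root [x_b] and a shifted root [x_c - 1] of the same row only meet at a wall. *)
Let wall r z b c : pat z -> inrow r b -> inrow r c -> x z b = x z c - 1 ->
  ~~ pat (z + unit_at b) /\ ~~ pat (z - unit_at c).
Proof.
move=> zp rb rc E.
have cb : c != b.
  by apply/eqP => cb; move/eqP: E; rewrite cb -subr_eq0 opprB addrCA subrr addr0 oner_eq0.
split; apply/negP => zp'.
  have := roots_inj zp' rb rc; rewrite !root_at_inc eqxx (negPf cb) /= E.
  by rewrite subrK addr0 eqxx.
have := roots_inj zp' rb rc; rewrite !root_at_dec eqxx (negPf cb) /= E.
by rewrite [b == c]eq_sym (negPf cb) subr0 eqxx.
Qed.

Let prod_zeros r z y : \prod_(t <- roots r.+1 z ++ roots1 r.-1 z) (y - t) =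
  (\prod_(c | inrow r.+1 c) (y - x z c)) * \prod_(c | inrow r.-1 c) (y + 1 - x z c).
Proof.
rewrite big_cat !big_map !big_enum /=; congr (_ * _).
by apply: eq_bigr => c _; rewrite opprB addrA.
Qed.

Let prod_poles r z y :
  \prod_(t <- roots1 r z ++ roots r z | t != y) (y - t) =
  (\prod_(c | inrow r c && (x z c - 1 != y)) (y + 1 - x z c)) *
  \prod_(c | inrow r c && (x z c != y)) (y - x z c).
Proof.
rewrite big_cat !big_map !big_enum_cond /=; congr (_ * _).
by apply: eq_bigr => c _; rewrite opprB addrA.
Qed.

Let residue_inc r z b : inrow r b -> pat z -> pat (z + unit_at b) ->
  (\prod_(t <- roots r.+1 z ++ roots1 r.-1 z) (x z b - t)) *
  (\prod_(t <- roots1 r z ++ roots r z | t != x z b) (x z b - t))^-1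
  = - (f_coef z b * e_coef (z + unit_at b) b).
Proof.
move=> rb zp zbp; have /andP[/eqP rbr bv] := rb.
rewrite prod_zeros prod_poles f_coefE // e_coefE // rbr root_at_inc eqxx addrK.
rewrite [X in _ * (X * _)^-1](bigD1 b) /=; last first.
  by rewrite rb /= -subr_eq0 addrAC subrr sub0r oppr_eq0 oner_eq0.
rewrite [x z b + 1 - _]addrAC subrr add0r mul1r.
rewrite [X in _ * (X * _)^-1](eq_bigl (fun c => inrow r c && (c != b))); last first.
  move=> c; case rc: (inrow r c) => //=; rewrite -[RHS]andTb; congr (_ && _).
  by apply/eqP => E; have := wall zp rb rc (esym E); rewrite zbp; case.
rewrite [X in _ * (_ * X)^-1](eq_bigl (fun c => inrow r c && (c != b))); last first.
  by move=> c; case rc: (inrow r c) => //=; rewrite (roots_inj zp rb rc).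
have -> : \prod_(c | inrow r.+1 c) (x z b - x (z + unit_at b) c)
    = \prod_(c | inrow r.+1 c) (x z b - x z c).
  apply: eq_bigr => c /andP[/eqP rc _]; rewrite root_at_inc.
  by case: eqP => [cb|_]; [move: rc; rewrite cb; lia|rewrite addr0].
have -> : \prod_(c | inrow r c && (c != b)) (x z b + 1 - x (z + unit_at b) c)
    = \prod_(c | inrow r c && (c != b)) (x z b + 1 - x z c).
  by apply: eq_bigr => c /andP[_ /negPf cb]; rewrite root_at_inc cb addr0.
by rewrite invfM; ring.
Qed.

(** The two poles of the box [b] itself differ by 1: they contribute a factor 1 at [x_b] but -1 at
    [x_b - 1], hence the opposite signs of the two residues. *)
Let residue_dec r z b : inrow r b -> pat z -> pat (z - unit_at b) ->
  (\prod_(t <- roots r.+1 z ++ roots1 r.-1 z) (x z b - 1 - t)) *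
  (\prod_(t <- roots1 r z ++ roots r z | t != x z b - 1) (x z b - 1 - t))^-1
  = e_coef z b * f_coef (z - unit_at b) b.
Proof.
move=> rb zp zbp; have /andP[/eqP rbr bv] := rb.
have r_gt0 := valid_row bv.
rewrite prod_zeros prod_poles f_coefE // e_coefE // rbr root_at_dec eqxx subrK.
rewrite [X in _ * (_ * X)^-1](bigD1 b) /=; last first.
  by rewrite rb /= eq_sym -subr_eq0 addrAC subrr sub0r oppr_eq0 oner_eq0.
rewrite [x z b - 1 - x z b]addrAC subrr add0r.
rewrite [X in _ * (X * _)^-1](eq_bigl (fun c => inrow r c && (c != b))); last first.
  move=> c; case rc: (inrow r c) => //=.
  by rewrite (inj_eq (addIr _)) (roots_inj zp rb rc).
rewrite [X in _ * (_ * (_ * X))^-1](eq_bigl (fun c => inrow r c && (c != b))); last first.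
  move=> c; case rc: (inrow r c) => //=; rewrite -[RHS]andTb; congr (_ && _).
  by apply/eqP => E; have := wall zp rc rb E; rewrite zbp; case.
have -> : \prod_(c | inrow r.-1 c) (x z b - x (z - unit_at b) c)
    = \prod_(c | inrow r.-1 c) (x z b - x z c).
  apply: eq_bigr => c /andP[/eqP rc _]; rewrite root_at_dec.
  by case: eqP => [cb|_]; [move: rc; rewrite cb rbr; lia|rewrite subr0].
have -> : \prod_(c | inrow r c && (c != b)) (x z b - 1 - x (z - unit_at b) c)
    = \prod_(c | inrow r c && (c != b)) (x z b - 1 - x z c).
  by apply: eq_bigr => c /andP[_ /negPf cb]; rewrite root_at_dec cb subr0.
by rewrite !invfM invrN1; ring.
Qed.

(** The excess of zeros over poles is [p r.+1 - p r], so the partial fractions take over at the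
    index [p r.+1 - p r + 1], exactly where [e_r] starts to be defined. The right-hand side is the
    diagonal part of [f e - e f]. *)
Lemma power_sum r z j : pat z -> (0 < r < n)%N ->
  h_series r z (p r.+1 - p r + 1 + j)%N =
  \sum_(b | inrow r b && pat (z - unit_at b))
      (x z b - 1) ^+ j * (e_coef z b * f_coef (z - unit_at b) b)
  - \sum_(b | inrow r b && pat (z + unit_at b))
      x z b ^+ j * (f_coef z b * e_coef (z + unit_at b) b).
Proof.
move=> zp /andP[r_gt0 rn].
have ysE : perm_eq (roots1 r z ++ roots r z) (good r z ++ bad r z).
  by rewrite (perm_trans _ (perm_good_bad r z)) // perm_catC.
have szs : size (roots r.+1 z ++ roots1 r.-1 z) =
    (size (roots1 r z ++ roots r z) + (p r.+1 - p r))%N.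
  rewrite !size_cat !size_map -!cardE (card_rowS W) //.
  have := @card_rowS _ _ _ _ W r.-1; rewrite prednK // => ->; last by lia.
  have pr : (p r <= p r.+1)%N by apply: gd_p_mono W _ _; lia.
  by move: #|inrow r.-1| => m; lia.
have inE' : {in good r z, forall y, (exists2 b, inrow r b & pat (z + unit_at b) /\ y = x z b)
    \/ (exists2 b, inrow r b & pat (z - unit_at b) /\ y = x z b - 1)}.
  move=> y; rewrite mem_cat => /orP[] /mapP[b]; rewrite mem_filter mem_row_enum.
    by move=> /andP[bp rb] ->; left; exists b.
  by move=> /andP[bp rb] ->; right; exists b.
have row_inj : {in inrow r &, injective (x z)}.
  by move=> b c rb rc /eqP; rewrite (roots_inj zp rc rb) => /eqP.
have row1_inj : {in inrow r &, injective (fun b => x z b - 1)}.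
  by move=> b c rb rc /addIr; apply: row_inj.
rewrite /h_series (ps_ratio_partial_fractions_cancel _ ysE (fun v => bad_zeros v zp rn)) //.
- rewrite /good big_cat /= !big_map 2!big_filter /row_enum !big_enum_cond /= addrC.
  congr (_ + _); last rewrite -sumrN.
    by apply: eq_bigr => b /andP[rb bp]; rewrite residue_dec // mulrC.
  apply: eq_bigr => b /andP[rb bp].
  by rewrite residue_inc // mulNr mulrC.
- have ue : uniq (row_enum r) := enum_uniq _.
  rewrite cat_uniq !map_inj_in_uniq ?(filter_uniq _ ue) //=.
  + rewrite andbT; apply/hasPn => _ /mapP[c cP ->]; move: cP.
    rewrite mem_sel => /andP[cp rc]; apply/mapP => -[b]; rewrite mem_sel.
    by move=> /andP[bp rb] /esym/(wall zp rb rc); rewrite bp; case.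
  + by move=> b c; rewrite 2!mem_sel => /andP[_ hb] /andP[_ hc]; exact: (row1_inj b c hb hc).
  + by move=> b c; rewrite 2!mem_sel => /andP[_ hb] /andP[_ hc]; exact: (row_inj b c hb hc).
move=> y /inE'; rewrite /bad mem_cat negb_or => -[] [b rb [bp ->]];
  apply/andP; split; apply/mapP => -[c]; rewrite mem_sel => /andP[cp rc].
- by move/row_inj => bc; move: cp; rewrite -bc ?bp.
- by move=> E; have := wall zp rb rc E; rewrite bp; case.
- by move=> E; have := wall zp rc rb (esym E); rewrite bp; case.
- by move/row1_inj => bc; move: cp; rewrite -bc ?bp.
Qed.

End Coefficients.

(** * Eigenvalues of [d_i(u)] and [a_i(u)], and the polynomials [C_i(u)] *)

Section CartanSeries.
Variables (K : numFieldType) (n : nat) (p : nat -> nat) (lam : nat -> nat -> K).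
Hypothesis W : generic_dominant n p lam.
Notation box := (box n p).
Notation state := (state n p).
Notation x := (root_at lam).
Notation pat := (pat lam).
Implicit Types (b c d : box) (z : state).

Lemma d_seriesE r z : d_series lam r z =
  (\prod_(c | inrow r c) linps (x z c)) * \prod_(c | inrow r.-1 c) geops (x z c - 1).
Proof. by rewrite /d_series /ps_ratio !big_map /row_enum !big_enum. Qed.

(** At the highest pattern a root of row i-1 diminished by 1 is the root of row i in the same column
    and layer. After cancellation only column [i] of row [i] is left. *)
Lemma d_series_top i : (0 < i <= n)%N ->
  d_series lam i (top n p lam) = \prod_(1 <= k < (p i).+1) linps (- lam i k).
Proof.
case: i => // i /= i_n; rewrite d_seriesE /=.
pose y j k : K := - lam j k + j%:R - i.+1%:R.
have -> : \prod_(c : box | inrow i.+1 c) linps (x (top n p lam) c) =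
    \prod_(c : box | inrow i.+1 c) linps (y (col c) (lay c)).
  by apply: eq_bigr => c /andP[/eqP rc cv]; rewrite root_at_top // rc.
have -> : \prod_(c : box | inrow i c) geops (x (top n p lam) c - 1) =
    \prod_(c : box | inrow i c) geops (y (col c) (lay c)).
  apply: eq_bigr => c /andP[/eqP rc cv]; rewrite root_at_top // rc /y.
  by congr geops; rewrite -natr1; ring.
rewrite (big_row W _ (fun j k => linps (y j k))) //.
rewrite (big_row W _ (fun j k => geops (y j k))) ?(ltnW i_n) //.
rewrite big_nat_recr //= mulrAC -big_split big1 => [|j _].
  by rewrite mul1r; apply: eq_bigr => k _; rewrite /y addrK.
by rewrite -big_split big1 // => k _; apply: linpsK.
Qed.

(** Row [r] supplies the zeros of [d_r] and the poles of [d_(r+1)], so only these two eigenvalues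
    change. The denominator is cleared to get a recursion on coefficients. *)
Lemma d_series_inc i r z b : inrow r b -> (0 < i)%N ->
  linps (x z b) * d_series lam i (z + unit_at b) =
  linps (x z b - ((i == r.+1)%:R - (i == r)%:R)) * d_series lam i z.
Proof.
move=> rb; case: i => // i _; have /andP[/eqP rbr bv] := rb.
rewrite !d_seriesE eqSS /=.
have rest (s : nat) (F : K -> pseries K) : s != r ->
    \prod_(c | inrow s c) F (x (z + unit_at b) c) = \prod_(c | inrow s c) F (x z c).
  move=> sr; apply: eq_bigr => c /andP[/eqP rc cv]; rewrite root_at_inc.
  by case: eqP => [cb|_]; [case/eqP: sr; rewrite -rc cb|rewrite addr0].
have this (F : K -> pseries K) : exists R : pseries K,
    \prod_(c | inrow r c) F (x (z + unit_at b) c) = F (x z b + 1) * R /\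
    \prod_(c | inrow r c) F (x z c) = F (x z b) * R.
  exists (\prod_(c | inrow r c && (c != b)) F (x z c)).
  rewrite (bigD1 b) //= [X in _ /\ X = _](bigD1 b) //=; split=> //.
  rewrite root_at_inc eqxx; congr (_ * _); apply: eq_bigr => c /andP[_ cb].
  by rewrite root_at_inc (negPf cb) addr0.
have [ir|ir] := eqVneq i r.
  have -> : (i.+1 == r) = false by rewrite ir; lia.
  rewrite rest; last by rewrite ir; lia.
  rewrite ir; have [R [-> ->]] := this (fun y => geops (y - 1)).
  rewrite addrK subr0 !mulrA [linps (x z b) * _]mulrC.
  rewrite -[_ * linps _ * geops _]mulrA linpsK mulr1.
  by rewrite [linps _ * _]mulrC -[_ * linps _ * geops _]mulrA linpsK mulr1.
rewrite (rest i (fun y => geops (y - 1))) // sub0r.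
have [ir'|ir'] := eqVneq i.+1 r.
  by rewrite ir'; have [R [-> ->]] := this (@linps K); rewrite opprK; ring.
by rewrite rest // oppr0 subr0.
Qed.

Definition a_roots r z : seq K := [seq x z c + r.-1%:R | c <- row_enum n p r].
Definition a_poles r : seq K := flatten [seq nseq (p k) (k.-1%:R : K) | k <- iota 1 r].

Fixpoint a_series r z : pseries K :=
  if r is r'.+1 then a_series r' z * ps_shift r'%:R (d_series lam r z) else 1.

Lemma size_a_poles r : (r <= n)%N -> size (a_poles r) = #|inrow (n := n) (p := p) r|.
Proof.
move=> rn; rewrite (card_row W) // size_flatten sumnE /shape -map_comp big_map.
by rewrite /index_iota subn1; apply: eq_bigr => k _; rewrite /= size_nseq.
Qed.

Lemma row_enum0 : row_enum n p 0 = [::].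
Proof.
apply/eqP; rewrite -size_eq0 -cardE; apply/eqP/eq_card0 => c.
by apply/negP => /andP[/eqP rc /andP[]]; rewrite rc; lia.
Qed.

(** The poles of [d_(r+1)(u - r)] at [x_c - 1 + r], for [c] in row [r], cancel the zeros of
    [a_r(u)]. The excess of [p r.+1] boxes in the next row leaves that many poles at [r]; [C_factor]
    clears them. *)
Lemma a_seriesE r z : (r <= n)%N -> a_series r z = ps_ratio (a_roots r z) (a_poles r).
Proof.
elim: r => [|r IHr] rn.
  by rewrite /a_roots row_enum0 /= ps_ratio_nil.
rewrite /= IHr ?(ltnW rn) // /d_series ps_shift_ratio.
have -> : [seq y + r%:R | y <- roots1 lam r.+1.-1 z] = a_roots r z.
  rewrite /a_roots /roots1 -map_comp /=; apply/eq_in_map => c.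
  rewrite mem_row_enum => /andP[/eqP rc cv] /=; have := valid_row cv; rewrite rc.
  by case: (r) => // r' _; rewrite -natr1 [_%:R + 1]addrC addrA subrK.
have -> : [seq y + r%:R | y <- roots lam r.+1 z] = a_roots r.+1 z.
  by rewrite /a_roots /roots -map_comp.
have -> : a_poles r.+1 = a_poles r ++ nseq (p r.+1) r%:R.
  have iotaE : iota 1 r.+1 = iota 1 r ++ [:: r.+1] by rewrite -(addn1 r) iotaD add1n addn1.
  by rewrite /a_poles iotaE map_cat flatten_cat /= cats0.
rewrite !size_map.
have -> : size (row_enum n p r.+1) = (size (row_enum n p r.+1.-1) + p r.+1)%N.
  by rewrite -!cardE (card_rowS W).
rewrite nseqD /= -!ps_ratioM.
set S := a_roots r z; set S' := a_roots r.+1 z; set N := nseq _ _.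
set M := nseq (p _) _.
transitivity (ps_ratio ((S ++ N) ++ S') ((S ++ N) ++ (a_poles r ++ M))).
  apply: ps_ratio_perm; apply/permP => a; rewrite !count_cat; lia.
by rewrite ps_ratioM ps_ratio_id mul1r.
Qed.

Lemma C_factorE r : C_factor K p r = \prod_(q <- a_poles r) ('X - q%:P).
Proof.
rewrite /C_factor /a_poles big_flatten big_map /index_iota subn1.
by apply: eq_bigr => k _; rewrite big_nseq iter_mulr_1.
Qed.

(** On the component of [b], the pole [x_b + r - 1] of [f_r(u - r + 1)] cancels one zero of
    [a_r(u)]. What remains is a multiple of a Lagrange polynomial, so [C_r] at the shifted root of
    [b] isolates this box. *)
Lemma C_polynomial r z b y : (r <= n)%N -> inrow r b ->
  let g := psX K * geops (x z b + r.-1%:R) * a_series r z in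
  \sum_(m < size (C_factor K p r))
     (\sum_(j < size (C_factor K p r) | (m <= j)%N) (C_factor K p r)`_j * g (j - m)%N)
     * y ^+ m
  = \prod_(c | inrow r c && (c != b)) (y - (x z c + r.-1%:R)).
Proof.
move=> rn rb g; pose s := [seq x z c + r.-1%:R | c <- row_enum n p r & c != b].
have rootsE : perm_eq (a_roots r z) (x z b + r.-1%:R :: s).
  rewrite /a_roots -(map_cons (fun c => x z c + r.-1%:R)); apply: perm_map.
  rewrite -rem_filter ?enum_uniq //; apply: perm_to_rem.
  by rewrite mem_row_enum.
have -> : g = psX K * ps_ratio s (a_poles r).
  rewrite /g a_seriesE // (ps_ratio_perm rootsE (perm_refl _)) ps_ratio_cons.
  by rewrite -mulrA geo_linps.
rewrite !C_factorE polynomial_part_ratio; last first.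
  have := perm_size rootsE; rewrite /= => <-.
  by rewrite size_map -cardE size_a_poles.
rewrite /s big_map big_filter big_enum_cond /=.
by [].
Qed.

Lemma C_polynomial_neq0 r z b : pat z -> inrow r b ->
  \prod_(c | inrow r c && (c != b)) (x z b + r.-1%:R - (x z c + r.-1%:R)) != 0.
Proof.
move=> zp /andP[/eqP rb bv]; apply/prodf_neq0 => c /andP[rc cb].
by rewrite opprD addrACA subrr addr0 subr_eq0 (root_at_inj W) // rb.
Qed.

Lemma C_polynomial_eq0 r z b b' : inrow r b -> b != b' ->
  \prod_(c | inrow r c && (c != b')) (x z b + r.-1%:R - (x z c + r.-1%:R)) = 0.
Proof. by move=> rb bb'; rewrite (bigD1 b) ?rb //= subrr mul0r. Qed.

End CartanSeries.

(** * Relations in the W-algebra *)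

Section MorphismLie.
Variables (A B : pzRingType) (f : {rmorphism A -> B}).
Implicit Types (a b : A) (s : bool) (F G : nat -> A).

Lemma morph_lie0 a b : f (lie a b) = f 0 -> f a * f b = f b * f a.
Proof. by rewrite /lie rmorphB !rmorphM rmorph0 => /subr0_eq. Qed.

Lemma morph_lieN a b s m F G :
  f (lie a b) = f (- s%:R * \sum_(0 <= t < m) F t * G t) ->
  f a * f b = f b * f a - s%:R * \sum_(0 <= t < m) f (F t) * f (G t).
Proof.
rewrite /lie rmorphB !rmorphM rmorphN rmorph_nat rmorph_sum mulNr => /eqP.
rewrite subr_eq addrC => /eqP ->; congr (_ - _ * _).
by apply: eq_bigr => t _; rewrite rmorphM.
Qed.

Lemma morph_lieB a b s (s' : bool) m F G :
  f (lie a b) = f ((s%:R - s'%:R) * \sum_(0 <= t < m) F t * G t) ->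
  f a * f b = f b * f a + (s%:R - s'%:R) * \sum_(0 <= t < m) f (F t) * f (G t).
Proof.
rewrite /lie rmorphB !rmorphM rmorphB !rmorph_nat rmorph_sum => /eqP.
rewrite subr_eq addrC => /eqP ->; congr (_ + _ * _).
by apply: eq_bigr => t _; rewrite rmorphM.
Qed.

Lemma morph_ser_inv (u v : nat -> A) m :
  \sum_(t < m.+1) u t * v (m - t)%N = (m == 0%N)%:R ->
  \sum_(t < m.+1) f (u t) * f (v (m - t)%N) = (m == 0%N)%:R.
Proof.
move=> /(congr1 f); rewrite rmorph_sum rmorph_nat => <-.
by apply: eq_bigr => t _; rewrite rmorphM.
Qed.

End MorphismLie.

Section LieSteps.
Variables (B : pzRingType) (x f : nat -> B) (k : B).

(** The sums for [(r + 1, s)] and [(r, s + 1)] differ by one term: this is the coefficient form of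
    [(u - v) [d(u), f(v)]]. *)
Lemma lie_sum_step r s :
  (forall r s, (0 < s)%N -> x r * f s =
    f s * x r + k * \sum_(0 <= t < r) f (r + s - t - 1)%N * x t) -> (0 < s)%N ->
  x r.+1 * f s = f s * x r.+1 + (x r * f s.+1 - f s.+1 * x r) + k * (f s * x r).
Proof.
move=> xf s_gt0; rewrite !xf // big_nat_recr //= mulrDr addrA.
rewrite [f s.+1 * _ + _]addrC addrK.
have -> : (r.+1 + s - r - 1 = s)%N by lia.
congr (_ + _ * _ + _); apply: eq_big_nat => t /andP[_ tr].
by congr (f _ * _); lia.
Qed.

Lemma comm_one (a b : B) : a = 1 -> a * b = b * a.
Proof. by move=> ->; rewrite mul1r mulr1. Qed.

Lemma comm_one_sum (a b : B) (k' : B) (F : nat -> B) :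
  a = 1 -> a * b = b * a + k' * \sum_(0 <= t < 0) F t.
Proof. by move=> ->; rewrite big_nil mulr0 addr0 mul1r mulr1. Qed.

End LieSteps.

Section Relations.
Variables (K : numFieldType) (n : nat) (p : nat -> nat).
Notation FA := (free_algebra K (generator n p)).
Notation WA := (W_algebra K n p).
Notation wd := (wd K n p).
Notation wf := (wf K n p).
Notation we := (we K n p).

Definition to_yangian (a : FA) : yangian K n p := quot_pi (@yangian_relators K n p) a.
Definition of_yangian (a : yangian K n p) : WA := quot_pi (@W_relators K n p) a.
HB.instance Definition _ := GRing.RMorphism.copy to_yangian (quot_pi (@yangian_relators K n p)).
HB.instance Definition _ := GRing.RMorphism.copy of_yangian (quot_pi (@W_relators K n p)).
HB.instance Definition _ := GRing.Linear.copy to_yangian (quot_pi (@yangian_relators K n p)).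
HB.instance Definition _ := GRing.Linear.copy of_yangian (quot_pi (@W_relators K n p)).

Definition to_W : FA -> WA := of_yangian \o to_yangian.
HB.instance Definition _ := GRing.RMorphism.on to_W.
HB.instance Definition _ := GRing.Linear.on to_W.

Lemma to_W_rel a b : yangian_rel a b -> to_W a = to_W b.
Proof.
move=> ab; congr of_yangian; apply/quot_piP; apply: ideal_gen_sub.
by exists a, b.
Qed.

Lemma wd0 i : wd i 0 = 1.
Proof. exact: (rmorph1 to_W). Qed.

Definition wd' i r : WA := to_W (fd' K n p i r).

Lemma wd'P i m : \sum_(t < m.+1) wd i t * wd' i (m - t)%N = (m == 0%N)%:R.
Proof. exact: (morph_ser_inv to_W (ser_invP (erefl : fd K n p i 0%N = 1) m)). Qed.

Lemma W_dd i j r s : (0 < i <= n)%N -> (0 < j <= n)%N ->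
  wd i r * wd j s = wd j s * wd i r.
Proof.
move=> i_n j_n; case: r => [|r]; first exact/comm_one/wd0.
case: s => [|s]; first exact/esym/comm_one/wd0.
apply: (morph_lie0 (f := to_W)); apply/to_W_rel/rel_dd; rewrite /= ?i_n ?j_n //.
Qed.

Lemma W_ef i j r s : (0 < i < n)%N -> (0 < j < n)%N ->
  (p i.+1 - p i + 1 <= r)%N -> (0 < s)%N ->
  we i r * wf j s = wf j s * we i r -
    (i == j)%:R * \sum_(0 <= t < r + s) wd' i t * wd i.+1 (r + s - t - 1).
Proof.
move=> i_n j_n r_p s_gt0.
apply: (morph_lieN (f := to_W)); apply/to_W_rel/rel_ef; rewrite /= ?i_n ?j_n ?r_p //.
Qed.

Lemma W_de i j r s : (0 < i <= n)%N -> (0 < j < n)%N ->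
  (p j.+1 - p j + 1 <= s)%N ->
  wd i r * we j s = we j s * wd i r + ((i == j)%:R - (i == j.+1)%:R) *
    \sum_(0 <= t < r) wd i t * we j (r + s - t - 1).
Proof.
move=> i_n j_n s_p; case: r => [|r]; first exact/comm_one_sum/wd0.
apply: (morph_lieB (f := to_W)); apply/to_W_rel/rel_de; rewrite /= ?i_n ?j_n ?s_p //.
Qed.

Lemma W_df i j r s : (0 < i <= n)%N -> (0 < j < n)%N -> (0 < s)%N ->
  wd i r * wf j s = wf j s * wd i r + ((i == j.+1)%:R - (i == j)%:R) *
    \sum_(0 <= t < r) wf j (r + s - t - 1) * wd i t.
Proof.
move=> i_n j_n s_p; case: r => [|r]; first exact/comm_one_sum/wd0.
apply: (morph_lieB (f := to_W)); apply/to_W_rel/rel_df; rewrite /= ?i_n ?j_n ?s_p //.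
Qed.

Lemma W_df_step i j r s : (0 < i <= n)%N -> (0 < j < n)%N -> (0 < s)%N ->
  wd i r.+1 * wf j s = wf j s * wd i r.+1 + (wd i r * wf j s.+1 - wf j s.+1 * wd i r)
    + ((i == j.+1)%:R - (i == j)%:R) * (wf j s * wd i r).
Proof.
by move=> i_n j_n s_gt0; apply: lie_sum_step => // r' s' s'_gt0; apply: W_df.
Qed.

End Relations.

(** * Representations of the W-algebra *)

Section Action.
Variables (K : comNzRingType) (A : algType K) (V : lmodType K).
Variable rho : representation A V.

HB.instance Definition _ (a : A) :=
  GRing.isLinear.Build K V V *:%R (rho a) (rep_linearr rho a).

Let left (v : V) (a : A) : V := rho a v.
HB.instance Definition _ (v : V) :=
  GRing.isLinear.Build K A V *:%R (left v) (rep_linearl rho v).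

Lemma act0 v : rho 0 v = 0. Proof. exact: (linear0 (left v)). Qed.
Lemma actD a b v : rho (a + b) v = rho a v + rho b v.
Proof. exact: (linearD (left v)). Qed.
Lemma actN a v : rho (- a) v = - rho a v. Proof. exact: (linearN (left v)). Qed.
Lemma actB a b v : rho (a - b) v = rho a v - rho b v.
Proof. exact: (linearB (left v)). Qed.
Lemma actZ c a v : rho (c *: a) v = c *: rho a v.
Proof. exact: (linearZ_LR (left v)). Qed.
Lemma act_sum I (r : seq I) (P : pred I) (F : I -> A) v :
  rho (\sum_(i <- r | P i) F i) v = \sum_(i <- r | P i) rho (F i) v.
Proof. exact: (linear_sum (left v)). Qed.

Lemma act_nat (m : nat) a v : rho (m%:R * a) v = m%:R *: rho a v.
Proof. by rewrite mulr_natl -scaler_nat actZ. Qed.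

End Action.

Lemma free_algebra_ind (K : comNzRingType) (X : choiceType)
    (Q : free_algebra K X -> Prop) :
  Q 0 -> Q 1 -> (forall c a b, Q a -> Q b -> Q (c *: a + b)) ->
  (forall x a, Q a -> Q (free_gen K x * a)) -> forall a, Q a.
Proof.
move=> Q0 Q1 Qlin Qgen a; rewrite [a]monalgE.
elim: (finmap.enum_fset _) => [|m s IHs]; first by rewrite big_nil.
rewrite big_cons.
have -> : << a@_m *g m >> = a@_m *: << m >> :> free_algebra K X.
  by apply/malgP => k; rewrite mcoeffZ !mcoeffU mulr_natr.
apply: Qlin => //; case: m => {IHs}; elim=> [|x m IHm].
  suff -> : << FMonom [::] >> = 1 :> free_algebra K X by [].
  apply/malgP => k; rewrite mcoeffU mcoeff1; congr (_ *+ _).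
  by rewrite eq_sym; congr (nat_of_bool (_ == _)); apply/val_inj; rewrite /= fm1.
suff -> : << FMonom (x :: m) >> = free_gen K x * << FMonom m >> :> free_algebra K X.
  exact: Qgen.
rewrite malgM_def fgmulUU mul1r; congr << _ >>.
by apply/val_inj; rewrite /= fmM fmU.
Qed.

Section Generation.
Variables (K : numFieldType) (n : nat) (p : nat -> nat) (V : lmodType K).
Variable rho : representation (W_algebra K n p) V.
Notation wd := (wd K n p).
Notation wf := (wf K n p).
Notation we := (we K n p).
Notation FA := (free_algebra K (generator n p)).

Lemma sym_gen (g : generator n p) : sym K n p (sval g) = free_gen K g.
Proof. by rewrite /sym; case: g => s sP; rewrite insubT. Qed.

Lemma act_to_W_lin c (a b : FA) v :
  rho (to_W (c *: a + b)) v = c *: rho (to_W a) v + rho (to_W b) v.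
Proof. by rewrite -(rep_linearl rho); congr (rho _ v); apply: linearP. Qed.

Lemma act_to_W_mul (a b : FA) v :
  rho (to_W (a * b)) v = rho (to_W a) (rho (to_W b) v).
Proof.
have -> : to_W (a * b) = to_W a * to_W b by apply: rmorphM.
exact: repM.
Qed.

Lemma generators_stable (Q : V -> Prop) :
  Q 0 -> (forall c u v, Q u -> Q v -> Q (c *: u + v)) ->
  (forall i t v, (0 < i <= n)%N -> Q v -> Q (rho (wd i t) v)) ->
  (forall i s v, (0 < i < n)%N -> Q v -> Q (rho (wf i s.+1) v)) ->
  (forall i a v, (0 < i < n)%N -> Q v -> Q (rho (we i (p i.+1 - p i + 1 + a)%N) v)) ->
  forall a v, Q v -> Q (rho a v).
Proof.
move=> Q0 Qlin Qd Qf Qe a v Qv.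
have [a' ->] : exists a', a = to_W a'.
  by exists (repr (repr a)); rewrite /to_W /= /of_yangian /to_yangian !quot_pi_surj.
elim/free_algebra_ind: a' => [||c b b' Qb Qb'|g b Qb].
- by rewrite (_ : to_W 0 = 0) ?act0 //; apply: rmorph0.
- by rewrite (_ : to_W 1 = 1) ?rep1 //; apply: rmorph1.
- by rewrite act_to_W_lin; apply: Qlin.
rewrite act_to_W_mul -sym_gen; case: g => -[i r|i r|i r] /= adm.
- have /andP[i_n r_gt0] := adm; have := Qd i r _ i_n Qb.
  by rewrite /Defs.wd /yd /fd gtn_eqF.
- have /andP[i_n r_gt0] := adm; have := Qf i r.-1 _ i_n Qb.
  by rewrite prednK.
- have /andP[i_n r_p] := adm; have := Qe i (r - (p i.+1 - p i + 1))%N _ i_n Qb.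
  by rewrite subnKC.
Qed.

End Generation.

(** * The relations as identities between operators *)

Section ActionOfRelations.
Variables (K : comNzRingType) (A : algType K) (V : lmodType K).
Variable rho : representation A V.
Implicit Types (a b : A) (v : V) (F G : nat -> A) (s : bool).

Lemma act_comm a b v : a * b = b * a -> rho a (rho b v) = rho b (rho a v).
Proof. by move=> ab; rewrite -!repM ab. Qed.

Lemma act_scalar (k : K) a v : rho (k%:A * a) v = k *: rho a v.
Proof. by rewrite mulr_algl actZ. Qed.

Lemma act_lieB a b s (s' : bool) m F G v :
  a * b = b * a + (s%:R - s'%:R) * \sum_(0 <= t < m) F t * G t ->
  rho a (rho b v) = rho b (rho a v) +
    (s%:R - s'%:R) *: \sum_(0 <= t < m) rho (F t) (rho (G t) v).
Proof.
move=> ab; rewrite -!repM ab actD; congr (_ + _).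
rewrite -![X in X - _]scaler_nat -![X in _ - X]scaler_nat -scalerBl act_scalar.
by rewrite act_sum; congr (_ *: _); apply: eq_bigr => t _; rewrite repM.
Qed.

Lemma act_lieN a b s m F G v :
  a * b = b * a - s%:R * \sum_(0 <= t < m) F t * G t ->
  rho a (rho b v) = rho b (rho a v) -
    s%:R *: \sum_(0 <= t < m) rho (F t) (rho (G t) v).
Proof.
move=> ab; rewrite -!repM ab actB; congr (_ - _); rewrite act_nat.
by rewrite act_sum; congr (_ *: _); apply: eq_bigr => t _; rewrite repM.
Qed.

Lemma act_lie_step a0 a1 b0 b1 s (s' : bool) v :
  a1 * b0 = b0 * a1 + (a0 * b1 - b1 * a0) + (s%:R - s'%:R) * (b0 * a0) ->
  rho a1 (rho b0 v) = rho b0 (rho a1 v) + (rho a0 (rho b1 v) - rho b1 (rho a0 v)) +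
    (s%:R - s'%:R) *: rho b0 (rho a0 v).
Proof.
move=> ab; rewrite -!repM ab !actD actN; congr (_ + _).
rewrite -![X in X - _]scaler_nat -![X in _ - X]scaler_nat -scalerBl act_scalar.
by [].
Qed.

Lemma act_ser_inv (k : bool) m F G v :
  \sum_(t < m.+1) F t * G (m - t)%N = k%:R ->
  \sum_(t < m.+1) rho (F t) (rho (G (m - t)%N) v) = k%:R *: v.
Proof.
move=> /(congr1 (fun a => rho a v)); rewrite act_sum => E.
transitivity (rho k%:R v).
  by rewrite -E; apply: eq_bigr => t _; rewrite repM.
by case: k {E}; rewrite ?rep1 ?scale1r ?act0 ?scale0r.
Qed.

End ActionOfRelations.

Section Modules.
Variables (K : numFieldType) (n : nat) (p : nat -> nat) (V : lmodType K).
Variable rho : representation (W_algebra K n p) V.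

(** Superscripts of [f_i] and [e_i] are counted from the first admissible one, so that they become
    exponents of roots in the matrix coefficients. *)
Definition dact i t (v : V) : V := rho (wd K n p i t) v.
Definition fact i s (v : V) : V := rho (wf K n p i s.+1) v.
Definition eact i a (v : V) : V := rho (we K n p i (p i.+1 - p i + 1 + a)%N) v.
Definition d'act i t (v : V) : V := rho (wd' K n p i t) v.

HB.instance Definition _ i t := GRing.Linear.copy (dact i t) (rho (wd K n p i t)).
HB.instance Definition _ i t := GRing.Linear.copy (fact i t) (rho (wf K n p i t.+1)).
HB.instance Definition _ i t := GRing.Linear.copy (eact i t)
  (rho (we K n p i (p i.+1 - p i + 1 + t)%N)).
HB.instance Definition _ i t := GRing.Linear.copy (d'act i t) (rho (wd' K n p i t)).

Lemma dact0 i v : dact i 0 v = v.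
Proof. by rewrite /dact wd0 rep1. Qed.

Lemma dact_comm i j r s v : (0 < i <= n)%N -> (0 < j <= n)%N ->
  dact i r (dact j s v) = dact j s (dact i r v).
Proof. by move=> i_n j_n; apply/act_comm/W_dd. Qed.

Lemma dact_fact i j r s v : (0 < i <= n)%N -> (0 < j < n)%N ->
  dact i r (fact j s v) = fact j s (dact i r v) + ((i == j.+1)%:R - (i == j)%:R) *:
    \sum_(0 <= t < r) fact j (r + s - t - 1) (dact i t v).
Proof.
move=> i_n j_n; rewrite /dact /fact (act_lieB rho v (W_df K p r i_n j_n (ltn0Sn s))).
congr (_ + _ *: _); apply: eq_big_nat => t /andP[_ tr].
by congr (rho (wf _ _ _ _ _) _); lia.
Qed.

Lemma dact_fact_step i j r s v : (0 < i <= n)%N -> (0 < j < n)%N ->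
  dact i r.+1 (fact j s v) = fact j s (dact i r.+1 v) +
    (dact i r (fact j s.+1 v) - fact j s.+1 (dact i r v)) +
    ((i == j.+1)%:R - (i == j)%:R) *: fact j s (dact i r v).
Proof. by move=> i_n j_n; apply/act_lie_step/W_df_step. Qed.

Lemma dact_eact i j r a v : (0 < i <= n)%N -> (0 < j < n)%N ->
  dact i r (eact j a v) = eact j a (dact i r v) + ((i == j)%:R - (i == j.+1)%:R) *:
    \sum_(0 <= t < r) dact i t (eact j (r + a - t - 1) v).
Proof.
move=> i_n j_n; rewrite /dact /eact.
rewrite (act_lieB rho v (W_de K r i_n j_n (leq_addr a _))).
congr (_ + _ *: _); apply: eq_big_nat => t /andP[_ tr].
by congr (rho _ (rho (we _ _ _ _ _) _)); lia.
Qed.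

Lemma eact_fact i j a s v : (0 < i < n)%N -> (0 < j < n)%N ->
  eact i a (fact j s v) = fact j s (eact i a v) - (i == j)%:R *:
    \sum_(t < p i.+1 - p i + 1 + a + s.+1)
       d'act i t (dact i.+1 (p i.+1 - p i + 1 + a + s - t) v).
Proof.
move=> i_n j_n; rewrite /dact /eact /fact /d'act.
rewrite (act_lieN rho v (W_ef K i_n j_n (leq_addr a _) (ltn0Sn s))) big_mkord.
congr (_ - _ *: _); apply: eq_bigr => t _.
by congr (rho _ (rho (wd _ _ _ _ _) _)); lia.
Qed.

Lemma dact_d'act i m v :
  \sum_(t < m.+1) dact i t (d'act i (m - t) v) = (m == 0%N)%:R *: v.
Proof. exact/act_ser_inv/wd'P. Qed.

Lemma d'actE i m v : d'act i m v = (m == 0%N)%:R *: v -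
  \sum_(t < m) dact i t.+1 (d'act i (m - t.+1) v).
Proof.
by rewrite -(dact_d'act i) big_ord_recl dact0 subn0 addrK.
Qed.

Lemma dact_sum_eigen i (s : pseries K) v : (forall t, dact i t v = s t *: v) ->
  forall (s' : pseries K) m, s * s' = 1 -> d'act i m v = s' m *: v.
Proof.
move=> ds s' m ss'; have s0 : s 0%N *: v = v by rewrite -ds dact0.
have [k] := ubnP m; elim: k m => // k IHk m mk; rewrite d'actE.
have -> : \sum_(t < m) dact i t.+1 (d'act i (m - t.+1) v) =
    (\sum_(t < m) s t.+1 * s' (m - t.+1)%N) *: v.
  rewrite scaler_suml; apply: eq_bigr => t _.
  by rewrite IHk ?linearZ_LR /= ?ds ?scalerA 1?mulrC //; have := ltn_ord t; lia.
have <- : (s * s') m = (m == 0%N)%:R by rewrite ss'.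
rewrite -scalerBl psM big_ord_recl subn0 addrK mulrC -scalerA.
by rewrite s0.
Qed.

Lemma eact_fact_eigen i j a s (A A' B : pseries K) v :
  (0 < i < n)%N -> (0 < j < n)%N ->
  (forall t, dact i t v = A t *: v) -> (forall t, dact i.+1 t v = B t *: v) ->
  A * A' = 1 ->
  eact i a (fact j s v) = fact j s (eact i a v) -
    ((i == j)%:R * (A' * B) (p i.+1 - p i + 1 + (a + s))%N) *: v.
Proof.
move=> i_n j_n dA dB AA'; rewrite eact_fact //; congr (_ - _).
rewrite -scalerA; congr (_ *: _); rewrite addnS addnA psM scaler_suml.
apply: eq_bigr => t _.
by rewrite dB linearZ_LR /= (dact_sum_eigen dA _ AA') scalerA mulrC.
Qed.

(** * Vectors killed by the raising operators *)

(** The weights decrease by 1 with [i], so every [f_j^(s)] lowers the eigenvalue by exactly 1, and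
    the eigenvalue records the depth. *)
Definition grading (v : V) : V := \sum_(1 <= i < n.+1) (n - i)%:R *: dact i 1 v.

Lemma grading_linear : linear grading.
Proof.
move=> c u v; rewrite /grading scaler_sumr -big_split /=; apply: eq_bigr => i _.
by rewrite linearP scalerDr !scalerA mulrC.
Qed.
HB.instance Definition _ := GRing.isLinear.Build K V V *:%R grading grading_linear.

Lemma grading_fact j s v : (0 < j < n)%N ->
  grading (fact j s v) = fact j s (grading v) - fact j s v.
Proof.
move=> j_n; rewrite /grading linear_sum /=.
have E i : (1 <= i < n.+1)%N -> (n - i)%:R *: dact i 1 (fact j s v) =
    fact j s ((n - i)%:R *: dact i 1 v) +
    ((n - i)%:R * ((i == j.+1)%:R - (i == j)%:R)) *: fact j s v.
  rewrite ltnS => i_n; rewrite dact_fact // big_nat1 dact0 scalerDr scalerA linearZ_LR /=.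
  by congr (_ + _ *: fact j _ v); lia.
rewrite (eq_big_nat _ _ E) big_split /=; congr (_ + _); rewrite -scaler_suml.
rewrite -scaleN1r; congr (_ *: _).
have pick k : (0 < k <= n)%N ->
    \sum_(1 <= i < n.+1) (n - i)%:R * (i == k)%:R = (n - k)%:R :> K.
  move=> k_n; rewrite (bigD1_seq k) ?mem_index_iota ?iota_uniq //=.
  by rewrite eqxx mulr1 big1 ?addr0 // => i /negPf ->; rewrite mulr0.
under eq_bigr => i _ do rewrite mulrBr.
rewrite sumrB !pick; [|by lia|by lia].
by rewrite subnS -subn1 natrB ?subn_gt0; [ring|lia].
Qed.

Lemma grading_dact i t v : (0 < i <= n)%N -> grading (dact i t v) = dact i t (grading v).
Proof.
move=> i_n; rewrite /grading linear_sum; apply: eq_big_nat => j.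
by rewrite ltnS => j_n; rewrite linearZ_LR /= dact_comm.
Qed.

Definition killed (v : V) := forall j a, (0 < j < n)%N -> eact j a v = 0.

Lemma killed_dact i t v : (0 < i <= n)%N -> killed v -> killed (dact i t v).
Proof.
move=> i_n vk j a j_n; have := dact_eact t a v i_n j_n.
rewrite vk // linear0 big1 ?scaler0 ?addr0 // => s _.
by rewrite vk // linear0.
Qed.

Section Irreducible.
Variables (zeta : V) (h0 : K).
Hypothesis rho_irr : irreducible rho.
Hypothesis zeta_neq0 : zeta != 0.
Hypothesis zeta_grading : grading zeta = h0 *: zeta.

Let eig k v := grading v = (h0 - k.+1%:R) *: v.

(** The submodule generated by killed eigenvectors lying below [zeta]. Closing under the [f_j] alone
    is enough: [d_i] and [e_j] are moved to the right until they reach a killed vector. *)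
Inductive low_span : V -> Prop :=
| low_span_base k v of killed v & eig k v : low_span v
| low_span0 : low_span 0
| low_spanP c u v of low_span u & low_span v : low_span (c *: u + v)
| low_spanf j s v of (0 < j < n)%N & low_span v : low_span (fact j s v).

Inductive eig_span : V -> Prop :=
| eig_span_base k v of eig k v : eig_span v
| eig_span0 : eig_span 0
| eig_spanP c u v of eig_span u & eig_span v : eig_span (c *: u + v).

Let eig_span_fact j s v : (0 < j < n)%N -> eig_span v -> eig_span (fact j s v).
Proof.
move=> j_n; elim=> {v} [k v kv||c u v _ IHu _ IHv].
- apply: (@eig_span_base k.+1); rewrite /eig grading_fact // kv linearZ_LR /=.
  rewrite -[X in _ - X]scale1r -scalerBl -[k.+2%:R]natr1 opprD addrA.
  by [].
- by rewrite linear0; apply: eig_span0.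
- by rewrite linearP; apply: eig_spanP.
Qed.

Let low_eig v : low_span v -> eig_span v.
Proof.
elim=> {v} [k v _ kv||c u v _ IHu _ IHv|j s v j_n _ IHv].
- exact: eig_span_base kv.
- exact: eig_span0.
- exact: eig_spanP.
- exact: eig_span_fact.
Qed.

(** The product of the operators [grading - (h0 - j)] for j from 1 to m. For large m it annihilates
    a given vector of [eig_span], while it multiplies [zeta] by [m!], which is nonzero in
    characteristic 0. *)
Fixpoint kill m v :=
  if m is m'.+1 then kill m' (grading v - (h0 - m%:R) *: v) else v.

Let killP m c u v : kill m (c *: u + v) = c *: kill m u + kill m v.
Proof.
elim: m u v => //= m IHm u v; rewrite -IHm; congr (kill m _).
by rewrite linearP scalerDr !scalerBr opprD addrACA; congr (_ + _ + _);
  rewrite !scalerA mulrC.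
Qed.

Let kill0 m : kill m 0 = 0.
Proof.
have := killP m (-1) 0 0; rewrite scaler0 addr0 scaleN1r addNr.
by [].
Qed.

Let killZ m c v : kill m (c *: v) = c *: kill m v.
Proof. by have := killP m c v 0; rewrite kill0 !addr0. Qed.

Let kill_eig m mu v : grading v = mu *: v ->
  kill m v = (\prod_(j < m) (mu - h0 + j.+1%:R)) *: v.
Proof.
move=> vmu; elim: m => [|m IHm]; first by rewrite big_ord0 scale1r.
rewrite /= vmu -scalerBl killZ IHm big_ord_recr /= scalerA; congr (_ *: _).
by ring.
Qed.

Let eig_span_kill v : eig_span v -> exists m0, forall m, (m0 <= m)%N -> kill m v = 0.
Proof.
elim=> {v} [k v kv||c u v _ [m1 h1] _ [m2 h2]].
- exists k.+1 => m km; rewrite (kill_eig _ kv).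
  rewrite (bigD1 (Ordinal km)) //= [X in X * _](_ : _ = 0); last by ring.
  by rewrite mul0r scale0r.
- by exists 0%N => m _; apply: kill0.
- exists (maxn m1 m2) => m; rewrite geq_max => /andP[l1 l2].
  by rewrite killP h1 // h2 // scaler0 addr0.
Qed.

Let low_spanD u v : low_span u -> low_span v -> low_span (u + v).
Proof. by move=> hu hv; rewrite -[u]scale1r; apply: low_spanP. Qed.

Let low_spanZ c v : low_span v -> low_span (c *: v).
Proof. by move=> hv; rewrite -[_ *: _]addr0; apply: low_spanP => //; apply: low_span0. Qed.

Let low_spanB u v : low_span u -> low_span v -> low_span (u - v).
Proof. by move=> hu hv; rewrite -scaleN1r addrC; apply: low_spanP. Qed.

Let low_span_sum (I : Type) (r : seq I) (P : pred I) (F : I -> V) :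
  (forall i, P i -> low_span (F i)) -> low_span (\sum_(i <- r | P i) F i).
Proof.
by move=> PF; apply: big_ind => //; apply: low_span0.
Qed.

Let low_span_d i t v : (0 < i <= n)%N -> low_span v -> low_span (dact i t v).
Proof.
move=> i_n hv; elim: hv t => {v} [k v vk kv||c u v _ IHu _ IHv|j s v j_n hv IHv] t.
- apply: (@low_span_base k); first exact: killed_dact.
  by rewrite /eig grading_dact // kv linearZ_LR.
- by rewrite linear0; apply: low_span0.
- by rewrite linearP; apply: low_spanP; [apply: IHu|apply: IHv].
rewrite dact_fact //; apply: low_spanD; first by apply: low_spanf => //; apply: IHv.
by apply/low_spanZ/low_span_sum => t' _; apply: low_spanf => //; apply: IHv.
Qed.

Let low_span_d' i m v : (0 < i <= n)%N -> low_span v -> low_span (d'act i m v).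
Proof.
move=> i_n hv; have [k] := ubnP m; elim: k m => // k IHk m mk.
rewrite d'actE; apply: low_spanB; first exact: low_spanZ.
apply: low_span_sum => -[t tm] _ /=; apply: low_span_d => //; apply: IHk.
by lia.
Qed.

Let low_span_e j a v : (0 < j < n)%N -> low_span v -> low_span (eact j a v).
Proof.
move=> j_n; elim=> {v} [k v vk _||c u v _ IHu _ IHv|i s v i_n hv IHv].
- by rewrite vk //; apply: low_span0.
- by rewrite linear0; apply: low_span0.
- by rewrite linearP; apply: low_spanP.
rewrite eact_fact //; apply: low_spanB; first exact: low_spanf.
apply/low_spanZ/low_span_sum => t _; apply: low_span_d'; first by lia.
by apply: low_span_d => //; lia.
Qed.

(** The condition is on [grading] and not on the separate [d_i], because in the application the
    [d]-formula at the relevant depth is not yet available. *)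
Lemma killed_eq0 k v : killed v -> grading v = (h0 - k.+1%:R) *: v -> v = 0.
Proof.
move=> vk kv; have [_ irr] := rho_irr.
have low_v : low_span v := low_span_base vk kv.
have sub : subrepresentation rho [set u | low_span u]%classic.
  split=> [|c u w|a u]; [exact: low_span0|exact: low_spanP|].
  apply: (@generators_stable _ _ _ _ rho low_span).
  + exact: low_span0.
  + exact: low_spanP.
  + by move=> i t w i_n; apply: (low_span_d t i_n).
  + by move=> i s w i_n; apply: low_spanf.
  + by move=> i a' w i_n; apply: (low_span_e a' i_n).
have [U0|UT] := irr _ sub.
  by have : [set u | low_span u]%classic v by []; rewrite U0.
have : [set u | low_span u]%classic zeta by rewrite UT.
move=> /low_eig/eig_span_kill[m /(_ m (leqnn m))].
rewrite (kill_eig _ zeta_grading) => /eqP; rewrite scaler_eq0 (negPf zeta_neq0) orbF.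
rewrite subrr; case/prodf_eq0 => j _; by rewrite add0r pnatr_eq0.
Qed.

End Irreducible.
End Modules.

(** * The Gelfand-Tsetlin vectors *)

Section GTVectors.
Variables (K : numFieldType) (n : nat) (p : nat -> nat) (lam : nat -> nat -> K).
Hypothesis W : generic_dominant n p lam.
Variables (V : lmodType K) (rho : representation (W_algebra K n p) V) (zeta : V).
Notation box := (box n p).
Notation state := (state n p).
Notation x := (root_at lam).
Notation pat := (pat lam).
Notation top := (top n p lam).
Notation depth := (depth lam).
Notation f_coef := (f_coef lam).
Notation e_coef := (e_coef lam).
Notation dact := (dact rho).
Notation fact := (fact rho).
Notation eact := (eact rho).
Notation grading := (grading rho).
Implicit Types (b c : box) (z : state).

Hypothesis rho_irr : irreducible rho.
Hypothesis zeta_neq0 : zeta != 0.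
Hypothesis zeta_d : forall i t, (0 < i <= n)%N ->
  dact i t zeta = d_series lam i top t *: zeta.
Hypothesis zeta_killed : killed rho zeta.

Let h0 : K := \sum_(1 <= i < n.+1) (n - i)%:R * d_series lam i top 1%N.

Let zeta_grading : grading zeta = h0 *: zeta.
Proof.
rewrite /grading /h0 scaler_suml; apply: eq_big_nat => i.
by rewrite ltnS => i_n; rewrite zeta_d // scalerA.
Qed.

Definition lagrange z b : {poly K} :=
  \prod_(c | inrow (row b) c && (c != b)) ((x z b - x z c)^-1 *: ('X - (x z c)%:P)).

Lemma lagrange_eq z b c : pat z -> valid b -> inrow (row b) c ->
  (lagrange z b).[x z c] = (c == b)%:R.
Proof.
move=> zp bv rc; rewrite /lagrange horner_prod; have [->|cb] := eqVneq c b.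
  rewrite big1 // => d /andP[rd db]; rewrite !hornerE mulVf //.
  by rewrite subr_eq0 (root_at_inj W).
by rewrite (bigD1 c) /= ?rc // !hornerE subrr mulr0 mul0r.
Qed.

Definition fact_poly (P : {poly K}) j v : V := \sum_(s < size P) P`_s *: fact j s v.

Lemma poly_sum (P : {poly K}) (A : pred box) (y k : box -> K) (w : box -> V) :
  \sum_(s < size P) P`_s *: (\sum_(b | A b) (y b ^+ s * k b) *: w b)
  = \sum_(b | A b) (P.[y b] * k b) *: w b.
Proof.
under eq_bigr => s _ do rewrite scaler_sumr.
rewrite exchange_big; apply: eq_bigr => b _.
rewrite horner_coef mulr_suml scaler_suml; apply: eq_bigr => s _.
by rewrite scalerA mulrA.
Qed.

(** The Lagrange polynomial extracts the [b]-term from the expected expansion of [f_r] on the vector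
    of [z - unit_at b]. That another box would give the same vector is part of [f_formula]. *)
Fixpoint gt_rec (m : nat) z : V :=
  if m is m'.+1 then
    if [pick b | active b && pat (z - unit_at b)] is Some b then
      (f_coef (z - unit_at b) b)^-1 *:
        fact_poly (lagrange (z - unit_at b) b) (row b) (gt_rec m' (z - unit_at b))
    else 0
  else zeta.

(** The value 0 outside of the patterns lets the expansions run over all boxes of a row. *)
Definition gt_vec z : V := if pat z then gt_rec (depth z) z else 0.

Lemma gt_vec_out z : ~~ pat z -> gt_vec z = 0.
Proof. by rewrite /gt_vec => /negPf ->. Qed.

Lemma gt_vec_top : gt_vec top = zeta.
Proof. by rewrite /gt_vec pat_top // depth_top. Qed.

Lemma depth_dec z b : pat (z - unit_at b) -> depth z = (depth (z - unit_at b)).+1.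
Proof. by move=> zp; rewrite -(depth_inc W b zp) subrK. Qed.

Lemma gt_vec_step z : pat z -> (0 < depth z)%N ->
  exists b, [/\ active b, pat (z - unit_at b) &
    gt_vec z = (f_coef (z - unit_at b) b)^-1 *:
        fact_poly (lagrange (z - unit_at b) b) (row b) (gt_vec (z - unit_at b))].
Proof.
move=> zp z_gt0; rewrite /gt_vec zp; case D: (depth z) z_gt0 => [//|m] _ /=.
case: pickP => [b /andP[ab bp]|none].
  exists b; split=> //; rewrite bp; congr (_ *: fact_poly _ _ (gt_rec _ _)).
  by have := depth_dec bp; rewrite D => -[].
have ztop : z != top by apply/eqP => zt; move: D; rewrite zt depth_top.
by have [b ab bp] := ex_pat_dec W zp ztop; have := none b; rewrite ab bp.
Qed.

Definition e_exp j a z : V :=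
  \sum_(c | inrow j c) ((x z c - 1) ^+ a * e_coef z c) *: gt_vec (z - unit_at c).
Definition f_exp j s z : V :=
  \sum_(b | inrow j b) (x z b ^+ s * f_coef z b) *: gt_vec (z + unit_at b).

Definition e_formula z := forall j a, (0 < j < n)%N -> eact j a (gt_vec z) = e_exp j a z.
Definition f_formula z := forall j s, (0 < j < n)%N -> fact j s (gt_vec z) = f_exp j s z.
Definition d_formula z := forall i t, (0 < i <= n)%N ->
  dact i t (gt_vec z) = d_series lam i z t *: gt_vec z.
Let g_formula z := grading (gt_vec z) = (h0 - (depth z)%:R) *: gt_vec z.

(** This is what the [f]-formula at [z] and the [e]-formula at each [z + unit_at b] would predict,
    but neither is assumed: [e] is moved past [f], which involves only [z] and patterns of smaller
    depth. *)
Lemma eact_fact_exp z : pat z -> e_formula z -> d_formula z ->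
  (forall c, pat (z - unit_at c) -> f_formula (z - unit_at c)) ->
  forall t a r s, (0 < t < n)%N -> (0 < r < n)%N ->
  eact t a (fact r s (gt_vec z)) =
  \sum_(b | inrow r b) (x z b ^+ s * f_coef z b) *:
    (if pat (z + unit_at b) then e_exp t a (z + unit_at b) else 0).
Proof.
move=> zp ez dz fz t a r s t_n r_n.
have t_n' : (0 < t <= n)%N by lia.
rewrite (eact_fact_eigen a s t_n r_n (dz t^~ t_n') (dz t.+1^~ ltac:(lia)) (ps_ratio_inv _ _)).
rewrite -h_seriesE; last by lia.
rewrite ez // linear_sum /=; apply/eqP; rewrite subr_eq addrC -subr_eq; apply/eqP.
(* [T1] follows the paths through [z - unit_at c], [T2] those through [z + unit_at b]. Off the
   diagonal they agree by [ef_coef_comm], both intermediate arrays being patterns by [pat_exchange];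
   on the diagonal their difference is [power_sum]. *)
pose T1 b c := if pat (z - unit_at c) then
  (((x z c - 1) ^+ a * e_coef z c) *
  (x (z - unit_at c) b ^+ s * f_coef (z - unit_at c) b)) *:
    gt_vec (z - unit_at c + unit_at b) else 0.
pose T2 b c := if pat (z + unit_at b) then
  ((x z b ^+ s * f_coef z b) *
  ((x (z + unit_at b) c - 1) ^+ a * e_coef (z + unit_at b) c)) *:
    gt_vec (z + unit_at b - unit_at c) else 0.
have -> : \sum_(c | inrow t c) fact r s
    (((x z c - 1) ^+ a * e_coef z c) *: gt_vec (z - unit_at c))
    = \sum_(b | inrow r b) \sum_(c | inrow t c) T1 b c.
  rewrite exchange_big; apply: eq_bigr => c rc; rewrite linearZ_LR /= /T1.
  have [cp|cp] := boolP (pat (z - unit_at c)); last first.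
    by rewrite (gt_vec_out cp) linear0 scaler0 big1.
  by rewrite fz // scaler_sumr; apply: eq_bigr => b rb; rewrite scalerA.
have -> : \sum_(b | inrow r b) (x z b ^+ s * f_coef z b) *:
    (if pat (z + unit_at b) then e_exp t a (z + unit_at b) else 0)
    = \sum_(b | inrow r b) \sum_(c | inrow t c) T2 b c.
  apply: eq_bigr => b rb; rewrite /T2.
  have [bp|bp] := boolP (pat (z + unit_at b)); last by rewrite scaler0 big1.
  by rewrite scaler_sumr; apply: eq_bigr => c rc; rewrite scalerA.
rewrite -sumrB; under eq_bigr => b _ do rewrite -sumrB.
have T12 b c : inrow r b -> inrow t c -> b != c -> T1 b c - T2 b c = 0.
  move=> rb tc bc; apply/eqP; rewrite subr_eq0; apply/eqP.
  have cb : c != b by rewrite eq_sym.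
  have zbc : z + unit_at b - unit_at c = z - unit_at c + unit_at b by rewrite addrAC.
  rewrite /T1 /T2 zbc; have [zp'|zp'] := boolP (pat (z - unit_at c + unit_at b)).
    have [-> ->] := pat_exchange W bc zp zp'.
    rewrite root_at_dec root_at_inc (negPf bc) (negPf cb) subr0 addr0.
    congr (_ *: _); have /andP[_ bv] := rb; have /andP[_ cv] := tc.
    by rewrite mulrACA (ef_coef_comm lam z bc bv cv); ring.
  by rewrite (gt_vec_out zp') !scaler0; case: ifP; case: ifP.
have [trE|tr] := eqVneq t r; last first.
  rewrite mul0r scale0r big1 // => b rb; rewrite big1 // => c tc; apply: T12 => //.
  by apply: contraNneq tr => bc; move: rb tc; rewrite bc => /andP[/eqP <- _] /andP[/eqP <- _].
rewrite trE in T12 *; rewrite mul1r.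
have -> : \sum_(b | inrow r b) \sum_(c | inrow r c) (T1 b c - T2 b c)
    = \sum_(b | inrow r b) (T1 b b - T2 b b).
  apply: eq_bigr => b rb; rewrite (bigD1 b) //= big1 ?addr0 // => c /andP[rc cb].
  by apply: T12 => //; rewrite eq_sym.
rewrite sumrB (power_sum W (a + s) zp r_n) scalerBl !scaler_suml.
rewrite [X in _ = X - _]big_mkcondr [X in _ = _ - X]big_mkcondr.
congr (_ - _); apply: eq_bigr => b rb; rewrite /T1 /T2; case: ifP => // bp.
  rewrite subrK root_at_dec eqxx; congr (_ *: _).
  by rewrite exprD; ring.
rewrite addrK root_at_inc eqxx addrK; congr (_ *: _).
by rewrite exprD; ring.
Qed.

Let act_if (g : {linear V -> V}) z (w : V) : (pat z -> g (gt_vec z) = w) ->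
  g (gt_vec z) = if pat z then w else 0.
Proof.
by case: ifP => [_ -> // | /negbT/gt_vec_out -> _]; rewrite linear0.
Qed.

(** The chosen box and the box lowered by [e] are both removed before [f] acts, so the [f]-formula
    is needed only two steps below the depth of [z]. This lets the [e]-formula run ahead in the
    induction. *)
Let e_formula_step z : pat z -> (0 < depth z)%N ->
  (forall z', pat z' -> (depth z' < depth z)%N -> e_formula z' /\ d_formula z') ->
  (forall z', pat z' -> ((depth z').+1 < depth z)%N -> f_formula z') -> e_formula z.
Proof.
move=> zp z_gt0 IHed IHf t a t_n; have [b [/andP[bn bv] bp ->]] := gt_vec_step zp z_gt0.
set z' := z - unit_at b; have zE : z = z' + unit_at b by rewrite /z' subrK.
have zlt : (depth z' < depth z)%N by rewrite (depth_dec bp).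
have [ez' dz'] := IHed z' bp zlt.
have r_n : (0 < row b < n)%N by rewrite (valid_row bv).
rewrite linearZ_LR /= /fact_poly linear_sum /=.
under eq_bigr => s _.
  rewrite linearZ_LR /= eact_fact_exp //; last first.
    move=> c cp; apply: IHf => //.
    by have := depth_dec cp; rewrite (depth_dec bp) => ->.
  over.
rewrite poly_sum (bigD1 b) /=; last by rewrite /inrow eqxx.
have rb : inrow (row b) b by rewrite /inrow eqxx.
rewrite [X in _ + X]big1 => [|c /andP[rc cb]]; last first.
  by rewrite lagrange_eq // (negPf cb) mul0r scale0r.
rewrite addr0 lagrange_eq // eqxx mul1r -zE zp scalerA mulVf ?scale1r //.
by rewrite (f_coef_neq0 W) // -zE.
Qed.

Let g_formula_fact z j s : g_formula z -> (0 < j < n)%N ->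
  grading (fact j s (gt_vec z)) = (h0 - (depth z).+1%:R) *: fact j s (gt_vec z).
Proof.
move=> gz j_n; rewrite grading_fact // gz linearZ_LR /= -natr1 opprD addrA.
by rewrite [in RHS]scalerBl scale1r.
Qed.

Let g_formula_step z : pat z -> (0 < depth z)%N ->
  (forall z', pat z' -> (depth z' < depth z)%N -> g_formula z') -> g_formula z.
Proof.
move=> zp z_gt0 IHg; rewrite /g_formula.
have [b [/andP[bn bv] bp ->]] := gt_vec_step zp z_gt0.
have r_n : (0 < row b < n)%N by rewrite (valid_row bv).
rewrite linearZ_LR /= [RHS]scalerA [_ * _^-1]mulrC -scalerA; congr (_ *: _).
rewrite /fact_poly linear_sum scaler_sumr; apply: eq_bigr => s _.
rewrite linearZ_LR /= g_formula_fact //; last first.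
  by apply: IHg => //; rewrite (depth_dec bp).
by rewrite (depth_dec bp) !scalerA mulrC.
Qed.

(** At depth [(depth z).+1] only the [e]-formula and the grading are required; this breaks the
    circle with [d_formula_step], which relies on the [f]-formula. *)
Let f_formula_step z : pat z ->
  (forall z', pat z' -> (depth z' <= (depth z).+1)%N ->
     [/\ e_formula z', g_formula z' & (depth z' <= depth z)%N -> d_formula z']) ->
  (forall z', pat z' -> (depth z' < depth z)%N -> f_formula z') -> f_formula z.
Proof.
move=> zp IH IHf j s j_n; apply/eqP; rewrite -subr_eq0; apply/eqP.
have [ez gz /(_ (leqnn _)) dz] := IH z zp (leqnSn _).
apply: (killed_eq0 rho_irr zeta_neq0 zeta_grading) (_ : _ = (h0 - (depth z).+1%:R) *: _).
  move=> t a t_n; rewrite linearB /= eact_fact_exp //; last first.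
    by move=> c cp; apply: IHf => //; rewrite (depth_dec cp).
  rewrite linear_sum /= -sumrB big1 // => b rb; rewrite linearZ_LR /= -scalerBr.
  rewrite (act_if (w := e_exp t a (z + unit_at b))) ?subrr ?scaler0 // => bp.
  by have [h _ _] := IH _ bp ltac:(rewrite (depth_inc W) //); apply: h.
rewrite linearB /= g_formula_fact // scalerBr; congr (_ - _).
rewrite linear_sum scaler_sumr; apply: eq_bigr => b rb; rewrite linearZ_LR /=.
rewrite (act_if (w := (h0 - (depth z).+1%:R) *: gt_vec (z + unit_at b))).
  case: ifP => [bp|/negbT/gt_vec_out ->]; last by rewrite !scaler0.
  by rewrite !scalerA mulrC.
move=> bp; have [_ h _] := IH _ bp ltac:(rewrite (depth_inc W) //).
by apply: etrans h _; rewrite (depth_inc W).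
Qed.

Let dactZ i t k v : dact i t (k *: v) = k *: dact i t v.
Proof. exact: linearZ_LR. Qed.

Let factZ i t k v : fact i t (k *: v) = k *: fact i t v.
Proof. exact: linearZ_LR. Qed.

Let step_eq (k a0 a1 c : K) (u w w' : V) :
  k *: (a1 *: u + (w' - a0 *: w) + c *: (a0 *: u)) =
  (a1 + c * a0) *: (k *: u) + (k *: w' - a0 *: (k *: w)).
Proof.
rewrite !scalerDr scalerN !scalerA addrAC -scalerDl.
by congr (_ *: _ + (_ - _ *: _)); ring.
Qed.

(** Operator and eigenvalue obey the same recursion in [t]: [dact_fact_step] summed against the
    Lagrange coefficients, where a shift of the index by 1 multiplies by [x_b] ([sumf]), and
    [d_series_inc] ([aE]). *)
Let d_formula_step z : pat z -> (0 < depth z)%N ->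
  (forall z', pat z' -> (depth z' < depth z)%N -> d_formula z' /\ f_formula z') ->
  d_formula z.
Proof.
move=> zp z_gt0 IH i t i_n; have [b [/andP[bn bv] bp vE]] := gt_vec_step zp z_gt0.
set z' := z - unit_at b in bp vE *; have zE : z = z' + unit_at b by rewrite /z' subrK.
have [dz' fz'] := IH z' bp ltac:(rewrite (depth_dec bp) //).
have r_n : (0 < row b < n)%N by rewrite (valid_row bv).
have rb : inrow (row b) b by rewrite /inrow eqxx.
have f_neq0 : f_coef z' b != 0 by rewrite (f_coef_neq0 W) // -zE.
have sumf k : \sum_(s < size (lagrange z' b)) (lagrange z' b)`_s *:
    fact (row b) (s + k) (gt_vec z') = (x z' b ^+ k * f_coef z' b) *: gt_vec z.
  under eq_bigr => s _ do (rewrite fz' // /f_exp;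
    under eq_bigr => c _ do rewrite exprD -mulrA).
  rewrite poly_sum (bigD1 b) //= lagrange_eq // eqxx mul1r -zE.
  by rewrite big1 ?addr0 // => c /andP[rc cb]; rewrite lagrange_eq // (negPf cb) mul0r scale0r.
elim: t => [|t IHt]; first by rewrite dact0 d_series0 scale1r.
set a := d_series lam i z'; set a' := d_series lam i z in IHt *.
have aE : a' t.+1 = x z' b * a' t + a t.+1 -
    (x z' b - ((i == (row b).+1)%:R - (i == row b)%:R)) * a t.
  have := @d_series_inc _ _ _ lam i (row b) z' b rb ltac:(lia).
  move=> /(congr1 (fun h : pseries K => h t.+1)).
  by rewrite !linpsM -zE -/a -/a' => /eqP; rewrite subr_eq => /eqP ->; ring.
set cc : K := _%:R - _%:R in aE; set v := gt_vec z' in vE sumf *.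
have stepE s : dact i t.+1 (fact (row b) s v) = a t.+1 *: fact (row b) s v +
    (dact i t (fact (row b) s.+1 v) - a t *: fact (row b) s.+1 v) +
    cc *: (a t *: fact (row b) s v).
  rewrite dact_fact_step // (dz' i t.+1 i_n) (dz' i t i_n).
  by rewrite !factZ.
rewrite {1}vE linearZ_LR /= /fact_poly linear_sum /=.
have termE (s : nat) k : dact i t.+1 (k *: fact (row b) s v) =
    (a t.+1 + cc * a t) *: (k *: fact (row b) (s + 0) v) +
    (dact i t (k *: fact (row b) (s + 1) v) - a t *: (k *: fact (row b) (s + 1) v)).
  by rewrite dactZ stepE step_eq addn0 addn1 dactZ.
rewrite (eq_bigr _ (fun (s : 'I_(size (lagrange z' b))) _ => termE s _)).
rewrite big_split sumrB -scaler_sumr sumf -linear_sum sumf -scaler_sumr sumf /=.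
rewrite dactZ IHt expr0 expr1 mul1r.
rewrite !scalerA -scalerBl -scalerDl scalerA; congr (_ *: _).
rewrite aE; apply: (mulfI f_neq0); rewrite mulVKf //; ring.
Qed.

Lemma gt_vec_formulas z : pat z -> [/\ e_formula z, d_formula z & f_formula z].
Proof.
(* The [f]-formula lags one depth behind. In the step, [e] and the grading reach depth N+1, then [f]
   reaches N by irreducibility, then [d] reaches N+1. *)
suff H N : (forall z, pat z -> (depth z <= N)%N ->
      [/\ e_formula z, g_formula z & d_formula z]) /\
    (forall z, pat z -> (depth z < N)%N -> f_formula z).
  move=> zp; have [H1 H2] := H (depth z).+1.
  by have [] := H1 z zp (leqnSn _); split=> //; apply: H2.
elim: N => [|N [IH1 IH2]].
  split=> // z' zp'; rewrite leqn0 => /eqP /(depth0 W zp') ->.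
  split=> [j a j_n||i t i_n].
  - rewrite gt_vec_top zeta_killed // /e_exp big1 // => c jc.
    rewrite gt_vec_out ?scaler0 //; apply/negP => cp.
    by have := depth_dec cp; rewrite depth_top.
  - by rewrite /g_formula depth_top gt_vec_top subr0.
  - by rewrite gt_vec_top zeta_d.
have IHe z' : pat z' -> (depth z' <= N.+1)%N -> e_formula z'.
  move=> zp'; rewrite leq_eqVlt ltnS => /predU1P[zN|zN]; last by have [] := IH1 z' zp' zN.
  apply: e_formula_step; rewrite ?zN // => z1 zp1 z1N.
  by have [] := IH1 z1 zp1 z1N.
have IHg z' : pat z' -> (depth z' <= N.+1)%N -> g_formula z'.
  move=> zp'; rewrite leq_eqVlt ltnS => /predU1P[zN|zN]; last by have [] := IH1 z' zp' zN.
  apply: g_formula_step; rewrite ?zN // => z1 zp1 z1N.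
  by have [] := IH1 z1 zp1 z1N.
have IHf z' : pat z' -> (depth z' <= N)%N -> f_formula z'.
  move=> zp'; rewrite leq_eqVlt => /predU1P[zN|zN]; last exact: IH2.
  apply: f_formula_step; rewrite ?zN // => z1 zp1 z1N.
  by split=> [||z1N']; [apply: IHe|apply: IHg|have [] := IH1 z1 zp1 z1N'].
have IHd z' : pat z' -> (depth z' <= N.+1)%N -> d_formula z'.
  move=> zp'; rewrite leq_eqVlt ltnS => /predU1P[zN|zN]; last by have [] := IH1 z' zp' zN.
  apply: d_formula_step; rewrite ?zN // => z1 zp1 z1N.
  by split; [have [] := IH1 z1 zp1 z1N|apply: IHf].
by split=> [z' zp' zN|z' zp']; [split; [apply: IHe|apply: IHg|apply: IHd]|apply: IHf].
Qed.


End GTVectors.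

(** * Action of series *)

Section SeriesAction.
Variables (K : comNzRingType) (A : algType K) (V : lmodType K).
Variable rho : representation A V.
Implicit Types (s t : nat -> A) (Q : {poly K}) (v : V) (c y : K).

Lemma act_ser_mul s t m v :
  rho (ser_mul s t m) v = \sum_(k < m.+1) rho (s k) (rho (t (m - k)%N) v).
Proof. by rewrite act_sum; apply: eq_bigr => k _; rewrite repM. Qed.

Lemma act_ser_shift c s m v : rho (ser_shift c s m) v =
  \sum_(r < m.+1) ('C(m.-1, m - r)%:R * c ^+ (m - r)) *: rho (s r) v.
Proof. by rewrite act_sum; apply: eq_bigr => k _; rewrite actZ. Qed.

Lemma act_laurent_coef Q s (m : int) v : rho (laurent_coef Q s m) v =
  \sum_(j < size Q | (m <= j%:Z)%R) Q`_j *: rho (s (absz (j%:Z - m))) v.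
Proof. by rewrite act_sum; apply: eq_bigr => k _; rewrite actZ. Qed.

Lemma act_laurent_poly Q s y v : rho (laurent_poly Q s).[y%:A] v =
  \sum_(m < size Q) y ^+ m *: rho (laurent_coef Q s m%:Z) v.
Proof.
rewrite /laurent_poly horner_poly act_sum; apply: eq_bigr => m _.
by rewrite -actZ exprZn expr1n -scalerAr mulr1.
Qed.

(** The leading coefficient 1 makes the system triangular. With the next two lemmas this leads from
    [B_i(u) zeta = 0] to [e_i^(r) zeta = 0]. *)
Lemma act_laurent_coef0 Q s v : Q \is monic ->
  (forall m, rho (laurent_coef Q s m) v = 0) -> forall t : nat, rho (s t) v = 0.
Proof.
move=> Qm Q0 t; have [k] := ubnP t; elim: k t => // k IHk t; rewrite ltnS => tk.
have Q_gt0 : (0 < size Q)%N by rewrite size_poly_gt0 monic_neq0.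
have := Q0 ((size Q).-1%:Z - t%:Z); rewrite act_laurent_coef.
have szQ : ((size Q).-1 < size Q)%N by rewrite prednK.
rewrite (bigD1 (Ordinal szQ)) /=; last by lia.
rewrite big1 => [|[j jQ] /= /andP[jt jQ']]; last first.
  have {}jQ' : j != (size Q).-1 by [].
  rewrite IHk ?scaler0 //; move: jQ jt jQ'; rewrite -{1}(prednK Q_gt0).
  by move: (size Q).-1 => d; lia.
by rewrite addr0 -lead_coefE (monicP Qm) scale1r opprB addrC subrK.
Qed.

Lemma act_ser_mul0 s t v : s 0%N = 1 ->
  (forall m, rho (ser_mul s t m) v = 0) -> forall m, rho (t m) v = 0.
Proof.
move=> s0 st m; have [k] := ubnP m; elim: k m => // k IHk m; rewrite ltnS => mk.
have := st m; rewrite act_ser_mul big_ord_recl s0 rep1 subn0 big1 ?addr0 // => -[j jm] _.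
by rewrite IHk ?(linear0 (rho _)) //= /bump /=; lia.
Qed.

Lemma act_ser_shift0 c s v :
  (forall m, rho (ser_shift c s m) v = 0) -> forall m, rho (s m) v = 0.
Proof.
move=> st m; have [k] := ubnP m; elim: k m => // k IHk m; rewrite ltnS => mk.
have := st m; rewrite act_ser_shift big_ord_recr /= subnn expr0 bin0 mul1r scale1r.
rewrite big1 ?add0r // => -[j jm] _ /=.
by rewrite IHk ?scaler0 //; lia.
Qed.

Lemma ser_mul_coef0 s t : s 0%N = 1 -> t 0%N = 1 -> ser_mul s t 0%N = 1.
Proof. by move=> s0 t0; rewrite /ser_mul big_ord1 s0 t0 mulr1. Qed.

Lemma ser_shift_coef0 c s : ser_shift c s 0%N = s 0%N.
Proof. by rewrite /ser_shift big_ord1 subnn expr0 bin0 mulr1 scale1r. Qed.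

End SeriesAction.

Section EigenSeries.
Variables (K : fieldType) (A : algType K) (V : lmodType K).
Variable rho : representation A V.

Lemma act_ser_shift_eigen c (s : nat -> A) (f : pseries K) (v : V) :
  (forall t, rho (s t) v = f t *: v) ->
  forall t, rho (ser_shift c s t) v = ps_shift c f t *: v.
Proof.
move=> sf t; rewrite act_ser_shift ps_shiftE scaler_suml.
by apply: eq_bigr => r _; rewrite sf scalerA.
Qed.

Lemma act_ser_mul_eigen (s t : nat -> A) (f g : pseries K) (v : V) :
  (forall m, rho (s m) v = f m *: v) -> (forall m, rho (t m) v = g m *: v) ->
  forall m, rho (ser_mul s t m) v = (f * g) m *: v.
Proof.
move=> sf tg m; rewrite act_ser_mul psM scaler_suml; apply: eq_bigr => k _.
by rewrite tg linearZ_LR /= sf scalerA mulrC.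
Qed.

End EigenSeries.

(** * The highest vector, and [C_r(u)] on the Gelfand-Tsetlin vectors *)

Section HighestWeightModule.
Variables (K : numFieldType) (n : nat) (p : nat -> nat) (lam : nat -> nat -> K).
Hypothesis W : generic_dominant n p lam.
Variables (V : lmodType K) (rho : representation (W_algebra K n p) V) (zeta : V).
Hypothesis hw : is_highest_weight_rep lam rho zeta.
Notation box := (box n p).
Notation state := (state n p).
Notation x := (root_at lam).
Notation pat := (pat lam).
Notation top := (top n p lam).
Notation depth := (depth lam).
Notation f_coef := (f_coef lam).
Notation e_coef := (e_coef lam).
Notation dact := (dact rho).
Notation fact := (fact rho).
Notation eact := (eact rho).
Notation gt_vec := (gt_vec lam rho zeta).
Implicit Types (b c : box) (z : state).

Let zeta_d i t : (0 < i <= n)%N -> dact i t zeta = d_series lam i top t *: zeta.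
Proof.
move=> i_n; rewrite (d_series_top W) //.
(* The coefficient of [u^(p i - t)] in [u^(p i) d_i(u)] is [d_i^(t)]. For [t > p i] this power is
   negative and [poly_coef] gives 0, as does a product of [p i] linear factors in [w]. *)
have := hw_d hw ((p i)%:Z - t%:Z) i_n; rewrite act_laurent_coef size_polyXn.
have lE : \prod_(1 <= k < (p i).+1) linps (- lam i k) =
    \prod_(a <- [seq - lam i k | k <- index_iota 1 (p i).+1]) linps a by rewrite big_map.
have wE : weight_poly p lam i =
    \prod_(a <- [seq - lam i k | k <- index_iota 1 (p i).+1]) ('X - a%:P).
  by rewrite big_map; apply: eq_bigr => k _; rewrite polyCN opprK.
have szE : size [seq - lam i k | k <- index_iota 1 (p i).+1] = p i.
  by rewrite size_map size_iota subn1.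
have szp : (p i < (p i).+1)%N by [].
rewrite (bigD1 (Ordinal szp)) /=; last by lia.
rewrite big1 => [|[j jp] /= /andP[_ jne]]; last first.
  rewrite coefXn; have {}jne : j != p i by [].
  by rewrite (negPf jne) scale0r.
rewrite coefXn eqxx scale1r addr0 opprB addrC subrK absz_nat => E.
rewrite -[dact i t zeta]/(rho (wd K n p i t) zeta) E lE; congr (_ *: _).
have [tp|pt] := leqP t (p i).
  by rewrite coef_prod_linps ?szE // subzn // wE.
rewrite coef_prod_linps_gt ?szE //.
have -> : (p i)%:Z - t%:Z = Negz (t - p i).-1 by lia.
by [].
Qed.

Lemma B_factor_monic i : B_factor K p i \is monic.
Proof.
rewrite /B_factor rpredM ?monic_exp ?monicXsubC //.
by apply: monic_prod => k _; rewrite monic_exp // monicXsubC.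
Qed.

Lemma a_ser0 i : a_ser K n p i 0%N = 1.
Proof.
elim: i => [|i IHi]; first by [].
by apply: ser_mul_coef0 => //; apply: etrans (ser_shift_coef0 _ _) (wd0 _ _ _ _).
Qed.

Let zeta_killed : killed rho zeta.
Proof.
move=> j a j_n.
have b0 m : rho (b_ser K n p j m) zeta = 0.
  by apply: (act_laurent_coef0 (B_factor_monic j)) => m'; apply: (hw_B hw m' j_n).
have e0 : forall m, rho (ser_shift j.-1%:R (we K n p j) m) zeta = 0.
  exact: act_ser_mul0 (a_ser0 j) b0.
exact: act_ser_shift0 e0 _.
Qed.

Let zeta_neq0 : zeta != 0. Proof. exact: hw_neq0 hw. Qed.
Let rho_irr : irreducible rho. Proof. exact: hw_irreducible hw. Qed.

Lemma gt_formulas z : pat z -> [/\ e_formula lam rho zeta z, d_formula lam rho zeta z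
  & f_formula lam rho zeta z].
Proof. exact: gt_vec_formulas. Qed.

Lemma wf_act0 i v : rho (wf K n p i 0) v = 0.
Proof.
have -> : wf K n p i 0 = 0; last exact: act0.
rewrite /wf /yf /ff /sym insubF ?raddf0 //.
by rewrite /admissible andbF.
Qed.

Lemma act_a_ser z r t : pat z -> (r <= n)%N ->
  rho (a_ser K n p r t) (gt_vec z) = a_series lam r z t *: gt_vec z.
Proof.
move=> zp; have [_ dz _] := gt_formulas zp; elim: r t => [|r IHr] t rn.
  by case: t => [|t]; rewrite /= ps1 ?rep1 ?scale1r ?act0 ?scale0r.
apply: act_ser_mul_eigen => m; first by apply: IHr; apply: ltnW.
by apply: act_ser_shift_eigen => {}m; apply: dz.
Qed.

Lemma act_c_ser z r t : pat z -> (0 < r < n)%N ->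
  rho (c_ser K n p r t) (gt_vec z) = \sum_(b | inrow r b)
    (psX K * geops (x z b + r.-1%:R) * a_series lam r z) t *:
      (f_coef z b *: gt_vec (z + unit_at b)).
Proof.
move=> zp r_n; have [_ _ fz] := gt_formulas zp.
have fE s : rho (wf K n p r s) (gt_vec z) = \sum_(b | inrow r b)
    (psX K * geops (x z b)) s *: (f_coef z b *: gt_vec (z + unit_at b)).
  case: s => [|s].
    by rewrite wf_act0 big1 // => b _; rewrite psXM scale0r.
  apply: etrans (fz _ _ r_n) _; apply: eq_bigr => b _.
  by rewrite psXM geopsE scalerA.
have shiftE (y : K) : ps_shift r.-1%:R (psX K * geops y) = psX K * geops (y + r.-1%:R).
  apply: (@linps_inj _ r.-1%:R); rewrite ps_shiftX -[geops y]mulr1 ps_shift_geops.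
  by rewrite ps_shift1 mulr1; ring.
rewrite act_ser_mul.
under eq_bigr => k _.
  rewrite act_a_ser ?linearZ_LR /=; [|by []|by lia].
  rewrite act_ser_shift.
  under eq_bigr => s _ do rewrite fE scaler_sumr.
  rewrite exchange_big scaler_sumr /=.
  over.
rewrite exchange_big; apply: eq_bigr => b _; rewrite psM scaler_suml.
apply: eq_bigr => k _; rewrite -shiftE ps_shiftE.
rewrite [X in _ = X *: _]mulrC -scalerA; congr (_ *: _); rewrite scaler_suml.
apply: eq_bigr => s _. by rewrite scalerA.
Qed.

Lemma act_C_at z r y : pat z -> (0 < r < n)%N ->
  rho (C_at n p r y) (gt_vec z) = \sum_(b | inrow r b)
    (\prod_(c | inrow r c && (c != b)) (y - (x z c + r.-1%:R))) *:
      (f_coef z b *: gt_vec (z + unit_at b)).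
Proof.
move=> zp r_n; apply: etrans (act_laurent_poly _ _ _ _ _) _.
have cE b : inrow r b -> \prod_(c | inrow r c && (c != b)) (y - (x z c + r.-1%:R)) =
    \sum_(m < size (C_factor K p r))
     (\sum_(j < size (C_factor K p r) | (m <= j)%N) (C_factor K p r)`_j *
       (psX K * geops (x z b + r.-1%:R) * a_series lam r z) (j - m)%N) * y ^+ m.
  by move=> rb; rewrite (C_polynomial W) //; lia.
under [RHS]eq_bigr => b rb do rewrite cE // scaler_suml.
rewrite exchange_big; apply: eq_bigr => m _ /=.
rewrite act_laurent_coef.
pose g b t := (psX K * geops (x z b + r.-1%:R) * a_series lam r z) t.
transitivity (y ^+ m *: \sum_(j < size (C_factor K p r) | (m%:Z <= j%:Z)%R)
    \sum_(b | inrow r b) (C_factor K p r)`_j *: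
      (g b (absz (j%:Z - m%:Z)) *: (f_coef z b *: gt_vec (z + unit_at b)))).
  congr (_ *: _); apply: eq_bigr => j _; rewrite -scaler_sumr; congr (_ *: _).
  exact: act_c_ser.
rewrite exchange_big scaler_sumr; apply: eq_bigr => b rb /=.
rewrite [X in _ = X *: _]mulrC -scalerA scaler_suml; congr (_ *: _).
apply: eq_big => [j|j mj]; first by rewrite lez_nat.
by rewrite scalerA /g subzn // -lez_nat.
Qed.

Lemma act_C_root z b : pat z -> active b -> pat (z + unit_at b) ->
  exists2 k, k != 0 & rho (C_at n p (row b) (x z b + (row b).-1%:R)) (gt_vec z)
    = k *: gt_vec (z + unit_at b).
Proof.
move=> zp /andP[bn bv] zbp; have rb : inrow (row b) b by rewrite /inrow eqxx.
have r_n : (0 < row b < n)%N by rewrite (valid_row bv).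
exists ((\prod_(c | inrow (row b) c && (c != b))
  (x z b + (row b).-1%:R - (x z c + (row b).-1%:R))) * f_coef z b).
  by rewrite mulf_neq0 ?(C_polynomial_neq0 W) ?(f_coef_neq0 W).
rewrite act_C_at // (bigD1 b) //= scalerA [X in _ + X]big1 ?addr0 // => c /andP[rc cb].
by rewrite C_polynomial_eq0 ?scale0r // eq_sym.
Qed.

End HighestWeightModule.

(** * Independence and spanning of the Gelfand-Tsetlin vectors *)

Section GTBasis.
Variables (K : numFieldType) (n : nat) (p : nat -> nat) (lam : nat -> nat -> K).
Hypothesis W : generic_dominant n p lam.
Variables (V : lmodType K) (rho : representation (W_algebra K n p) V) (zeta : V).
Hypothesis hw : is_highest_weight_rep lam rho zeta.
Notation box := (box n p).
Notation state := (state n p).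
Notation x := (root_at lam).
Notation pat := (pat lam).
Notation top := (top n p lam).
Notation depth := (depth lam).
Notation f_coef := (f_coef lam).
Notation e_coef := (e_coef lam).
Notation dact := (dact rho).
Notation fact := (fact rho).
Notation eact := (eact rho).
Notation gt_vec := (gt_vec lam rho zeta).
Implicit Types (b c : box) (z : state).

Lemma eact_poly_sum (s : seq state) (k : state -> K) (r : nat) (P : {poly K}) :
  all pat s -> (0 < r < n)%N -> \sum_(z <- s) k z *: gt_vec z = 0 ->
  \sum_(z <- s) \sum_(b | inrow r b)
    (k z * (P.[x z b - 1] * e_coef z b)) *: gt_vec (z - unit_at b) = 0.
Proof.
move=> /allP sp r_n s0.
have : \sum_(a < size P) P`_a *: eact r a (\sum_(z <- s) k z *: gt_vec z) = 0.
  by rewrite s0 big1 // => a _; rewrite linear0 scaler0.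
under eq_bigr => a _ do rewrite linear_sum scaler_sumr.
rewrite exchange_big big_seq => E; rewrite big_seq -[RHS]E.
apply: eq_bigr => z /sp zp; have [ez _ _] := gt_formulas W hw zp.
under [RHS]eq_bigr => a _.
  rewrite linearZ_LR /= ez // scalerA mulrC -scalerA.
  over.
rewrite -scaler_sumr poly_sum scaler_sumr; apply: eq_bigr => b _.
by rewrite scalerA.
Qed.

(** A Lagrange combination of the [e_r^(a)] turns a relation into one of smaller depth. For a
    removable box [b] of [z], the coefficient of [z - unit_at b] in it is [k z] times a nonzero
    [e_coef]. Every pattern except [top] has such a box. *)
Lemma gt_vec_free (s : seq state) (k : state -> K) : uniq s -> all pat s ->
  \sum_(z <- s) k z *: gt_vec z = 0 -> {in s, forall z, k z = 0}.
Proof.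
have [N] := ubnP (\max_(z <- s) depth z).
elim: N s k => // N IHN s k; rewrite ltnS => sN us sp s0.
have /allP spz := sp.
have k0 z b : z \in s -> active b -> pat (z - unit_at b) -> k z = 0.
  move=> zs /andP[bn bv] bp; pose r := row b; pose z' := z - unit_at b.
  have rb : inrow r b by rewrite /inrow eqxx.
  have r_n : (0 < r < n)%N by rewrite /r (valid_row bv).
  pose P := lagrange lam z' b.
  have := eact_poly_sum P sp r_n s0; rewrite exchange_big /=.
  pose F c y := k y * (P.[x y c - 1] * e_coef y c).
  pose s' := undup [seq y - unit_at c | y <- s, c <- [seq c <- enum box | pat (y - unit_at c)]].
  have s'P y : reflect (exists y1 c, [/\ y1 \in s, pat (y1 - unit_at c) & y = y1 - unit_at c])
      (y \in s').
    rewrite mem_undup; apply: (iffP allpairsPdep) => [[y1 [c [y1s]]]|[y1 [c [y1s cp ->]]]].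
      by rewrite mem_filter => /andP[cp _] ->; exists y1, c.
    by exists y1, c; split=> //; rewrite mem_filter cp mem_enum.
  (* Several pairs may lead to the same [y1 - unit_at c]; [k'] gathers their coefficients over the
     duplicate-free [s']. *)
  pose k' y := \sum_(c | inrow r c) (if y + unit_at c \in s then F c (y + unit_at c) else 0).
  have E c : inrow r c -> \sum_(y <- s) F c y *: gt_vec (y - unit_at c) =
      \sum_(y <- s') (if y + unit_at c \in s then F c (y + unit_at c) else 0) *: gt_vec y.
    move=> rc; rewrite (bigID (fun y => pat (y - unit_at c))) /= addrC big1 ?add0r; last first.
      by move=> y cp; rewrite gt_vec_out ?scaler0.
    rewrite [RHS](eq_bigr (fun y => if y + unit_at c \in s then
      F c (y + unit_at c) *: gt_vec y else 0)); last by move=> y _; case: ifP; rewrite ?scale0r.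
    rewrite -big_mkcond -big_filter -[RHS]big_filter.
    have -> : \sum_(y <- [seq y <- s | pat (y - unit_at c)]) F c y *: gt_vec (y - unit_at c)
        = \sum_(y <- [seq y - unit_at c | y <- [seq y <- s | pat (y - unit_at c)]])
            F c (y + unit_at c) *: gt_vec y.
      by rewrite big_map; apply: eq_bigr => y _; rewrite subrK.
    apply: perm_big; apply: uniq_perm.
    - rewrite map_inj_uniq ?filter_uniq // => y1 y2; exact: addIr.
    - by rewrite filter_uniq ?undup_uniq.
    move=> y; apply/mapP/idP => [[y1]|].
      rewrite mem_filter => /andP[y1p y1s] ->; rewrite mem_filter subrK y1s /=.
      by apply/s'P; exists y1, c.
    rewrite mem_filter => /andP[ys /s'P[y1 [d [_ y1p yE]]]].
    exists (y + unit_at c); rewrite ?addrK // mem_filter addrK ys andbT.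
    by rewrite yE.
  rewrite (eq_bigr _ E) exchange_big /= => s'0.
  have : {in s', forall y, k' y = 0}.
    apply: IHN; rewrite ?undup_uniq //.
    - have N_gt0 : (0 < N)%N.
        apply: leq_trans sN; apply: leq_trans (leq_bigmax_seq _ zs isT).
        by rewrite (depth_dec W bp).
      rewrite -(prednK N_gt0) ltnS; apply/bigmax_leqP_seq => y /s'P[y1 [c [y1s cp ->]]] _.
      rewrite -ltnS prednK // -(depth_dec W cp); apply: leq_trans sN.
      exact: leq_bigmax_seq.
    - by apply/allP => y /s'P[y1 [c [_ cp ->]]].
    - by rewrite -[RHS]s'0; apply: eq_bigr => y _; rewrite /k' scaler_suml.
  have z's' : z' \in s' by apply/s'P; exists z, b.
  (* For a pattern [z' + unit_at c] the argument of [P] is [x z' c], a node of the interpolation, so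
     the terms with [c != b] vanish. *)
  move=> /(_ z' z's'); rewrite /k' (bigD1 b) //= [X in _ + X]big1 => [|c /andP[rc cb]].
    rewrite addr0 subrK zs /F -[x z b - 1](_ : x z' b = _); last first.
      by rewrite /z' root_at_dec eqxx.
    rewrite (lagrange_eq W) // eqxx mul1r => /eqP.
    by rewrite mulf_eq0 (negPf (e_coef_neq0 W (spz z zs) bp)) orbF => /eqP.
  case: ifP => // _; rewrite /F root_at_inc eqxx addrK (lagrange_eq W) // (negPf cb).
  by rewrite mul0r mulr0.
move=> z zs; have [zt|zt] := eqVneq z top; last first.
  by have [b ab bp] := ex_pat_dec W (spz z zs) zt; apply: k0 ab bp.
move: s0; rewrite (bigD1_seq z) //= big_seq_cond big1 => [|y /andP[ys yz]]; last first.
  have yt : y != top by rewrite -zt.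
  by have [b ab bp] := ex_pat_dec W (spz y ys) yt; rewrite (k0 y b) ?scale0r.
rewrite addr0 [gt_vec z](_ : _ = zeta) => [/eqP|]; last by rewrite zt gt_vec_top.
by rewrite scaler_eq0 (negPf (hw_neq0 hw)) orbF => /eqP.
Qed.

Inductive gt_span : V -> Prop :=
| gt_span_base z of pat z : gt_span (gt_vec z)
| gt_span0 : gt_span 0
| gt_spanP (a : K) u v of gt_span u & gt_span v : gt_span (a *: u + v).

Let gt_span_vec z : gt_span (gt_vec z).
Proof.
have [zp|/gt_vec_out ->] := boolP (pat z); [exact: gt_span_base|exact: gt_span0].
Qed.

Let gt_span_sum (A : pred box) (k : box -> K) (w : box -> state) :
  gt_span (\sum_(b | A b) k b *: gt_vec (w b)).
Proof.
apply: big_ind => [|u v hu hv|b _]; first exact: gt_span0.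
  by rewrite -[u]scale1r; apply: gt_spanP.
by rewrite -[_ *: _]addr0; apply: gt_spanP => //; apply: gt_span0.
Qed.

Lemma gt_span_full v : gt_span v.
Proof.
have [_ irr] := hw_irreducible hw.
have stable (g : {linear V -> V}) : (forall z, pat z -> gt_span (g (gt_vec z))) ->
    forall u, gt_span u -> gt_span (g u).
  move=> gz u; elim=> {u} [z zp||k u w _ IHu _ IHw]; first exact: gz.
    by rewrite linear0; apply: gt_span0.
  by rewrite linearP; apply: gt_spanP.
have sub : subrepresentation rho [set u | gt_span u]%classic.
  split=> [|c u w|a u]; [exact: gt_span0|exact: gt_spanP|].
  apply: (@generators_stable _ _ _ _ rho gt_span).
  - exact: gt_span0.
  - exact: gt_spanP.
  - move=> i t w i_n; apply: (stable (dact i t)) => z zp.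
    have [_ dz _] := gt_formulas W hw zp.
    rewrite -[gt_span _]/(gt_span (dact i t (gt_vec z))) dz // -[_ *: _]addr0.
    by apply: gt_spanP => //; apply: gt_span0.
  - move=> i s w i_n; apply: (stable (fact i s)) => z zp.
    have [_ _ fz] := gt_formulas W hw zp.
    rewrite -[gt_span _]/(gt_span (fact i s (gt_vec z))) fz //.
    exact: gt_span_sum.
  - move=> i a' w i_n; apply: (stable (eact i a')) => z zp.
    have [ez _ _] := gt_formulas W hw zp.
    rewrite -[gt_span _]/(gt_span (eact i a' (gt_vec z))) ez //.
    exact: gt_span_sum.
have [U0|UT] := irr _ sub; last by have : [set u | gt_span u]%classic v by rewrite UT.
have : [set u | gt_span u]%classic zeta.
  by have := gt_span_vec top; rewrite gt_vec_top.
by rewrite U0 /= => z0; have := hw_neq0 hw; rewrite z0 eqxx.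
Qed.

End GTBasis.

(** * Patterns and states *)

Section PatternStates.
Variables (K : numFieldType) (n : nat) (p : nat -> nat) (lam : nat -> nat -> K).
Hypothesis W : generic_dominant n p lam.
Notation box := (box n p).
Notation state := (state n p).
Notation x := (root_at lam).
Notation pat := (pat lam).
Notation top := (top n p lam).
Notation array := (nat -> nat -> nat -> K).
Implicit Types (b c : box) (z : state) (L : array).

Lemma to_nat_natr (m : nat) : to_nat (m%:R : K) = m.
Proof. by apply/eqP; rewrite -(eqr_nat K) -to_natK //; exists m. Qed.

Lemma is_natD (s t : K) : is_nat s -> is_nat t -> is_nat (s + t).
Proof. by move=> [a ->] [b ->]; exists (a + b)%N; rewrite natrD. Qed.

Lemma pattern_nat L r i k : is_pattern n p lam L -> (0 < i <= r)%N -> (r <= n)%N ->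
  (0 < k <= p i)%N -> is_nat (lam i k - L r i k).
Proof.
move=> Lp ir rn ki; have [m] := ubnP (n - r)%N; elim: m r ir rn => // m IHm r ir rn rm.
have [nr|rn'] := eqVneq r n.
  by rewrite nr (pattern_top Lp) // ?subrr; [exists 0%N|lia].
rewrite -[lam i k](subrK (L r.+1 i k)) -addrA; apply: is_natD.
  by apply: IHm; lia.
by apply: (pattern_up Lp) => //; lia.
Qed.

Definition state_of L : state := [ffun b =>
  if valid b then top b + (to_nat (lam (col b) (lay b) - L (row b) (col b) (lay b)))%:Z
  else top b].

Lemma state_ofP L b : is_pattern n p lam L -> valid b ->
  exists m : nat, state_of L b = top b + m%:Z /\
    L (row b) (col b) (lay b) = lam (col b) (lay b) - m%:R.
Proof.
move=> Lp bv; have /andP[cb lb] := bv.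
exists (to_nat (lam (col b) (lay b) - L (row b) (col b) (lay b))).
rewrite [state_of L b]ffunE bv; split=> //.
by rewrite -to_natK ?subKr //; apply: pattern_nat => //; apply: row_le.
Qed.

Lemma gapsS i k : (0 < i < n)%N -> (0 < k <= p i)%N ->
  lam i k - lam i.+1 k = (gaps n lam i k)%:R - (gaps n lam i.+1 k)%:R.
Proof.
move=> i_n ki; have pi : (p i <= p i.+1)%N by apply: gd_p_mono W _ _.
rewrite (@lam_gaps _ _ _ _ W i) //; last by lia.
rewrite (@lam_gaps _ _ _ _ W i.+1); [ring|lia|lia].
Qed.

Lemma pat_state_of L : is_pattern n p lam L -> pat (state_of L).
Proof.
move=> Lp; apply/patP; split=> [b|b c bv cv l r k|b c bv cv l r k].
- rewrite /active; have [bv|nbv _] := boolP (valid b); last by rewrite ffunE (negPf nbv).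
  have := row_le b; rewrite andbT -leqNgt => bn nb.
  have rb : row b = n by lia.
  have /andP[cb lb] := bv.
  rewrite ffunE bv rb (pattern_top Lp) // ?subrr; last by lia.
  by rewrite -[0]/(0%:R) to_nat_natr addr0.
- have [m [-> Lb]] := state_ofP Lp bv; have [m' [-> Lc]] := state_ofP Lp cv.
  have /andP[cb lb] := bv; have := row_le c => cn.
  have [N] := pattern_up Lp (r := row b) (i := col b) (k := lay b) ltac:(lia) ltac:(lia) lb.
  rewrite Lb -r -k l Lc; have -> : lam (col c) (lay c) - m'%:R - (lam (col c) (lay c) - m%:R)
     = m%:R - m'%:R :> K by ring.
  move/eqP; rewrite subr_eq -natrD eqr_nat => /eqP mE.
  by rewrite !ffunE r k l; lia.
have [m [-> Lb]] := state_ofP Lp bv; have [m' [-> Lc]] := state_ofP Lp cv.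
have /andP[cb lb] := bv; have := row_le c => cn.
have [N] := pattern_down Lp (r := row b) (i := col b) (k := lay b) ltac:(lia) ltac:(lia) lb.
rewrite Lb -r -k l Lc.
have -> : lam (col b) (lay c) - m%:R - (lam (col c) (lay c) - m'%:R) =
   (lam (col b) (lay c) - lam (col c) (lay c)) + (m'%:R - m%:R) by ring.
rewrite k gapsS; [|lia|by rewrite -l].
move/eqP; rewrite addrACA -natrD -opprD -natrD subr_eq -natrD eqr_nat => /eqP mE.
by rewrite !ffunE r k l; lia.
Qed.

Definition box_of r i k : box := (inord r, inord i, inord k).

Lemma box_ofK b : box_of (row b) (col b) (lay b) = b.
Proof. by case: b => [[r i] k]; rewrite /box_of /row /col /lay /= !inord_val. Qed.

Lemma box_ofE r i k : (0 < i <= r)%N -> (r <= n)%N -> (0 < k <= p i)%N ->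
  [/\ row (box_of r i k) = r, col (box_of r i k) = i, lay (box_of r i k) = k
    & valid (box_of r i k)].
Proof.
move=> ir rn ki; have [b /andP[/eqP <- bv] [<- <-]] := ex_box W ir rn ki.
by rewrite box_ofK.
Qed.

Definition array_of z : array := fun r i k =>
  if [&& (0 < i <= r)%N, (r <= n)%N & (0 < k <= p i)%N]
  then lam i k - (z (box_of r i k) - top (box_of r i k))%:~R else 0.

Lemma array_of_pattern z : pat z -> is_pattern n p lam (array_of z).
Proof.
move=> zp; have /patP zpp := zp.
have is_int_nat (m : int) : 0 <= m -> is_nat (m%:~R : K).
  by case: m => // m _; exists m.
split=> [i k i_n ki|r i k ir rn ki|r i k ir rn ki|r i k].
- have [rb cb lb bv] := box_ofE i_n (leqnn n) ki.
  rewrite /array_of i_n leqnn ki (pat_fixed zpp) ?subrr ?subr0 //.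
  by rewrite /active rb ltnn.
- have [rb cb lb bv] := @box_ofE r i k ir ltac:(lia) ki.
  have [rc cc lc cv] := @box_ofE r.+1 i k ltac:(lia) ltac:(lia) ki.
  rewrite /array_of ir ki !ifT; try lia.
  rewrite opprD opprK addrACA subrr add0r addrC -intrB; apply: is_int_nat.
  have := pat_lt zpp bv cv ltac:(lia) ltac:(lia) ltac:(lia).
  by rewrite ![top _]ffunE rb cb lb rc cc lc; lia.
- have pi : (p i <= p i.+1)%N by apply: gd_p_mono W _ _; lia.
  have [rb cb lb bv] := @box_ofE r i k ir ltac:(lia) ki.
  have [rc cc lc cv] := @box_ofE r.+1 i.+1 k ltac:(lia) ltac:(lia) ltac:(lia).
  rewrite /array_of ki !ifT; try lia.
  have -> : forall s t u v : K, s - t - (u - v) = (s - u) + (v - t) by move=> *; ring.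
  rewrite gapsS; [|lia|lia].
  rewrite !pmulrn -!intrB -intrD; apply: is_int_nat.
  have := pat_le zpp bv cv ltac:(lia) ltac:(lia) ltac:(lia).
  by rewrite ![top _]ffunE rb cb lb rc cc lc; lia.
by rewrite /array_of => /negPf ->.
Qed.

Lemma array_ofK z : pat z -> state_of (array_of z) = z.
Proof.
move=> zp; apply/ffunP => b; rewrite ffunE; case: ifP => bv; last first.
  by have /patP zpp := zp; rewrite (pat_fixed zpp) // /active bv andbF.
have := bv => /andP[cb lb]; rewrite /array_of cb lb (row_le b) /= box_ofK subKr.
have := pat_ge_top W b zp; rewrite -subr_ge0.
by case E : (z b - top b) => [m|//] _; rewrite to_nat_natr -E addrC subrK.
Qed.

Lemma state_of_inj L L' : is_pattern n p lam L -> is_pattern n p lam L' ->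
  state_of L = state_of L' -> L = L'.
Proof.
move=> Lp Lp' E; apply/funext => r; apply/funext => i; apply/funext => k.
have [|out] := boolP [&& (0 < i <= r)%N, (r <= n)%N & (0 < k <= p i)%N]; last first.
  by rewrite (pattern_out Lp) // (pattern_out Lp').
move=> /and3P[ir rn ki]; have [rb cb lb bv] := box_ofE ir rn ki.
have [m [E1 E1']] := state_ofP Lp bv; have [m' [E2 E2']] := state_ofP Lp' bv.
rewrite rb cb lb in E1' E2'; rewrite E1' E2'.
by congr (_ - _%:R); move: E1; rewrite E E2 => /addrI [].
Qed.

End PatternStates.

(** * The vectors of the statement *)

Section ZetaVectors.
Variables (K : numFieldType) (n : nat) (p : nat -> nat) (lam : nat -> nat -> K).
Hypothesis W : generic_dominant n p lam.
Variables (V : lmodType K) (rho : representation (W_algebra K n p) V) (zeta : V).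
Hypothesis hw : is_highest_weight_rep lam rho zeta.
Notation box := (box n p).
Notation state := (state n p).
Notation x := (root_at lam).
Notation pat := (pat lam).
Notation top := (top n p lam).
Notation gt_vec := (gt_vec lam rho zeta).
Notation WA := (W_algebra K n p).
Implicit Types (b c : box) (z : state) (A : pred box).

Lemma incnE z b c m : (z + unit_at b *+ m) c = z c + ((c == b) * m)%N%:Z.
Proof.
elim: m => [|m IHm]; first by rewrite mulr0n addr0 muln0 addr0.
by rewrite mulrSr addrA incE IHm; case: (c == b); lia.
Qed.

Lemma pat_between z b m j : pat z -> pat (z + unit_at b *+ m) -> (j <= m)%N ->
  pat (z + unit_at b *+ j).
Proof.
move=> /patP z0 /patP zm jm; apply/patP; split=> [c nc|c d cv dv l r k|c d cv dv l r k];
  rewrite !incnE.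
- by have := pat_fixed z0 nc; have := pat_fixed zm nc; rewrite incnE; case: (c == b); lia.
- have := pat_lt z0 cv dv l r k; have := pat_lt zm cv dv l r k; rewrite !incnE.
  by case: (c == b); case: (d == b); lia.
- have := pat_le z0 cv dv l r k; have := pat_le zm cv dv l r k; rewrite !incnE.
  by case: (c == b); case: (d == b); lia.
Qed.

(** For a basis it matters only that the scalar is nonzero, which composition preserves. *)
Definition reach (a : WA) z z' := exists2 k : K, k != 0 & rho a (gt_vec z) = k *: gt_vec z'.

Lemma reach1 z : reach 1 z z.
Proof. by exists 1; rewrite ?oner_neq0 // rep1 scale1r. Qed.

Lemma reachM a a' z z' z'' : reach a' z z' -> reach a z' z'' -> reach (a * a') z z''.
Proof.
move=> [k k0 E] [l l0 E']; exists (k * l); first exact: mulf_neq0.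
by apply: etrans (repM _ _ _ _) _; rewrite E linearZ_LR /= E' scalerA.
Qed.

Lemma reach_prod (F : nat -> WA) (Z : nat -> state) i j : (i <= j)%N ->
  (forall k, (i <= k < j)%N -> reach (F k) (Z k.+1) (Z k)) ->
  reach (\prod_(i <= k < j) F k) (Z j) (Z i).
Proof.
move=> ij; have [m] := ubnP (j - i)%N; elim: m i ij => // m IHm i ij jm FZ.
move: ij; rewrite leq_eqVlt => /predU1P[->|ij]; first by rewrite big_geq //; apply: reach1.
rewrite big_ltn //; apply: reachM (FZ i _); last by rewrite leqnn.
by apply: IHm; [|lia|move=> k k_ij; apply: FZ; lia].
Qed.

Lemma reach_prod_rev (F : nat -> WA) (Z : nat -> state) i j : (i <= j)%N ->
  (forall k, (i <= k < j)%N -> reach (F k) (Z k) (Z k.+1)) ->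
  reach (\prod_(k <- rev (index_iota i j)) F k) (Z i) (Z j).
Proof.
move=> ij; have -> : j = (i + (j - i))%N by rewrite subnKC.
elim: (j - i)%N => [|m IHm] FZ.
  by rewrite addn0 /index_iota subnn big_nil; apply: reach1.
have -> : index_iota i (i + m.+1) = index_iota i (i + m) ++ [:: (i + m)%N].
  by rewrite /index_iota !addKn -(addn1 m) iotaD.
rewrite rev_cat big_cons addnS; apply: reachM; last by apply: FZ; lia.
by apply: IHm => k k_i; apply: FZ; lia.
Qed.

Lemma reach_string z b m : pat z -> active b -> pat (z + unit_at b *+ m) ->
  reach (\prod_(j <- rev (iota 0 m)) C_at n p (row b) (x z b + (row b).-1%:R + j%:R))
    z (z + unit_at b *+ m).
Proof.
move=> zp ab zmp.
have := @reach_prod_rev (fun j => C_at n p (row b) (x z b + (row b).-1%:R + j%:R))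
  (fun j => z + unit_at b *+ j) 0 m (leq0n m).
rewrite mulr0n addr0 /index_iota subn0; apply=> k k_m.
have zk : pat (z + unit_at b *+ k) by apply: pat_between zmp _ => //; lia.
have zk1 : pat (z + unit_at b *+ k + unit_at b).
  by rewrite -addrA -mulrSr; apply: pat_between zmp _ => //; lia.
have rootE : x (z + unit_at b *+ k) b + (row b).-1%:R = x z b + (row b).-1%:R + k%:R.
  by rewrite /root_at incnE eqxx mul1n intrD -pmulrn; ring.
have zE : z + unit_at b *+ k.+1 = z + unit_at b *+ k + unit_at b by rewrite mulrSr addrA.
have := act_C_root W hw zk ab zk1; rewrite rootE -zE.
by case=> l l0 E; exists l.
Qed.

Section Path.
Variable L : nat -> nat -> nat -> K.
Hypothesis Lp : is_pattern n p lam L.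
Notation zL := (state_of n p lam L).

Definition mix A : state := [ffun b => if A b then zL b else top b].

Let zLp : pat zL := pat_state_of W Lp.

Lemma eq_mix A A' : (forall b, active b -> A b = A' b) -> mix A = mix A'.
Proof.
move=> AA; apply/ffunP => b; rewrite [LHS]ffunE [RHS]ffunE.
have [ab|nb] := boolP (active b); first by rewrite AA.
by have /patP zp := zLp; rewrite (pat_fixed zp nb) !if_same.
Qed.

(** As the entries of [zL] are at least those of [top], [z_c < z_b] can fail only if [c] is raised
    without [b], and [z_b <= z_c] only if [b] is raised without [c]. The two closure conditions
    exclude this. *)
Lemma pat_mix A :
  (forall b c, valid b -> valid c -> lay b = lay c -> row c = (row b).+1 ->
     col c = col b -> A c -> A b) ->
  (forall b c, valid b -> active c -> lay b = lay c -> row c = (row b).+1 ->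
     col c = (col b).+1 -> A b -> A c) -> pat (mix A).
Proof.
move=> A1 A2; have /patP zp := zLp; have /patP tp := pat_top W.
apply/patP; split=> [b nb|b c bv cv l r k|b c bv cv l r k].
- by rewrite ffunE (pat_fixed zp nb) if_same.
- have := pat_lt zp bv cv l r k; have := pat_lt tp bv cv l r k.
  have := A1 b c bv cv l r k; have := pat_ge_top W b zLp.
  rewrite [mix A c]ffunE [mix A b]ffunE.
  by case: (A b); case: (A c) => //; [lia|move=> _ /(_ isT)].
have := pat_le zp bv cv l r k; have := pat_le tp bv cv l r k.
have := pat_ge_top W c zLp; have := A2 b c bv.
rewrite [mix A c]ffunE [mix A b]ffunE.
have [ac /(_ isT l r k)|nc _] := boolP (active c).
  by case: (A b); case: (A c) => //; [move=> /(_ isT)|lia].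
rewrite (pat_fixed zp nc) if_same.
by case: (A b).
Qed.

(** The boxes treated once the factor for (r, i, k) has acted. Products act from the right: columns
    come in decreasing order, rows increase within a column, and layers decrease within a row. *)
Definition lowered i r k : pred box := fun b =>
  (i < col b)%N || (col b == i) && ((row b < r)%N || (row b == r) && (k <= lay b)%N).

Lemma pat_lowered i r k : pat (mix (lowered i r k)).
Proof.
by apply: pat_mix => b c bv cv l rc cc; rewrite /lowered rc cc -?l; lia.
Qed.

Lemma reach_lower_string i r k : (0 < i <= r)%N -> (r < n)%N -> (0 < k <= p i)%N ->
  reach (lower_string n p lam L r i k) (mix (lowered i r k.+1)) (mix (lowered i r k)).
Proof.
move=> ir rn ki; have [rb cb lb bv] := box_ofE W ir (ltnW rn) ki.
set b := box_of n p r i k in rb cb lb bv *.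
have ab : active b by rewrite /active rb rn.
have topb : mix (lowered i r k.+1) b = top b.
  by rewrite ffunE /lowered rb cb lb; case: ifP => //; lia.
rewrite /lower_string.
have -> : l_top lam i k - l_row L r i k = lam i k - L r i k.
  by rewrite /l_top /l_row; ring.
set m := to_nat _.
have E : mix (lowered i r k) = mix (lowered i r k.+1) + unit_at b *+ m.
  apply/ffunP => c; rewrite incnE; have [->|cb'] := eqVneq c b.
    rewrite topb mul1n [LHS]ffunE ifT; last by rewrite /lowered rb cb lb; lia.
    by rewrite [LHS]ffunE bv rb cb lb.
  rewrite mul0n addr0 [LHS]ffunE [RHS]ffunE.
  suff -> : lowered i r k c = lowered i r k.+1 c by [].
  rewrite /lowered; have [cc|] := eqVneq (col c) i; last by [].
  have [rc|] := eqVneq (row c) r; last by [].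
  suff : lay c != k by lia.
  by apply: contraNneq cb' => lc; apply/eqP; apply: box_eq; lia.
have := @reach_string (mix (lowered i r k.+1)) b m (pat_lowered _ _ _) ab.
rewrite -E => /(_ (pat_lowered _ _ _)); rewrite rb.
(* At the highest entry [x_b = - lambda_i^(k) + i - r], so the string starts at [- l_i^(k)]; each
   factor then raises the root by 1. *)
have -> // : x (mix (lowered i r k.+1)) b + r.-1%:R = - l_top lam i k.
rewrite /root_at topb -/(root_at lam top b) root_at_top // rb cb lb /l_top.
by have -> : r%:R = r.-1%:R + 1 :> K; [rewrite natr1 prednK //; lia|ring].
Qed.

Lemma reach_zeta_elt : reach (zeta_elt n p lam L) top zL.
Proof.
have valid_le b : valid b -> (0 < col b <= row b)%N && (0 < lay b <= p (col b))%N by [].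
pose X i := mix (fun b => i <= col b)%N.
have X1 : X 1%N = zL.
  apply/ffunP => b; rewrite ffunE; case: ifP => // c0.
  have /patP zp := zLp; rewrite (pat_fixed zp) //.
  by apply/negP => /andP[_ /valid_le]; lia.
(* Active boxes lie in columns below [n], so nothing is lowered yet. *)
have Xn : X n = top.
  apply/ffunP => b; rewrite ffunE; case: ifP => // c0.
  have /patP zp := zLp; rewrite (pat_fixed zp) //.
  by apply/negP => /andP[bn /valid_le]; lia.
rewrite -X1 -Xn /zeta_elt; apply: reach_prod => [|i i_n].
  exact: gd_n_gt0 W.
have -> : X i.+1 = mix (lowered i i (p i).+1).
  apply: eq_mix => b /andP[bn /valid_le bv]; rewrite /lowered.
  by have [cb|] := eqVneq (col b) i; [rewrite cb in bv *|]; lia.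
have -> : X i = mix (lowered i n (p i).+1).
  apply: eq_mix => b /andP[bn /valid_le bv]; rewrite /lowered.
  by have [cb|] := eqVneq (col b) i; [rewrite cb in bv *|]; lia.
apply: (@reach_prod_rev _ (fun r => mix (lowered i r (p i).+1))); first by lia.
move=> r r_n; have -> : mix (lowered i r.+1 (p i).+1) = mix (lowered i r 1).
  apply: eq_mix => b /andP[bn /valid_le bv]; rewrite /lowered.
  by have [cb|] := eqVneq (col b) i; [rewrite cb in bv *|]; lia.
rewrite /P_elt; apply: (@reach_prod _ (fun k => mix (lowered i r k))) => // k k_p.
by apply: reach_lower_string; lia.
Qed.

End Path.

Lemma zeta_vecE (L : pattern n p lam) : exists2 k, k != 0 &
  zeta_vec rho zeta L = k *: gt_vec (state_of n p lam (sval L)).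
Proof.
have [k k0 E] := reach_zeta_elt (svalP L).
by exists k => //; rewrite -E gt_vec_top.
Qed.

Theorem zeta_vec_basis : is_basis (zeta_vec (lam := lam) rho zeta).
Proof.
split=> [m s c s_inj s0 j|v].
  pose st (i : 'I_m) := state_of n p lam (sval (s i)).
  have st_inj : injective st.
    move=> i i' /(state_of_inj W (svalP (s i)) (svalP (s i'))) E; apply: s_inj.
    by case: (s i) (s i') E => [L1 h1] [L2 h2] /= E; apply: eq_exist.
  have kP i : exists k, k != 0 /\ zeta_vec rho zeta (s i) = k *: gt_vec (st i).
    by have [k k0 E] := zeta_vecE (s i); exists k.
  have [k kE] := choice kP.
  (* Coefficients are indexed by states there; as [st] is injective, the sum has at most one
     term. *)
  have := @gt_vec_free _ _ _ _ W _ _ _ hw [seq st i | i <- enum 'I_m]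
    (fun z => \sum_(i | st i == z) c i * k i).
  rewrite map_inj_uniq // enum_uniq => /(_ isT) H.
  have {}H := H _ _ (st j) (map_f st (mem_enum 'I_m j)).
  have : \sum_(i | st i == st j) c i * k i = 0.
    apply: H; first by apply/allP => _ /mapP[i _ ->]; apply: pat_state_of (svalP _).
    rewrite big_map big_enum /= -[RHS]s0; apply: eq_bigr => i _.
    have [_ ->] := kE i; rewrite scalerA; congr (_ *: _).
    by rewrite (eq_bigl (pred1 i)) ?big_pred1_eq // => i'; rewrite (inj_eq st_inj).
  rewrite (eq_bigl (pred1 j)) ?big_pred1_eq => [|i']; last by rewrite (inj_eq st_inj).
  by move/eqP; rewrite mulf_eq0 (negPf (kE j).1) orbF => /eqP.
elim: (gt_span_full W hw v) => {v} [z zp||a u v _ [m1 [s1 [c1 ->]]] _ [m2 [s2 [c2 ->]]]].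
- pose L : pattern n p lam := exist _ _ (array_of_pattern W zp).
  have [k k0 E] := zeta_vecE L; exists 1%N, (fun=> L), (fun=> k^-1).
  by rewrite big_ord1 E scalerA mulVf // scale1r array_ofK.
- pose L : pattern n p lam := exist _ _ (array_of_pattern W (pat_top W)).
  by exists 0%N, (fun=> L), (fun=> 0); rewrite big_ord0.
pose j2 (T : Type) (f1 : 'I_m1 -> T) (f2 : 'I_m2 -> T) (j : 'I_(m1 + m2)) :=
  match split j with inl j => f1 j | inr j => f2 j end.
exists (m1 + m2)%N, (j2 _ s1 s2), (j2 _ (fun j => a * c1 j) c2).
rewrite big_split_ord /= scaler_sumr /j2; congr (_ + _); apply: eq_bigr => j _.
  by rewrite (unsplitK (inl j)) scalerA.
by rewrite (unsplitK (inr j)).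
Qed.

End ZetaVectors.

Local Open Scope complex_scope.

Theorem theorem3p3 (R : realType) (n : nat) (p : nat -> nat)
    (lam : nat -> nat -> R[i]) (V : lmodType R[i])
    (rho : representation (W_algebra R[i] n p) V) (zeta : V)
    (n_gt0 : (1 <= n)%N)
    (p_gt0 : forall i, (1 <= i <= n)%N -> (0 < p i)%N)
    (p_mono : forall i, (1 <= i < n)%N -> (p i <= p i.+1)%N)
    (lam_dominant : forall i k, (1 <= i < n)%N -> (1 <= k <= p i)%N ->
      is_nat (lam i k - lam i.+1 k))
    (lam_generic : forall i j k m, (1 <= i <= n)%N -> (1 <= j <= n)%N ->
      (1 <= k <= p i)%N -> (1 <= m <= p j)%N -> k != m ->
      ~ is_int (lam i k - lam j m))
    (rho_hw : is_highest_weight_rep lam rho zeta) :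
  is_basis (zeta_vec (lam := lam) rho zeta).
Proof.
apply: zeta_vec_basis rho_hw; split=> // k m kn mn.
by apply: lam_generic => //; rewrite n_gt0 leqnn.
Qed.
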